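(* Let $Q\subset\mathbb{R}^2$ be a compact convex polygon, centrally symmetric about the origin with nonempty interior, $L=\partial Q$, and consider the CC metric $d_{CC}$ on $H(\mathbb{R})$ induced by $\|\cdot\|_L$. For every $r>0$, if $B_r$ is the CC ball of radius $r$ about ${\sf 0}$, then $$\frac{\vol\bigl(\{{\sf x}\in B_r:\ \text{there is exactly one CC geodesic from }{\sf 0}\text{ to }{\sf x}\}\bigr)}{\vol(B_r)}=\frac{V_{\rm reg}}{V}.$$ In particular the asymptotic density of points reached by a unique geodesic from ${\sf 0}$ equals $V_{\rm reg}/V$.
   Context: Exponential coordinates on $H(\mathbb{R})$: $(x,y,z)(x',y',z')=(x+x',y+y',z+z'+\tfrac12(xy'-yx'))$, ${\sf 0}=(0,0,0)$, $\pi(x,y,z)=(x,y)$, $\delta_t(x,y,z)=(tx,ty,t^2z)$; vol is Lebesgue measure on $\mathbb{R}^3$. $\|\cdot\|_L$ is the norm with unit ball $Q$; $d_{CC}$ is the infimum over admissible curves ($\gamma_3'=\tfrac12(\gamma_1\gamma_2'-\gamma_2\gamma_1')$) of the $\|\cdot\|_L$-length of their projection; a CC geodesic is an admissible curve realizing the distance. $\mathcal S$ is the CC unit sphere about ${\sf 0}$, $V=\vol(B_1)$, and $V_{\rm reg}=\vol\{\delta_t{\sf p}:{\sf p}\in\mathcal S,\ \pi({\sf p})\in Q^\circ,\ 0\le t\le1\}$ where $Q^\circ$ is the interior of $Q$. *)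

(* Defs.v *)
From HB Require Import structures.
From mathcomp Require Import all_boot all_order all_algebra.
From mathcomp Require Import all_classical all_reals all_analysis.
Set Implicit Arguments. Unset Strict Implicit. Unset Printing Implicit Defensive.
Import Order.TTheory GRing.Theory Num.Theory.
Import numFieldNormedType.Exports.
Local Open Scope classical_set_scope.
Local Open Scope ring_scope.

Section Heis.
Variable R : realType.

(* Points of H(R) in exponential coordinates: ((x, y), z); pi = fst. *)
Definition hpt := ((R * R) * R)%type.
Definition horigin : hpt := ((0, 0), 0).
Definition hproj (p : hpt) : R * R := p.1.
Definition hdil (t : R) (p : hpt) : hpt :=
  ((t * p.1.1, t * p.1.2), t ^+ 2 * p.2).

Definition conv_hull (s : seq (R * R)) : set (R * R) :=
  [set v | exists w : 'I_(size s) -> R,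
     (forall i, 0 <= w i) /\ \sum_(i < size s) w i = 1 /\
     v = (\sum_(i < size s) w i * (nth (0, 0) s i).1,
          \sum_(i < size s) w i * (nth (0, 0) s i).2)].
Definition is_convex_polygon (Q : set (R * R)) : Prop :=
  exists s : seq (R * R), Q = conv_hull s.
Definition centrally_symmetric (Q : set (R * R)) : Prop :=
  forall v, Q v -> Q (- v.1, - v.2).

Definition normL (Q : set (R * R)) (v : R * R) : R :=
  inf [set t : R | 0 < t /\ Q (v.1 / t, v.2 / t)].

Definition proj_length (Q : set (R * R)) (g : R -> hpt) (a b : R) : \bar R :=
  ereal_sup [set ((\sum_(x <- pairmap (fun u v =>
        normL Q ((hproj (g v)).1 - (hproj (g u)).1,
                 (hproj (g v)).2 - (hproj (g u)).2)) a (rcons s b)) x)%:E)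
     | s in [set s : seq R | path <=%R a (rcons s b)]].

Definition lipschitz01 (f : R -> R) : Prop :=
  exists k : R, forall s t, 0 <= s <= 1 -> 0 <= t <= 1 ->
    `|f s - f t| <= k * `|s - t|.

(* Admissible (horizontal) curves parametrized on [0,1]: Lipschitz, with
   gamma_3' = 1/2 (gamma_1 gamma_2' - gamma_2 gamma_1') in integrated form. *)
Definition admissible (g : R -> hpt) : Prop :=
  lipschitz01 (fun t => (g t).1.1) /\ lipschitz01 (fun t => (g t).1.2) /\
  lipschitz01 (fun t => (g t).2) /\
  forall t, 0 <= t <= 1 ->
    (g t).2 - (g 0).2 =
      2^-1 * Rintegral lebesgue_measure [set u | 0 <= u <= t]
        (fun u => (g u).1.1 * derive1 (fun s => (g s).1.2) u
                - (g u).1.2 * derive1 (fun s => (g s).1.1) u).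

Definition dCC (Q : set (R * R)) (p q : hpt) : \bar R :=
  ereal_inf [set proj_length Q g 0 1
    | g in [set g | admissible g /\ g 0 = p /\ g 1 = q]].

Definition cc_geodesic (Q : set (R * R)) (x : hpt) (g : R -> hpt) : Prop :=
  admissible g /\ g 0 = horigin /\ g 1 = x /\
  proj_length Q g 0 1 = dCC Q horigin x /\
  forall t, 0 <= t <= 1 -> proj_length Q g 0 t = (t%:E * dCC Q horigin x)%E.

Definition unique_geodesic (Q : set (R * R)) (x : hpt) : Prop :=
  (exists g, cc_geodesic Q x g) /\
  forall g1 g2, cc_geodesic Q x g1 -> cc_geodesic Q x g2 ->
    forall t, 0 <= t <= 1 -> g1 t = g2 t.

Definition CCball (Q : set (R * R)) (r : R) : set hpt :=
  [set p | (dCC Q horigin p <= r%:E)%E].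
Definition CCsphere (Q : set (R * R)) : set hpt :=
  [set p | dCC Q horigin p = 1%:E].
Definition reg_cone (Q : set (R * R)) : set hpt :=
  [set q | exists p t, CCsphere Q p /\ (interior Q) (hproj p) /\
           0 <= t <= 1 /\ q = hdil t p].

Definition vol : set hpt -> \bar R :=
  ((@lebesgue_measure R \x @lebesgue_measure R) \x @lebesgue_measure R)%E.

Definition unique_ratio (Q : set (R * R)) (r : R) : R :=
  fine (vol (CCball Q r `&` [set x | unique_geodesic Q x])) /
  fine (vol (CCball Q r)).

End Heis.

(* Main.v *)
(** A curve is admissible iff its projection is Lipschitz and its height satisfies
    [|z t - z s - (x s * y t - y s * x t) / 2| <= C * (t - s) ^ 2] (Lipschitz functions
    are primitives of their a.e. derivative, by Radon-Nikodym and Lebesgue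
    differentiation).  Inscribed polygons then reduce the CC distance to a finite
    problem: minimize the length of a product of horizontal steps ("words").  Decomposing
    steps along the vertices of [Q] and bringing together two steps in the same direction,
    which can be done without losing area, makes every direction occur at most once, so
    minimizers exist by compactness.

    Let [x] lie over [v] with [||v|| < d x], [v] not parallel to a vertex.  A minimizing
    word maximizes the enclosed area, so exchanging consecutive blocks shows that its
    distance to the chord [v] increases and then decreases.  Two minimizers can therefore
    be subdivided so that corresponding steps [p], [q] satisfy [q ^ v = r * (p ^ v)] with a
    fixed ratio [r] of heights.  The word formed by the half steps [p / 2], [q / 2] is not
    longer and encloses [(2 + r + 1 / r) / 4] times the area plus [|p ^ q| / 8] for each
    pair; maximality forces [r = 1] and [p = q].  Hence [x] has a unique geodesic.

    If [||v|| = d x], any point strictly below another such point of the same fibre has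
    two geodesics, so over each [v] at most three points with [||v|| = d x] are reached
    uniquely.  The points with a unique geodesic in the ball of radius 1 and the regular
    cone thus differ by a null set, and dilations give all radii. *)

Require Import Defs.
From HB Require Import structures.
From mathcomp Require Import all_boot all_order all_algebra.
From mathcomp Require Import all_classical all_reals all_analysis.
From mathcomp Require Import measurable_realfun ring lra.
Import Order.TTheory GRing.Theory Num.Theory.
Import numFieldNormedType.Exports.
Local Open Scope classical_set_scope.
Local Open Scope ring_scope.
Set Implicit Arguments. Unset Strict Implicit. Unset Printing Implicit Defensive.

(** * Words and their enclosed areas *)

Section Words.
Variable R : realType.
Implicit Types (u v w : R * R) (W : seq (R * R)).

(** Geodesics are compared point by point. A point at arc length [l] on a minimizer splits [x] into
    two factors whose distances add up, so uniqueness becomes the absence of two different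
    splittings at the same [l] ([branching]). This form is stable under reflection and dilation, and
    inside a ball it is a countable union of closed sets, whence measurability.

    Minimal length and maximal area are linked by one construction: a word over [v] that encloses
    too much area is shrunk by some [t < 1] and completed by the chord [(1 - t) v], which adds no
    area. Length is strictly gained when the chord is shorter than the allowed length; here
    [||v|| < d x] enters, and the points with equality need a separate argument.

    The factor of the averaging step comes from polarization: the vectors [r p - q] are all parallel
    to [v], so their word encloses no area, and this fixes the mixed area of the two words as
    [r + 1 / r] times the common area. Directions [v] parallel to a vertex are avoided because a
    step of height zero could not be matched with a step of the other word. *)

Definition wedge u v : R := u.1 * v.2 - u.2 * v.1.
Definition vsc (t : R) v : R * R := (t * v.1, t * v.2).

Lemma wedgeDl u u' v : wedge (u + u') v = wedge u v + wedge u' v.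
Proof. by rewrite /wedge /=; ring. Qed.
Lemma wedgeDr u v v' : wedge u (v + v') = wedge u v + wedge u v'.
Proof. by rewrite /wedge /=; ring. Qed.
Lemma wedgeZl t u v : wedge (vsc t u) v = t * wedge u v.
Proof. by rewrite /wedge /=; ring. Qed.
Lemma wedgeZr t u v : wedge u (vsc t v) = t * wedge u v.
Proof. by rewrite /wedge /=; ring. Qed.
Lemma wedgeNl u v : wedge (- u) v = - wedge u v.
Proof. by rewrite /wedge /=; ring. Qed.
Lemma wedgeNr u v : wedge u (- v) = - wedge u v.
Proof. by rewrite /wedge /=; ring. Qed.
Lemma wedgevv u : wedge u u = 0.
Proof. by rewrite /wedge /=; ring. Qed.
Lemma wedgeC u v : wedge u v = - wedge v u.
Proof. by rewrite /wedge /=; ring. Qed.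
Lemma wedge0l v : wedge 0 v = 0.
Proof. by rewrite /wedge /=; ring. Qed.
Lemma wedge0r v : wedge v 0 = 0.
Proof. by rewrite /wedge /=; ring. Qed.

(** The three-term Plücker relation, expressing that three vectors of the plane are dependent. It
    drives [maximal_no_descent]. *)
Lemma wedge_plucker a b c v :
  wedge a b * wedge c v + wedge b c * wedge a v + wedge c a * wedge b v = 0.
Proof. by rewrite /wedge /=; ring. Qed.

Lemma pairE (u v : R * R) : u.1 = v.1 -> u.2 = v.2 -> u = v.
Proof. by case: u v => [a b] [c d] /= -> ->. Qed.

Lemma vscD t u v : vsc t (u + v) = vsc t u + vsc t v.
Proof. by apply: pairE => /=; ring. Qed.
Lemma vscDl s t v : vsc (s + t) v = vsc s v + vsc t v.
Proof. by apply: pairE => /=; ring. Qed.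
Lemma vsc0 t : vsc t 0 = 0.
Proof. by apply: pairE => /=; ring. Qed.
Lemma vsc0l v : vsc 0 v = 0.
Proof. by apply: pairE => /=; ring. Qed.
Lemma vsc1 v : vsc 1 v = v.
Proof. by apply: pairE => /=; ring. Qed.
Lemma vscA s t v : vsc s (vsc t v) = vsc (s * t) v.
Proof. by apply: pairE => /=; ring. Qed.
Lemma vscN1 v : vsc (-1) v = - v.
Proof. by apply: pairE => /=; ring. Qed.

Lemma pair_neq0 (v : R * R) : v != 0 -> v.1 != 0 \/ v.2 != 0.
Proof.
move=> v0; case: (eqVneq v.1 0) => [v1|]; last by left.
by right; apply: contra v0 => /eqP v2; apply/eqP/pairE.
Qed.

Lemma wedge_parallel u w v : v != 0 -> wedge u v = 0 -> wedge w v = 0 ->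
  wedge u w = 0.
Proof.
move=> /pair_neq0 v0 uv wv.
have e1 : wedge u w * v.1 = wedge u v * w.1 - wedge w v * u.1.
  by rewrite /wedge; ring.
have e2 : wedge u w * v.2 = wedge u v * w.2 - wedge w v * u.2.
  by rewrite /wedge; ring.
move: e1 e2; rewrite uv wv !mul0r subr0 => /eqP + /eqP.
rewrite !mulf_eq0; case: v0 => /negPf ->; rewrite orbF; first by move=> /eqP.
by move=> _ /eqP.
Qed.

Lemma wedge_eq u w v : wedge u w = 0 -> wedge u v = wedge w v -> wedge u v != 0 ->
  u = w.
Proof.
move=> uw uv n0.
have e1 : wedge u v * w.1 - wedge w v * u.1 = wedge u w * v.1.
  by rewrite /wedge; ring.
have e2 : wedge u v * w.2 - wedge w v * u.2 = wedge u w * v.2.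
  by rewrite /wedge; ring.
move: e1 e2; rewrite uw -uv !mul0r -!mulrBr => /eqP + /eqP.
rewrite !mulf_eq0 (negPf n0) /= !subr_eq0 => /eqP e1 /eqP e2.
exact: pairE.
Qed.

Fixpoint vsum W : R * R := if W is w :: W' then w + vsum W' else 0.
(** This is the height reached from the origin by the horizontal path with successive steps [W].
    Prepending [w] is left multiplication by [(w, 0)], which contributes half the wedge with the
    rest. *)
Fixpoint warea W : R :=
  if W is w :: W' then warea W' + 2^-1 * wedge w (vsum W') else 0.

Lemma vsum_cat A B : vsum (A ++ B) = vsum A + vsum B.
Proof. by elim: A => [|w A IH] /=; rewrite ?add0r// IH addrA. Qed.

Lemma warea_cat A B :
  warea (A ++ B) = warea A + warea B + 2^-1 * wedge (vsum A) (vsum B).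
Proof.
elim: A => [|w A IH] /=; first by rewrite wedge0l; ring.
by rewrite IH vsum_cat wedgeDl wedgeDr; ring.
Qed.

Lemma vsum_rev W : vsum (rev W) = vsum W.
Proof.
elim: W => [//|w W IH] /=.
by rewrite rev_cons -cats1 vsum_cat IH /= addr0 addrC.
Qed.

Lemma warea_rev W : warea (rev W) = - warea W.
Proof.
elim: W => [|w W IH] /=; first by rewrite oppr0.
rewrite rev_cons -cats1 warea_cat IH /= addr0 vsum_rev wedge0r.
by rewrite (wedgeC w); ring.
Qed.

Lemma vsum_scale t W : vsum (map (vsc t) W) = vsc t (vsum W).
Proof. by elim: W => [|w W IH] /=; rewrite ?vsc0// IH vscD. Qed.

Lemma warea_scale t W : warea (map (vsc t) W) = t ^+ 2 * warea W.
Proof.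
elim: W => [|w W IH] /=; first by rewrite mulr0.
by rewrite IH vsum_scale wedgeZl wedgeZr; ring.
Qed.

(** Only the mutual term of [B] and [C] changes: half their wedge turns into its opposite. Endpoint
    and length are kept, so this is the variation used to improve or test words. *)
Lemma warea_swap A B C D : warea (A ++ C ++ B ++ D) =
  warea (A ++ B ++ C ++ D) - wedge (vsum B) (vsum C).
Proof.
rewrite !warea_cat !vsum_cat !(wedgeDr, wedgeDl) (wedgeC (vsum C) (vsum B)).
by field.
Qed.

Lemma vsum_swap A B C D : vsum (A ++ C ++ B ++ D) = vsum (A ++ B ++ C ++ D).
Proof. by rewrite !vsum_cat (addrCA (vsum C)). Qed.

Lemma parallel_area v W : v != 0 ->
  (forall w, w \in W -> wedge w v = 0) -> warea W = 0 /\ wedge (vsum W) v = 0.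
Proof.
move=> v0; elim: W => [|w W IH] /= H; first by rewrite wedge0l.
have [|-> e] := IH; first by move=> x xW; apply: H; rewrite inE xW orbT.
have ew : wedge w v = 0 by apply: H; rewrite mem_head.
by rewrite wedgeDl ew e (wedge_parallel v0)//; split; ring.
Qed.

(* [L] is a common subdivision of two words into pairs of steps. *)
Implicit Types L : seq ((R * R) * (R * R)).

(** The polarization of [warea]: the coefficient of [a * b] in the area of the word with steps
    [a p + b q]. *)
Fixpoint mixed_area L : R := if L is pq :: L' then
  mixed_area L' + 2^-1 * (wedge pq.1 (vsum (unzip2 L')) + wedge pq.2 (vsum (unzip1 L')))
  else 0.

Definition comb (a b : R) L := [seq vsc a pq.1 + vsc b pq.2 | pq <- L].

Lemma vsum_comb a b L :
  vsum (comb a b L) = vsc a (vsum (unzip1 L)) + vsc b (vsum (unzip2 L)).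
Proof.
elim: L => [|pq L IH] /=; first by rewrite !vsc0 addr0.
by rewrite IH !vscD addrACA.
Qed.

Lemma warea_comb a b L : warea (comb a b L) =
  a ^+ 2 * warea (unzip1 L) + a * b * mixed_area L + b ^+ 2 * warea (unzip2 L).
Proof.
elim: L => [|pq L IH] /=; first by ring.
rewrite IH vsum_comb !(wedgeDl, wedgeDr, wedgeZl, wedgeZr); ring.
Qed.

(* Each averaged step [(p + q) / 2] is replaced by the two half steps, in the
   order enclosing the larger area. *)
Fixpoint interleave L : seq (R * R) := if L is pq :: L' then
  (if 0 <= wedge pq.1 pq.2 then [:: vsc 2^-1 pq.1; vsc 2^-1 pq.2]
   else [:: vsc 2^-1 pq.2; vsc 2^-1 pq.1]) ++ interleave L' else [::].

Lemma vsum_interleave L : vsum (interleave L) = vsum (comb 2^-1 2^-1 L).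
Proof.
elim: L => [//|[p q] L IH] /=; case: ifP => _ /=; rewrite IH.
  by rewrite addrA.
by rewrite addrA [_ + vsc _ p]addrC.
Qed.

(** Breaking the step [(p + q) / 2] into its halves adds the triangle between them, half the wedge
    of [p / 2] and [q / 2]; this is the origin of [8^-1]. The chosen order makes the sign
    positive. *)
Lemma warea_interleave L : warea (interleave L) =
  warea (comb 2^-1 2^-1 L) + 8^-1 * \sum_(pq <- L) `|wedge pq.1 pq.2|.
Proof.
elim: L => [|[p q] L IH] /=; first by rewrite big_nil; ring.
rewrite big_cons /= -[\sum_(_ <- _) _](mulVKf (_ : 8%:R != 0)) ?pnatr_eq0//.
case: ifP => pq /=.
  rewrite IH !(wedgeDl, wedgeDr, wedgeZl, wedgeZr) vsum_interleave ger0_norm//.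
  by field.
have {}pq : wedge p q < 0 by rewrite ltNge pq.
rewrite IH !(wedgeDl, wedgeDr, wedgeZl, wedgeZr) vsum_interleave ltr0_norm//.
by rewrite (wedgeC q p); field.
Qed.

(** By induction on [W]: a negative head in front of a nonempty positive block would be a forbidden
    adjacent pair. *)
Lemma no_descent_split (f : R * R -> R) W :
  (forall w, w \in W -> f w != 0) ->
  (forall X a b Y, W = X ++ a :: b :: Y -> ~ (f a < 0 /\ 0 < f b)) ->
  exists U D, [/\ W = U ++ D, (forall w, w \in U -> 0 < f w) &
                 (forall w, w \in D -> f w < 0)].
Proof.
elim: W => [|w W IH] f0 H; first by exists [::], [::].
have [||U [D [e pU pD]]] := IH.
- by move=> x xW; apply: f0; rewrite inE xW orbT.
- by move=> X a b Y e; apply: (H (w :: X) a b Y); rewrite e.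
have := f0 w (mem_head _ _); rewrite neq_lt => /orP[fw|fw]; last first.
  exists (w :: U), D; split=> //; first by rewrite e.
  by move=> x; rewrite inE => /orP[/eqP ->|/pU].
exists [::], (w :: W); split=> // x; rewrite inE => /orP[/eqP -> //|].
rewrite e; case: U pU e => [_ _ /pD//|u U pU e _].
have /= := H [::] w u (U ++ D); rewrite e => /(_ erefl)[].
by split=> //; apply: pU; rewrite mem_head.
Qed.

Lemma cat_eq_cat (T : Type) (A B C D : seq T) : A ++ B = C ++ D ->
  (exists X, C = A ++ X /\ B = X ++ D) \/ (exists X, A = C ++ X /\ D = X ++ B).
Proof.
elim: A C => [|a A IH] [|c C] /=.
- by move=> ->; left; exists [::].
- by move=> ->; left; exists (c :: C).
- by move=> <-; right; exists (a :: A).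
- by case=> -> /IH[[X [-> ->]]|[X [-> ->]]]; [left|right]; exists X.
Qed.

Variable N : R * R -> R.
Definition wlen W : R := \sum_(w <- W) N w.

Lemma wlen_cat A B : wlen (A ++ B) = wlen A + wlen B.
Proof. by rewrite /wlen big_cat. Qed.
Lemma wlen_cons w W : wlen (w :: W) = N w + wlen W.
Proof. by rewrite /wlen big_cons. Qed.
Lemma wlen_nil : wlen [::] = 0.
Proof. by rewrite /wlen big_nil. Qed.
Lemma wlen_rev W : wlen (rev W) = wlen W.
Proof. by rewrite /wlen (perm_big W)// perm_rev. Qed.
Lemma wlen_swap A B C D : wlen (A ++ C ++ B ++ D) = wlen (A ++ B ++ C ++ D).
Proof. by rewrite !wlen_cat; ring. Qed.

Hypothesis Nhom : forall t v, 0 <= t -> N (vsc t v) = t * N v.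
Hypothesis Npos : forall v, v != 0 -> 0 < N v.

Lemma wlen_scale t W : 0 <= t -> wlen (map (vsc t) W) = t * wlen W.
Proof.
move=> t0; elim: W => [|w W IH] /=; first by rewrite !wlen_nil mulr0.
by rewrite !wlen_cons IH Nhom// mulrDr.
Qed.

Lemma wlen_interleave L :
  wlen (interleave L) = 2^-1 * (wlen (unzip1 L) + wlen (unzip2 L)).
Proof.
elim: L => [|[p q] L IH] /=; first by rewrite !wlen_nil; ring.
by rewrite wlen_cat IH; case: ifP => _;
  rewrite !wlen_cons wlen_nil !Nhom ?invr_ge0//; ring.
Qed.

Definition same W W' := [/\ vsum W = vsum W', warea W = warea W' & wlen W = wlen W'].

Lemma same_cat A B A' B' : same A A' -> same B B' -> same (A ++ B) (A' ++ B').
Proof.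
move=> [a1 a2 a3] [b1 b2 b3].
by split; rewrite ?vsum_cat ?warea_cat ?wlen_cat ?a1 ?a2 ?a3 ?b1 ?b2 ?b3.
Qed.

(** Subdivision seen only through its effect on prefixes: every break point of [W] is a break point
    of [V], with the same endpoint, area and length on both sides. This is all that comparing points
    on paths requires. *)
Definition refines V W := forall P P', W = P ++ P' ->
  exists Va Vb, [/\ V = Va ++ Vb, same Va P & same Vb P'].

Lemma refines_same V W : refines V W -> same V W.
Proof.
move=> /(_ W [::]); rewrite cats0 => /(_ erefl)[Va [Vb [-> a b]]].
by rewrite -[W]cats0; exact: same_cat.
Qed.

Lemma refines_nil : refines [::] [::].
Proof. by move=> [|p P] // [|p' P'] // _; exists [::], [::]. Qed.

Lemma refines_cons w V W : refines V W -> refines (w :: V) (w :: W).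
Proof.
move=> rf [|p P] P' /=.
  move=> <-; exists [::], (w :: V); split=> //.
  by apply: (@same_cat [:: w] _ [:: w]) => //; exact: refines_same.
case=> <- /rf[Va [Vb [-> a b]]]; exists (w :: Va), Vb; split=> //.
by apply: (@same_cat [:: w] _ [:: w]).
Qed.

Lemma same_split a b w W : 0 <= a -> 0 <= b -> a + b = 1 ->
  same (vsc a w :: vsc b w :: W) (w :: W).
Proof.
move=> a0 b0 ab; split=> /=.
- by rewrite addrA -vscDl ab vsc1.
- rewrite wedgeDr !wedgeZl wedgeZr wedgevv.
  by rewrite -[in RHS](mul1r (wedge w _)) -ab; ring.
- by rewrite !wlen_cons !Nhom// addrA -mulrDl ab mul1r.
Qed.

Lemma same_trans V W X : same V W -> same W X -> same V X.
Proof. by move=> [a b c] [d e f]; split; congruence. Qed.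

Lemma refines_split a b w V W : 0 <= a -> 0 <= b -> a + b = 1 ->
  refines V (vsc b w :: W) -> refines (vsc a w :: V) (w :: W).
Proof.
move=> a0 b0 ab rf [|p P] P' /=.
  move=> <-; exists [::], (vsc a w :: V); split=> //.
  apply: same_trans (same_split w W a0 b0 ab).
  by apply: (@same_cat [:: _] _ [:: _]) => //; exact: refines_same.
case=> <- eW; have := rf (vsc b w :: P) P'; rewrite /= -eW.
move=> /(_ erefl)[Va [Vb [-> aa bb]]]; exists (vsc a w :: Va), Vb; split=> //.
apply: same_trans (same_split w P a0 b0 ab).
by apply: (@same_cat [:: _] _ [:: _]).
Qed.

Lemma refines_cat V W V' W' : refines V W -> refines V' W' ->
  refines (V ++ V') (W ++ W').
Proof.
move=> r r' P P' /cat_eq_cat[[X [-> eX]]|[X [eX ->]]].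
  have [Va [Vb [-> a b]]] := r' _ _ eX.
  exists (V ++ Va), Vb; split=> //; first by rewrite catA.
  by apply: same_cat => //; exact: refines_same.
have [Va [Vb [-> a b]]] := r _ _ eX.
exists Va, (Vb ++ V'); split=> //; first by rewrite catA.
by apply: same_cat => //; exact: refines_same.
Qed.

(** Both words cut a height interval, the first one after scaling by [r], and the two partitions are
    merged. The first steps are compared and the taller one is cut to fit, so that each round uses
    up at least one step. *)
Lemma common_refinement (c : R * R) (r : R) U1 U2 : 0 < r ->
  (forall w, w \in U1 -> 0 < wedge w c) -> (forall w, w \in U2 -> 0 < wedge w c) ->
  r * wedge (vsum U1) c = wedge (vsum U2) c ->
  exists L, [/\ refines (unzip1 L) U1, refines (unzip2 L) U2 &
    forall pq, pq \in L -> wedge pq.2 c = r * wedge pq.1 c /\ 0 < wedge pq.1 c].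
Proof.
move=> r0.
have pos U : (forall w, w \in U -> 0 < wedge w c) -> 0 <= wedge (vsum U) c.
  elim: U => [|w U IH] H /=; first by rewrite wedge0l.
  rewrite wedgeDl addr_ge0//; first by apply/ltW/H; rewrite mem_head.
  by apply: IH => x xU; apply: H; rewrite inE xU orbT.
have [n] := ubnP (size U1 + size U2)%N.
elim: n U1 U2 => [//|n IH] [|w1 U1] [|w2 U2] sz p1 p2 /=.
- by move=> _; exists [::]; split=> //; exact: refines_nil.
- rewrite wedge0l mulr0 wedgeDl => e; exfalso.
  have := p2 w2 (mem_head _ _); have : 0 <= wedge (vsum U2) c.
    by apply: pos => x xU; apply: p2; rewrite inE xU orbT.
  by lra.
- rewrite wedge0l wedgeDl => /eqP; rewrite mulf_eq0 gt_eqF//= => /eqP e; exfalso.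
  have := p1 w1 (mem_head _ _); have : 0 <= wedge (vsum U1) c.
    by apply: pos => x xU; apply: p1; rewrite inE xU orbT.
  by lra.
rewrite !wedgeDl => e.
have h1 := p1 w1 (mem_head _ _); have h2 := p2 w2 (mem_head _ _).
have p1' w : w \in U1 -> 0 < wedge w c by move=> x; apply: p1; rewrite inE x orbT.
have p2' w : w \in U2 -> 0 < wedge w c by move=> x; apply: p2; rewrite inE x orbT.
have rh1 : 0 < r * wedge w1 c by exact: mulr_gt0.
case: (ltgtP (r * wedge w1 c) (wedge w2 c)) => h.
(* The fraction of [w2] whose height matches the whole of [w1]; the remainder stays at the head of
   the second word. *)
- pose a := r * wedge w1 c / wedge w2 c.
  have a0 : 0 < a by exact: divr_gt0.
  have a1 : 0 < 1 - a by rewrite subr_gt0 ltr_pdivrMr// mul1r.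
  have aE : a * wedge w2 c = r * wedge w1 c by rewrite mulfVK// gt_eqF.
  have [||||L [r1 r2 HL]] := IH U1 (vsc (1 - a) w2 :: U2).
  + by move: sz; rewrite /= addSn ltnS.
  + exact: p1'.
  + by move=> w; rewrite inE => /orP[/eqP ->|/p2'//]; rewrite wedgeZl mulr_gt0.
  + by rewrite /= wedgeDl wedgeZl mulrBl aE mul1r; lra.
  exists ((w1, vsc a w2) :: L); split=> /=.
  + exact: refines_cons.
  + by apply: refines_split r2; [exact: ltW|exact: ltW|rewrite subrKC].
  + by move=> pq; rewrite inE => /orP[/eqP -> /=|/HL//]; rewrite wedgeZl aE.
- pose a := wedge w2 c / (r * wedge w1 c).
  have a0 : 0 < a by exact: divr_gt0.
  have a1 : 0 < 1 - a by rewrite subr_gt0 ltr_pdivrMr// mul1r.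
  have aE : r * (a * wedge w1 c) = wedge w2 c.
    by rewrite mulrCA mulfVK// gt_eqF.
  have [||||L [r1 r2 HL]] := IH (vsc (1 - a) w1 :: U1) U2.
  + by move: sz; rewrite /= addSn addnS !ltnS.
  + by move=> w; rewrite inE => /orP[/eqP ->|/p1'//]; rewrite wedgeZl mulr_gt0.
  + exact: p2'.
  + by rewrite /= wedgeDl wedgeZl mulrDr mulrBl mulrBr aE mul1r; lra.
  exists ((vsc a w1, w2) :: L); split=> /=.
  + by apply: refines_split r1; [exact: ltW|exact: ltW|rewrite subrKC].
  + exact: refines_cons.
  + move=> pq; rewrite inE => /orP[/eqP -> /=|/HL//]; rewrite wedgeZl aE.
    by rewrite mulr_gt0.
- have [||||L [r1 r2 HL]] := IH U1 U2.
  + by move: sz; rewrite /= addSn addnS !ltnS => /ltnW.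
  + exact: p1'.
  + exact: p2'.
  + by lra.
  exists ((w1, w2) :: L); split=> /=; [exact: refines_cons..|].
  by move=> pq; rewrite inE => /orP[/eqP -> /=|/HL//].
Qed.

(** Nonzero steps have positive length, so the length of a prefix determines where it ends. *)
Lemma same_prefix A B C D : A ++ B = C ++ D ->
  (forall w, w \in A ++ B -> w != 0) -> wlen A = wlen C -> A = C.
Proof.
have pos X : (forall w, w \in X -> w != 0) -> wlen X = 0 -> X = [::].
  case: X => [//|x X] H; rewrite wlen_cons => e; exfalso.
  have : 0 < N x by apply: Npos; apply: H; rewrite mem_head.
  have : 0 <= wlen X.
    rewrite /wlen big_seq; apply: sumr_ge0 => w wX; apply/ltW/Npos/H.
    by rewrite inE wX orbT.
  by lra.
move=> e H; case: (cat_eq_cat e) => -[X [eX eB]]; rewrite eX wlen_cat => l.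
  rewrite (pos X) ?cats0//; last by lra.
  by move=> w wX; apply: H; rewrite eB !mem_cat wX orbT.
rewrite (pos X) ?cats0//; last by lra.
by move=> w wX; apply: H; rewrite eX !mem_cat wX orbT.
Qed.

(** * Words of maximal area for a given endpoint and length *)

Section Maximal.
Variables (v : R * R) (z D : R).
Hypothesis z0 : 0 < z.
Hypothesis max_area : forall W, vsum W = v -> wlen W <= D -> warea W <= z.

Definition maximal W := [/\ vsum W = v, warea W = z & wlen W = D].

Lemma maximal_convex A B C E : maximal (A ++ B ++ C ++ E) ->
  0 <= wedge (vsum B) (vsum C).
Proof.
move=> [h1 h2 h3]; have := max_area (W := A ++ C ++ B ++ E).
rewrite vsum_swap wlen_swap warea_swap h1 h2 h3 => /(_ erefl (lexx _)); lra.
Qed.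

(** Let [P] be the point reached after [a]. If [a] descends and [b] ascends with respect to [v],
    block exchanges make all three terms of the Plücker relation for [a], [b], [P] nonnegative, so
    all vanish and [P] is parallel to [a]. Then [wedge a v] reduces to the wedge of [a] with the
    rest of the path, which is nonnegative by another exchange. *)
Lemma maximal_no_descent X a b Y : maximal (X ++ a :: b :: Y) ->
  ~ (wedge a v < 0 /\ 0 < wedge b v).
Proof.
move=> M [av bv].
pose P := vsum X + a; pose c := vsum Y.
have ev : v = P + b + c by case: M; rewrite vsum_cat /= => <- _ _; rewrite !addrA.
have h1 : 0 <= wedge P (b + c).
  by move: (@maximal_convex [::] (X ++ [:: a]) (b :: Y) [::]);
     rewrite /= cats0 -catA vsum_cat /= addr0; apply.
have h2 : 0 <= wedge a b.
  by move: (@maximal_convex X [:: a] [:: b] Y); rewrite /= !addr0; apply.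
have h3 : 0 <= wedge P b.
  by move: (@maximal_convex [::] (X ++ [:: a]) [:: b] Y);
     rewrite /= -catA vsum_cat /= !addr0; apply.
have h4 : 0 <= wedge P a.
  move: (@maximal_convex [::] X [:: a] (b :: Y)).
  by rewrite /= addr0 /P wedgeDl wedgevv addr0; apply.
have h5 : 0 <= wedge a (b + c).
  by move: (@maximal_convex X [:: a] (b :: Y) [::]);
     rewrite /= cats0 addr0; apply.
have Pv : 0 <= wedge P v by rewrite ev -addrA wedgeDr wedgevv add0r.
have pl := wedge_plucker a b P v.
have t1 : 0 <= wedge a b * wedge P v by exact: mulr_ge0.
have t2 : 0 <= wedge b P * wedge a v.
  by rewrite (wedgeC b P) mulNr -mulrN mulr_ge0// oppr_ge0 ltW.
have t3 : wedge P a * wedge b v = 0.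
  by apply/eqP; rewrite eq_le mulr_ge0// ?(ltW bv)// andbT; lra.
move/eqP: t3; rewrite mulf_eq0 (gt_eqF bv) orbF => /eqP Pa.
move: av; rewrite ev -addrA wedgeDr (wedgeC a P) Pa; lra.
Qed.

(** The descending half is measured against [- v], so that [common_refinement] serves both
    halves. *)
Lemma maximal_arch W : maximal W -> (forall w, w \in W -> wedge w v != 0) ->
  exists U E, [/\ W = U ++ E, (forall w, w \in U -> 0 < wedge w v) &
                 (forall w, w \in E -> 0 < wedge w (- v))].
Proof.
move=> M gen; have [||U [E [e pU pE]]] := @no_descent_split (wedge^~ v) W.
- exact: gen.
- by move=> X a b Y e; apply: (@maximal_no_descent X a b Y); rewrite -e.
- exists U, E; split=> // w /pE; rewrite wedgeNr oppr_gt0//.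
Qed.

(** The rising halves and the falling halves are matched separately, both with the ratio [r] of the
    peak heights. Averaging the matched steps gives a competitor of admissible length, and its area
    is compared with the maximum [z]. *)
Lemma maximal_unique W1 W2 P1 P1' P2 P2' : maximal W1 -> maximal W2 ->
  (forall w, w \in W1 -> wedge w v != 0) ->
  (forall w, w \in W2 -> wedge w v != 0) ->
  W1 = P1 ++ P1' -> W2 = P2 ++ P2' -> wlen P1 = wlen P2 -> same P1 P2.
Proof.
move=> M1 M2 g1 g2 e1 e2 len.
have [U1 [E1 [d1 pU1 pE1]]] := maximal_arch M1 g1.
have [U2 [E2 [d2 pU2 pE2]]] := maximal_arch M2 g2.
have gen0 : v != 0.
  apply/eqP => v0; case: W1 M1 g1 {e1 d1} => [[_ /= zz _]|w W _].
    by move: z0; rewrite -zz ltxx.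
  by move=> /(_ w (mem_head _ _)); rewrite v0 wedge0r eqxx.
(* The endpoint [v] has height zero, so rise and fall agree; they are positive, since otherwise both
   halves are empty and the area is zero. Hence the same [r] fits both halves. *)
have height (W U E : seq (R * R)) : maximal W -> W = U ++ E ->
    (forall w, w \in U -> 0 < wedge w v) -> (forall w, w \in E -> 0 < wedge w (- v)) ->
    0 < wedge (vsum U) v /\ wedge (vsum E) (- v) = wedge (vsum U) v.
  move=> [Mv Mz _] e pU pE.
  have eq : wedge (vsum E) (- v) = wedge (vsum U) v.
    have : wedge (vsum U + vsum E) v = 0 by rewrite -vsum_cat -e Mv wedgevv.
    rewrite wedgeDl wedgeNr; lra.
  split=> //.
  have pos c (X : seq (R * R)) : (forall w, w \in X -> 0 < wedge w c) -> X != [::] ->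
      0 < wedge (vsum X) c.
    elim: X => [//|x X IH] H _ /=; rewrite wedgeDl.
    have hx : 0 < wedge x c by apply: H; rewrite mem_head.
    case: X IH H => [_ _|y X IH H]; first by rewrite /= wedge0l addr0.
    by rewrite addr_gt0// IH// => w wX; apply: H; rewrite inE wX orbT.
  case: (eqVneq U [::]) => [U0|/pos]; last exact.
  rewrite -eq; apply: pos => //; apply/eqP => E0.
  by move: z0; rewrite -Mz e U0 E0 /= ltxx.
have [h1 k1] := height _ _ _ M1 d1 pU1 pE1.
have [h2 k2] := height _ _ _ M2 d2 pU2 pE2.
pose r := wedge (vsum U2) v / wedge (vsum U1) v.
have r0 : 0 < r by exact: divr_gt0.
have er : r * wedge (vsum U1) v = wedge (vsum U2) v by rewrite mulfVK// gt_eqF.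
have [LU [a1 a2 aL]] := common_refinement r0 pU1 pU2 er.
have [|LE [b1 b2 bL]] := common_refinement r0 pE1 pE2 _; first by rewrite k1 k2.
pose L := LU ++ LE.
have HL pq : pq \in L -> wedge pq.2 v = r * wedge pq.1 v /\ wedge pq.1 v != 0.
  rewrite mem_cat => /orP[/aL[-> h]|/bL]; first by rewrite gt_eqF.
  rewrite !wedgeNr oppr_gt0 => -[e h]; rewrite lt_eqF//; split=> //; lra.
have f1 : refines (unzip1 L) W1.
  by rewrite d1 /unzip1 map_cat; exact: refines_cat.
have f2 : refines (unzip2 L) W2.
  by rewrite d2 /unzip2 map_cat; exact: refines_cat.
have [s1 s1' s1''] := refines_same f1; have [s2 s2' s2''] := refines_same f2.
have [m1 m1' m1''] := M1; have [m2 m2' m2''] := M2.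
(* all steps of [r p - q] are parallel to [v], so that word encloses no area *)
have mixE : r ^+ 2 * z - r * mixed_area L + z = 0.
  have [|h _] := @parallel_area v (comb r (-1) L) gen0.
    move=> w /mapP[pq /HL[e _] ->]; rewrite wedgeDl !wedgeZl e; ring.
  by move: h; rewrite warea_comb s1' s2' m1' m2' => <-; ring.
have sum0 : 0 <= \sum_(pq <- L) `|wedge pq.1 pq.2| by exact: sumr_ge0.
have := max_area (W := interleave L).
rewrite vsum_interleave vsum_comb wlen_interleave warea_interleave warea_comb.
rewrite s1 s2 s1' s2' s1'' s2'' m1 m2 m1' m2' m1'' m2'' -vscDl.
have -> : 2^-1 + 2^-1 = 1 :> R by field.
rewrite vsc1 => /(_ erefl) H.
have {}H : r * (2^-1 ^+ 2 * z + 2^-1 * 2^-1 * mixed_area L + 2^-1 ^+ 2 * z +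
     8^-1 * (\sum_(pq <- L) `|wedge pq.1 pq.2|)) <= r * z.
  by rewrite ler_pM2l//; apply: H; lra.
(* Four times the area inequality scaled by [r], with the mixed area eliminated by [mixE]. Both
   summands are nonnegative, so both vanish. *)
have key : (r - 1) ^+ 2 * z + 2^-1 * (r * \sum_(pq <- L) `|wedge pq.1 pq.2|) <= 0.
  set S := \sum_(pq <- L) _ in H sum0 *; set m := mixed_area L in H mixE.
  have -> : (r - 1) ^+ 2 * z + 2^-1 * (r * S) =
    4 * (r * (2^-1 ^+ 2 * z + 2^-1 * 2^-1 * m + 2^-1 ^+ 2 * z + 8^-1 * S) - r * z)
    + (r ^+ 2 * z - r * m + z) by field.
  by rewrite mixE; lra.
have t1 : 0 <= (r - 1) ^+ 2 * z by rewrite mulr_ge0// ?sqr_ge0// ltW.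
have t2 : 0 <= r * \sum_(pq <- L) `|wedge pq.1 pq.2| by rewrite mulr_ge0// ltW.
have r1 : r = 1.
  have /eqP : (r - 1) ^+ 2 * z = 0 by lra.
  by rewrite mulf_eq0 sqrf_eq0 (gt_eqF z0) orbF subr_eq0 => /eqP.
have S0 : \sum_(pq <- L) `|wedge pq.1 pq.2| = 0.
  have /eqP : r * \sum_(pq <- L) `|wedge pq.1 pq.2| = 0 by lra.
  by rewrite mulf_eq0 (gt_eqF r0) /= => /eqP.
(* Matched steps are parallel because their wedge vanishes, and they have the same nonzero height
   because [r = 1]. *)
have eL pq : pq \in L -> pq.1 = pq.2.
  move=> h; have [ev nv] := HL _ h; rewrite r1 mul1r in ev.
  apply: (wedge_eq (v := v)) => //.
  move/eqP: S0; rewrite big_seq psumr_eq0// => /allP/(_ _ h).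
  by rewrite h /= normr_eq0 => /eqP.
(* Both words are now refined by one and the same word, whose prefixes are determined by their
   length. *)
have e12 : unzip1 L = unzip2 L by apply/eq_in_map => pq /eL.
have nz w : w \in unzip1 L -> w != 0.
  move=> /mapP[pq /HL[_ h] ->]; apply: contra h => /eqP ->.
  by rewrite wedge0l.
have [A1 [B1 [x1 y1 _]]] := f1 _ _ e1.
have [A2 [B2 [x2 y2 _]]] := f2 _ _ e2.
have eA : A1 = A2.
  apply: (@same_prefix A1 B1 A2 B2); first by rewrite -x1 -x2.
    by rewrite -x1.
  by case: y1 y2 => _ _ -> [_ _ ->].
by case: y1 y2; rewrite eA => a1' a2' a3' [b1' b2' b3']; split; congruence.
Qed.

End Maximal.
End Words.

(** * Lipschitz functions as primitives *)

Section LipschitzFTC.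
Variable R : realType.
Notation mu := (@lebesgue_measure R).

(** The Lipschitz bound says that [H x = M * x - G x] is nondecreasing as well. Lebesgue measure is
    therefore [M^-1] times the sum of the Stieltjes measures of [G] and [H], so the first is
    absolutely continuous and has a Radon-Nikodym density. The constant values 0 and 1 at the two
    ends make it a finite measure. *)
Lemma lip_density (G : R -> R) (M : R) : 0 < M ->
  {homo G : x y / x <= y} -> (forall x y, x <= y -> G y - G x <= M * (y - x)) ->
  (forall x, x <= 0 -> G x = 0) -> (forall x, 1 <= x -> G x = 1) ->
  exists h : R -> R, [/\ forall x, 0 <= h x, mu.-integrable setT (EFin \o h) &
    forall a b, a <= b -> (\int[mu]_(x in `]a, b]) (h x)%:E = (G b - G a)%:E)%E].
Proof.
move=> M0 ndG lipG G0 G1.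
have cont (F : R -> R) : (forall x y, `|F x - F y| <= M * `|x - y|) -> continuous F.
  move=> FM x; apply/(@cvgrPdist_le _ R^o) => e e0; near=> y.
  apply: le_trans (FM _ _) _; rewrite -ler_pdivlMl// mulrC.
  by near: y; apply: cvgr_dist_le => //; rewrite divr_gt0.
have lipG' x y : `|G x - G y| <= M * `|x - y|.
  wlog xy : x y / x <= y.
    by move=> H; case: (leP x y) => [|/ltW] /H//; rewrite distrC (distrC y).
  rewrite distrC ger0_norm ?subr_ge0 ?ndG// distrC ger0_norm ?subr_ge0//.
  exact: lipG.
have rcG : right_continuous G by apply: right_continuousW; exact: cont lipG'.
pose H x := M * x - G x.
have ndH : {homo H : x y / x <= y}.
  by move=> x y xy; have := lipG _ _ xy; rewrite /H; lra.
have rcH : right_continuous H.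
  apply: right_continuousW; move=> x; apply: cvgB; last exact: cont lipG' x.
  by apply: cvgM; [exact: cvg_cst|exact: cvg_id].
have GNy : G @ -oo --> (0 : R).
  apply: cvg_near_cst; near=> x; apply: G0; near: x; exact: nbhs_ninfty_le.
have Gy : G @ +oo --> (1 : R).
  apply: cvg_near_cst; near=> x; apply: G1; near: x; exact: nbhs_pinfty_ge.
pose cG : cumulativeBounded (0:R) (1:R) := HB.pack G
  (isCumulative.Build R _ R G ndG rcG) (isCumulativeBounded.Build R 0 1 G GNy Gy).
pose cH : cumulative R R := HB.pack H (isCumulative.Build R _ R H ndH rcH).
have lsE (F : cumulative R R) a b : a <= b ->
    lebesgue_stieltjes_measure F `]a, b]%classic = (F b - F a)%:E.
  move=> ab; rewrite /lebesgue_stieltjes_measure /measure_extension.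
  by rewrite measurable_mu_extE/=; [rewrite wlength_itv_bnd|exact: is_ocitv].
pose nG := lebesgue_stieltjes_measure cG.
pose nH := lebesgue_stieltjes_measure cH.
have M'0 : 0 <= M^-1 by rewrite invr_ge0 ltW.
pose s : {measure set (measurableTypeR R) -> \bar R} :=
  mscale (NngNum M'0) (measure_add nG nH).
have sE A : s A = ((M^-1)%:E * (nG A + nH A))%E.
  by rewrite -measure_addE.
have lebE A : measurable A -> mu A = s A.
  apply: lebesgue_measure_unique => X /ocitvP[->|[[a b]/= ab ->]].
    by rewrite !measure0.
  rewrite sE /nG /nH !lsE ?(ltW ab)//.
  rewrite /lebesgue_measure lsE ?(ltW ab)//= -EFinD -EFinM; congr EFin.
  by rewrite /H; field; rewrite gt_eqF.
have dom : nG `<< mu.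
  apply/null_content_dominatesP => A mA A0.
  have : ((M^-1)%:E * (nG A + nH A) = 0)%E by rewrite -sE -lebE.
  move=> /eqP; rewrite mule_eq0 eqe invr_eq0 (gt_eqF M0) /= => /eqP e.
  apply/eqP; rewrite eq_le measure_ge0 andbT -[X in (_ <= X)%E]e.
  by rewrite leeDl// measure_ge0.
have [f [f0 ffin fint fE]] :=
  @radon_nikodym_sigma_finite _ _ _ mu nG dom.
exists (fine \o f); split.
- by move=> x; rewrite fine_ge0.
- by apply: eq_integrable fint => // x _; rewrite /= fineK.
- move=> a b ab; have e1 := lsE cG _ _ ab.
  have e2 := fE `]a, b]%classic (measurable_itv _).
  apply: etrans (etrans (esym e2) e1).
  by apply: eq_integral => x _; rewrite /= fineK.
Unshelve. all: by end_near. Qed.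

End LipschitzFTC.

(** * Integrals of functions that differ on a null set *)

Section NullIntegral.
Import HBNNSimple.
Context d (T : measurableType d) (R : realType) (mu : {measure set T -> \bar R}).
Local Open Scope ereal_scope.

(** Stated for arbitrary [f] and [g], since the integrand of [admissible] contains [derive1] at
    points where it carries no information. The integral is a supremum over simple functions below
    [f]; cutting such a function to the complement of [N] keeps its integral and puts it below
    [g]. *)
Lemma ge0_integralT_le_off_null (N : set T) (f g : T -> \bar R) :
  measurable N -> mu N = 0 -> (forall x, 0 <= f x) -> (forall x, 0 <= g x) ->
  (forall x, ~ N x -> f x <= g x) -> \int[mu]_x f x <= \int[mu]_x g x.
Proof.
move=> mN N0 f0 g0 fg; rewrite !ge0_integralTE//.
apply: ge_ereal_sup => _ [h hf <-].
apply: ereal_sup_ubound; exists (proj_nnsfun h (measurableC mN)).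
  move=> x; rewrite -mrestrict patchE; case: ifPn => // /set_mem Nx.
  exact: le_trans (hf x) (fg _ Nx).
rewrite -!integralT_nnsfun; apply: ge0_ae_eq_integral => //.
- exact/measurable_EFinP.
- exact/measurable_EFinP.
- by move=> x _; rewrite lee_fin.
- by move=> x _; rewrite lee_fin.
exists N; split=> // x nx; apply: contrapT => Nx; apply: nx => _.
by rewrite -mrestrict patchE mem_set.
Qed.

Lemma integral_eq_off_null (D N : set T) (f g : T -> \bar R) :
  measurable N -> mu N = 0 -> (forall x, D x -> ~ N x -> f x = g x) ->
  \int[mu]_(x in D) f x = \int[mu]_(x in D) g x.
Proof.
move=> mN N0 fg; rewrite integral_mkcond [RHS]integral_mkcond.
have e x : ~ N x -> (f \_ D) x = (g \_ D) x.
  by move=> Nx; rewrite !patchE; case: ifPn => // /set_mem Dx; exact: fg.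
rewrite integralE [RHS]integralE; congr (_ - _).
  by apply/eqP; rewrite eq_le; apply/andP; split;
    apply: (ge0_integralT_le_off_null mN N0) => // x Nx; rewrite !funeposE e.
by apply/eqP; rewrite eq_le; apply/andP; split;
  apply: (ge0_integralT_le_off_null mN N0) => // x Nx; rewrite !funenegE e.
Qed.
End NullIntegral.

(** * Almost everywhere derivatives of Lipschitz functions on the unit interval *)

Section LipschitzDerivative.
Variable R : realType.
Notation mu := (@lebesgue_measure R).
Local Notation Rint A h := (Rintegral mu A h).

(** The retraction onto the unit interval: composing with it extends a function known to be
    Lipschitz on [[0, 1]] to a Lipschitz function on the line. *)
Definition clamp01 (x : R) : R := Num.min (Num.max x 0) 1.

Lemma clamp01_ge0 x : 0 <= clamp01 x.
Proof. by rewrite /clamp01 le_min ler01 le_max lexx orbT. Qed.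
Lemma clamp01_le1 x : clamp01 x <= 1.
Proof. by rewrite /clamp01 ge_min lexx orbT. Qed.
Lemma clamp01_itv x : 0 <= clamp01 x <= 1.
Proof. by rewrite clamp01_ge0 clamp01_le1. Qed.
Lemma clamp01_id x : 0 <= x <= 1 -> clamp01 x = x.
Proof. by move=> /andP[x0 x1]; rewrite /clamp01 (max_idPl x0) (min_idPl x1). Qed.
Lemma clamp01_le0 x : x <= 0 -> clamp01 x = 0.
Proof. by move=> x0; rewrite /clamp01 (max_idPr x0) (min_idPl ler01). Qed.
Lemma clamp01_gt1 x : 1 <= x -> clamp01 x = 1.
Proof.
by move=> x1; rewrite /clamp01 (max_idPl (le_trans ler01 x1)) (min_idPr x1).
Qed.

Lemma clamp01_homo x y : x <= y -> clamp01 x <= clamp01 y /\ clamp01 y - clamp01 x <= y - x.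
Proof.
move=> xy; rewrite /clamp01 !minEle !maxEle.
by do ! case: ifPn; rewrite -?ltNge => *; split; lra.
Qed.

(** Here [h] is the density of [f] and [N] the exceptional null set. The derivative is identified on
    the open interval only: [f] is arbitrary outside [[0, 1]], so nothing is known of [derive1 f] at
    the endpoints. *)
Record lip_primitive (f h : R -> R) (C : R) (N : set R) := LipPrimitive {
  lp_integrable : mu.-integrable `[0, 1] (EFin \o h);
  lp_primitive : forall s t, 0 <= s -> s <= t -> t <= 1 ->
    Rint `]s, t] h = f t - f s;
  lp_bound : forall s t, 0 <= s -> s <= t -> t <= 1 ->
    Rint `]s, t] (fun x => `|h x|) <= C * (t - s);
  lp_mnull : measurable N;
  lp_null : mu N = 0%E;
  lp_derive : forall x, 0 < x < 1 -> ~ N x -> derive1 f x = h x }.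

(** Adding a large slope [K] to [f] makes it increasing, so that its normalization [G] is a
    distribution function with a density [g]. Undoing this gives [h = c * g - K], and Lebesgue
    differentiation identifies [h] with the derivative almost everywhere. *)
Lemma lipschitz01_primitive f : lipschitz01 f -> exists h C N, lip_primitive f h C N.
Proof.
move=> [k fk].
(* The extra 1 keeps the total increment [c] positive, so that one can divide by it. *)
pose K := `|k| + 1.
have fK s t : 0 <= s <= 1 -> 0 <= t <= 1 -> `|f s - f t| <= `|k| * `|s - t|.
  by move=> s01 t01; apply: le_trans (fk _ _ s01 t01) _; rewrite ler_wpM2r// ler_norm.
pose F x := f (clamp01 x) + K * clamp01 x.
pose c := F 1 - F 0.
have c0 : 0 < c.
  rewrite /c /F clamp01_gt1// clamp01_le0// mulr1 mulr0.
  have := fK 0 1; rewrite lexx ler01 /= lexx => /(_ erefl erefl).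
  by rewrite sub0r normrN1 mulr1 ler_norml => /andP[]; rewrite /K; lra.
have Fle x y : x <= y -> F x <= F y /\ F y - F x <= (`|k| + K) * (y - x).
  move=> /clamp01_homo[h1 h2].
  have := fK _ _ (clamp01_itv y) (clamp01_itv x).
  rewrite (ger0_norm (_ : 0 <= clamp01 y - clamp01 x)) ?subr_ge0//.
  rewrite ler_norml => /andP[a b].
  have k0 : 0 <= `|k| by [].
  have : (`|k| + K) * (clamp01 y - clamp01 x) <= (`|k| + K) * (y - x).
    by rewrite ler_wpM2l// /K; lra.
  rewrite /F; move: a b; rewrite /K => a b e; split; lra.
pose G x := (F x - F 0) / c.
have M0 : 0 < (`|k| + K) / c.
  by rewrite divr_gt0// /K; have : 0 <= `|k| by []; lra.
have [g [g0 gint gE]] : exists g : R -> R, [/\ forall x, 0 <= g x,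
    mu.-integrable setT (EFin \o g) &
    forall a b, a <= b -> (\int[mu]_(x in `]a, b]) (g x)%:E = (G b - G a)%:E)%E].
  apply: (lip_density M0).
  - by move=> x y /Fle[xy _]; rewrite /G ler_pM2r ?invr_gt0// lerD2r.
  - move=> x y /Fle[_ xy]; rewrite /G -mulrBl mulrAC ler_pM2r ?invr_gt0//; lra.
  - by move=> x x0; rewrite /G /F !clamp01_le0// subrr mul0r.
  - by move=> x x1; rewrite /G /F (clamp01_gt1 x1) -/(F 1) /F
      -[in X in X / _](clamp01_gt1 (lexx 1)) divff// gt_eqF.
have fE x : 0 <= x <= 1 -> f x = c * G x + F 0 - K * x.
  move=> x01; rewrite /G mulrC divfK ?gt_eqF// /F (clamp01_id x01).
  by rewrite clamp01_le0//; ring.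
pose h x := c * g x - K.
have mg : measurable_fun setT g.
  by move/integrableP : gint => [/measurable_EFinP].
have mh : measurable_fun setT h.
  by apply: measurable_funB => //; exact: measurable_funM.
have Kint (A : set R) : measurable A -> (mu A < +oo)%E ->
    mu.-integrable A (EFin \o (fun=> K)).
  by move=> mA Afin; apply: measurable_bounded_integrable => //; exact: bounded_cst.
have gint' (A : set R) : measurable A -> mu.-integrable A (EFin \o g).
  by move=> mA; apply: integrableS gint.
have cgint (A : set R) : measurable A -> mu.-integrable A (EFin \o (fun x => c * g x)).
  move=> mA; rewrite (_ : EFin \o _ = (fun x => c%:E * (g x)%:E)%E)//.
  by apply: integrableZl => //; exact: gint'.
have itvfin s t : (mu `]s, t] < +oo)%E.
  by rewrite lebesgue_measure_itv; case: ifP => _; rewrite ?ltry// -EFinD ltry.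
have intE s t : s <= t -> Rint `]s, t] g = G t - G s.
  by move=> st; rewrite /Rintegral gE.
have KE s t : s <= t -> Rint `]s, t] (fun=> K) = K * (t - s).
  move=> st; have muE : mu `]s, t]%classic = (t - s)%:E.
    rewrite lebesgue_measure_itv /= lte_fin.
    by case: ltgtP st => // -> _; rewrite subrr.
  transitivity (K * fine (mu `]s, t]%classic)); last by rewrite muE.
  by apply: Rintegral_cst.
have [N [mN N0 NE]] : {ae mu, forall x, (BRight (0:R) < BRight x)%O ->
    derivable (fun y : R => Rint `]0, y] g) x 1 /\
    derive1 (fun y : R => Rint `]0, y] g) x = g x}.
  apply: (@FTC1 _ g (BRight (0:R))) => [y|]; first exact: gint'.
  exact: (open_integrable_locally openT).
(* In the constant, [|k| + K] bounds the slope of [F] and the last [K] accounts for the slope that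
   is subtracted again. *)
exists h, ((`|k| + K) + K), N; split=> //.
- have -> : EFin \o h = ((EFin \o (fun x => c * g x)%R) \- (EFin \o (fun=> K)))%E by [].
  apply: integrableB => //; first exact: cgint.
  by apply: Kint => //; rewrite lebesgue_measure_itv /=; case: ifP => _; rewrite ?ltry// -EFinD ltry.
- move=> s t s0 st t1; rewrite /h RintegralB//; [|exact: cgint|exact: Kint].
  rewrite RintegralZl//; last exact: gint'.
  rewrite intE// KE// !fE; [ring|lra|lra].
- move=> s t s0 st t1.
  apply: (@le_trans _ _ (Rint `]s, t] (fun x => c * g x + K))).
    apply: le_Rintegral => //.
    + have : mu.-integrable `]s, t] (EFin \o h).
        have -> : EFin \o h = ((EFin \o (fun x => c * g x)%R) \- (EFin \o (fun=> K)))%E by [].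
        by apply: integrableB => //; [exact: cgint|exact: Kint].
      by move/integrable_abse; apply: eq_integrable.
    + have -> : EFin \o (fun x => c * g x + K) = ((EFin \o (fun x => c * g x)%R) \+ (EFin \o (fun=> K)))%E by [].
      by apply: integrableD => //; [exact: cgint|exact: Kint].
    + move=> x _; rewrite /h; apply: le_trans (ler_normB _ _) _.
      by rewrite !ger0_norm// ?mulr_ge0// ?ltW// /K ltr_wpDl.
  rewrite RintegralD//; [|exact: cgint|exact: Kint].
  rewrite RintegralZl//; last exact: gint'.
  rewrite intE// KE//.
  have -> : c * (G t - G s) = F t - F s.
    by rewrite /G -mulrBl mulrC divfK ?gt_eqF//; ring.
  by have [_] := Fle _ _ st; lra.
- move=> x x01 Nx; have [dF dE] : derivable (fun y : R => Rint `]0, y] g) x 1 /\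
    derive1 (fun y : R => Rint `]0, y] g) x = g x.
    apply: contrapT => H; apply: Nx; apply: NE => /= H'; apply: H; apply: H'.
    by rewrite bnd_simp; case/andP: x01.
  have dF' : is_derive x 1 (fun y : R => Rint `]0, y] g) (g x).
    by split=> //; rewrite -derive1E.
  have : is_derive x 1 (fun y : R => c * Rint `]0, y] g + F 0 - K * y) (c * g x + 0 - K * 1).
    by apply: is_deriveB; apply: is_deriveD.
  move=> H; rewrite derive1E.
  have {}H : is_derive x 1 f (c * g x + 0 - K * 1).
    apply: near_eq_is_derive H; near=> y.
    have y01 : 0 < y < 1.
      near: y; apply: (near_in_itvoo (a := 0) (b := 1)).
      by rewrite in_itv/=.
    rewrite fE; last by lra.
    rewrite intE; last by lra.
    by rewrite /G subrr mul0r subr0.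
  by have [_ ->] := H; rewrite /h; ring.
Unshelve. all: by end_near. Qed.

End LipschitzDerivative.

(** * Admissible curves *)

Section Admissible.
Variable R : realType.
Notation mu := (@lebesgue_measure R).
Local Notation Rint A h := (Rintegral mu A h).

Lemma lipschitz01_bounded (f : R -> R) : lipschitz01 f ->
  exists M, 0 <= M /\ forall t, 0 <= t <= 1 -> `|f t| <= M.
Proof.
move=> [k fk]; exists (`|f 0| + `|k|); split=> [|t t01]; first by rewrite addr_ge0.
have := fk t 0 t01; rewrite lexx ler01 subr0 => /(_ erefl) h.
rewrite -[f t](subrK (f 0)) addrC; apply: le_trans (ler_normD _ _) _.
rewrite lerD2l; apply: le_trans h _; apply: le_trans (ler_norm _) _.
rewrite normrM normr_id ler_piMr//.
by case/andP: t01 => t0 t1; rewrite ger0_norm.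
Qed.

Lemma lipschitz01_clamp_continuous (f : R -> R) : lipschitz01 f ->
  continuous (f \o @clamp01 R).
Proof.
move=> [k fk] x; apply/(@cvgrPdist_le _ R^o) => e e0; near=> y.
have k0 : 0 < `|k| + 1 by rewrite ltr_wpDl.
have h : `|clamp01 x - clamp01 y| <= `|x - y|.
  have [xy|/ltW xy] := leP x y.
    have [h1 h2] := clamp01_homo xy.
    by rewrite distrC ger0_norm ?subr_ge0// distrC ger0_norm ?subr_ge0.
  by have [h1 h2] := clamp01_homo xy; rewrite !ger0_norm ?subr_ge0.
apply: le_trans (fk _ _ (clamp01_itv _) (clamp01_itv _)) _.
apply: (@le_trans _ _ ((`|k| + 1) * `|x - y|)).
  apply: (@le_trans _ _ ((`|k| + 1) * `|clamp01 x - clamp01 y|)).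
    by rewrite ler_wpM2r// (le_trans (ler_norm _))// lerDl.
  by rewrite ler_wpM2l// ltW.
rewrite -ler_pdivlMl// mulrC.
by near: y; apply: cvgr_dist_le => //; rewrite divr_gt0.
Unshelve. all: by end_near. Qed.

(** Over [n + 1] equal pieces of [[0, t]] the increments add up to at most [C * t ^ 2 / (n + 1)],
    which tends to zero. *)
Lemma quadratic_increment_const (f : R -> R) (C : R) :
  (forall s t, 0 <= s -> s <= t -> t <= 1 -> `|f t - f s| <= C * (t - s) ^+ 2) ->
  forall t, 0 <= t <= 1 -> f t = f 0.
Proof.
move=> H t /andP[t0 t1]; apply/eqP; rewrite -subr_eq0 -normr_le0.
have step (n : nat) : `|f t - f 0| <= C * t ^+ 2 / n.+1%:R.
  have n0 : (n.+1%:R : R) != 0 by rewrite pnatr_eq0.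
  have gen (m : nat) : (m <= n.+1)%N ->
      `|f (t * (m%:R / n.+1%:R)) - f 0| <= m%:R * (C * (t / n.+1%:R) ^+ 2).
    elim: m => [_|m IH mn]; first by rewrite !(mul0r, mulr0) subrr normr0.
    apply: le_trans (ler_distD (f (t * (m%:R / n.+1%:R))) _ _) _.
    have -> : m.+1%:R * (C * (t / n.+1%:R) ^+ 2) =
        C * (t / n.+1%:R) ^+ 2 + m%:R * (C * (t / n.+1%:R) ^+ 2).
      by rewrite -natr1; ring.
    apply: lerD; last by apply: IH; exact: ltnW.
    have d : t * (m.+1%:R / n.+1%:R) - t * (m%:R / n.+1%:R) = t / n.+1%:R.
      by rewrite -natr1; field.
    apply: le_trans (H _ _ _ _ _) _.
    - by rewrite mulr_ge0// divr_ge0.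
    - by rewrite -subr_ge0 d divr_ge0.
    - rewrite (le_trans _ t1)// ler_piMr// ler_pdivrMr// mul1r ler_nat//.
    - by rewrite d.
  have := gen n.+1 (leqnn _); rewrite divff// mulr1.
  by congr (_ <= _); field.
apply/ler_addgt0Pr => e e0; rewrite add0r.
have [N HN] : exists N : nat, C * t ^+ 2 / e < N%:R.
  exists (Num.bound `|C * t ^+ 2 / e|).
  exact: le_lt_trans (ler_norm _) (archi_boundP (normr_ge0 _)).
apply: le_trans (step N) _; rewrite ler_pdivrMr//; move: HN.
rewrite ltr_pdivrMr// => /ltW h; apply: le_trans h _.
by rewrite mulrC ler_wpM2l ?ler_nat// ltW.
Qed.

(** The derivative-free form of admissibility. The quantity bounded is the height of the group
    increment from [g s] to [g t] (see [hdiff2]), so the condition is invariant under left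
    translation. *)
Definition horizontal (g : R -> hpt R) := [/\ lipschitz01 (fun t => (g t).1.1),
  lipschitz01 (fun t => (g t).1.2) &
  exists C, forall s t, 0 <= s -> s <= t -> t <= 1 ->
    `|(g t).2 - (g s).2 - 2^-1 * wedge (g s).1 (g t).1| <= C * (t - s) ^+ 2].

(** Twice the signed area swept from the origin by the plane curve [(x, y)]. *)
Definition area_integral (x y : R -> R) (t : R) := Rint [set u | 0 <= u <= t]
  (fun u => x u * derive1 y u - y u * derive1 x u).

(** Freezing [x] and [y] at time [s] in the integrand produces exactly the wedge. In what remains,
    the factors [x u - x s] and [y u - y s] are of order [t - s], and so are the integrals of the
    absolute derivatives that they multiply. *)
Lemma area_integral_expansion (x y : R -> R) : lipschitz01 x -> lipschitz01 y ->
  exists C, forall s t, 0 <= s -> s <= t -> t <= 1 ->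
    `|area_integral x y t - area_integral x y s - wedge (x s, y s) (x t, y t)|
      <= C * (t - s) ^+ 2.
Proof.
move=> lx ly.
have [hx [Cx [Nx px]]] := lipschitz01_primitive lx.
have [hy [Cy [Ny py]]] := lipschitz01_primitive ly.
pose x' := x \o @clamp01 R; pose y' := y \o @clamp01 R.
have mx : measurable_fun setT x' by apply: continuous_measurable_fun; exact: lipschitz01_clamp_continuous.
have my : measurable_fun setT y' by apply: continuous_measurable_fun; exact: lipschitz01_clamp_continuous.
have [Mx [Mx0 bx]] := lipschitz01_bounded lx.
have [My [My0 by']] := lipschitz01_bounded ly.
pose P u := x' u * hy u - y' u * hx u.
have itvS s t : 0 <= s -> t <= 1 -> `]s, t] `<=` (`[0, 1]%classic : set R).
  move=> s0 t1 u /=; rewrite !in_itv /= => /andP[su ut].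
  by rewrite (le_trans s0 (ltW su)) (le_trans ut t1).
have prodint (f h : R -> R) (M : R) (D : set R) : measurable D ->
    measurable_fun setT f -> (forall u, `|f u| <= M) ->
    mu.-integrable D (EFin \o h) -> mu.-integrable D (EFin \o (fun u => f u * h u)).
  move=> mD mf fM ih.
  have -> : EFin \o (fun u => f u * h u) = ((EFin \o f) \* (EFin \o h))%E by [].
  apply: integrableMr => //; first exact: measurable_funS mf.
  exists M; split; first by rewrite num_real.
  by move=> K MK u _; apply: le_trans (fM u) (ltW MK).
have Pint : mu.-integrable `[0, 1] (EFin \o P).
  have -> : EFin \o P = ((EFin \o (fun u => x' u * hy u)%R) \-
      (EFin \o (fun u => y' u * hx u)%R))%E by [].
  apply: integrableB => //.
    apply: (prodint _ _ Mx) => //; last exact: lp_integrable py.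
    by move=> u; apply: bx; exact: clamp01_itv.
  apply: (prodint _ _ My) => //; last exact: lp_integrable px.
  by move=> u; apply: by'; exact: clamp01_itv.
(* The two endpoints join the exceptional set because [lip_derive] information exists only in the
   open interval. *)
pose N := Nx `|` Ny `|` ([set 0] `|` [set 1]).
have mN : measurable N.
  by apply: measurableU; apply: measurableU => //;
    [exact: lp_mnull px|exact: lp_mnull py].
have N0 : mu N = 0%E.
  have null_U A B : measurable A -> measurable B -> mu A = 0%E -> mu B = 0%E ->
      mu (A `|` B) = 0%E.
    move=> mA mB A0 B0; apply/eqP; rewrite eq_le measure_ge0 andbT.
    apply: (@le_trans _ _ (mu A + mu B)%E); first exact: measureU2.
    by rewrite A0 B0 adde0.
  apply: (@null_U _ _); [apply: measurableU; [exact: lp_mnull px|exact: lp_mnull py]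
                 |exact: measurableU| |].
    apply: (@null_U _ _); [exact: lp_mnull px|exact: lp_mnull py|exact: lp_null px|
      exact: lp_null py].
  by apply: (@null_U _ _) => //; exact: lebesgue_measure_set1.
have [kx hkx] := lx; have [ky hky] := ly.
exists (`|kx| * Cy + `|ky| * Cx) => s t s0 st t1; pose I := area_integral x y; rewrite -/I.
have IE r : r <= 1 -> I r = Rint `[0, r] P.
  move=> r1; rewrite /I /area_integral -set_itvcc /Rintegral; congr fine.
  apply: (@integral_eq_off_null _ _ _ mu _ N _ _ mN N0) => u /=; rewrite in_itv /= => /andP[u0 ur] Nu.
  have u01 : 0 <= u <= 1 by rewrite u0 (le_trans ur r1).
  have u01' : 0 < u < 1.
    rewrite !lt_neqAle u0 (le_trans ur r1) !andbT; apply/andP; split.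
      by apply/eqP => e; apply: Nu; right; left; rewrite /= -e.
    by apply/eqP => e; apply: Nu; right; right; rewrite /= e.
  rewrite (lp_derive px u01')//; last by move=> h; apply: Nu; left; left.
  rewrite (lp_derive py u01')//; last by move=> h; apply: Nu; left; right.
  by rewrite /P /x' /y' /= clamp01_id.
pose D : set R := `]s, t]%classic.
have mD : measurable D by exact: measurable_itv.
have ist : I t - I s = Rint D P.
  rewrite !IE//; last exact: le_trans st t1.
  apply: Rintegral_itvB; rewrite ?bnd_simp//.
  by apply: integrableS Pint => //; apply: subset_itvl; rewrite bnd_simp.
have ihx : mu.-integrable D (EFin \o hx).
  by apply: integrableS (lp_integrable px) => //; exact: itvS.
have ihy : mu.-integrable D (EFin \o hy).
  by apply: integrableS (lp_integrable py) => //; exact: itvS.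
have iP : mu.-integrable D (EFin \o P).
  by apply: integrableS Pint => //; exact: itvS.
have cint (c : R) h : mu.-integrable D (EFin \o h) ->
    mu.-integrable D (EFin \o (fun u => c * h u)).
  move=> ih; have -> : EFin \o (fun u => c * h u) = (fun u => c%:E * (h u)%:E)%E by [].
  exact: integrableZl.
pose q u := P u - (x s * hy u - y s * hx u).
have iL : mu.-integrable D (EFin \o (fun u => x s * hy u - y s * hx u)).
  have -> : EFin \o (fun u => x s * hy u - y s * hx u) =
    ((EFin \o (fun u => x s * hy u)%R) \- (EFin \o (fun u => y s * hx u)%R))%E by [].
  by apply: integrableB => //; exact: cint.
have iq : mu.-integrable D (EFin \o q).
  have -> : EFin \o q = ((EFin \o P) \-
    (EFin \o (fun u => x s * hy u - y s * hx u)%R))%E by [].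
  exact: integrableB.
have absint h : mu.-integrable D (EFin \o h) ->
    mu.-integrable D (EFin \o (fun u => `|h u|)).
  by move/integrable_abse; apply: eq_integrable.
have -> : I t - I s - wedge (x s, y s) (x t, y t) = Rint D q.
  have -> : Rint D q = Rint D P - Rint D (fun u => x s * hy u - y s * hx u).
    exact: RintegralB.
  have -> : Rint D (fun u => x s * hy u - y s * hx u) =
      Rint D (fun u => x s * hy u) - Rint D (fun u => y s * hx u).
    by apply: RintegralB => //; exact: cint.
  rewrite !RintegralZl// (lp_primitive px)// (lp_primitive py)// ist /wedge /=.
  by ring.
pose B u := `|kx| * (t - s) * `|hy u| + `|ky| * (t - s) * `|hx u|.
have iB : mu.-integrable D (EFin \o B).
  have -> : EFin \o B = ((EFin \o (fun u => `|kx| * (t - s) * `|hy u|)%R) \+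
    (EFin \o (fun u => `|ky| * (t - s) * `|hx u|)%R))%E by [].
  by apply: integrableD => //; apply: cint; exact: absint.
apply: (@le_trans _ _ (Rint D (fun u => `|q u|))); first exact: le_normr_Rintegral.
apply: (@le_trans _ _ (Rint D B)).
  apply: le_Rintegral => //; first exact: absint.
  move=> u; rewrite /D /= in_itv /= => /andP[su ut].
  have u01 : 0 <= u <= 1 by rewrite (le_trans s0 (ltW su)) (le_trans ut t1).
  have s01 : 0 <= s <= 1 by rewrite s0 (le_trans st t1).
  have -> : q u = (x u - x s) * hy u - (y u - y s) * hx u.
    by rewrite /q /P /x' /y' /= clamp01_id//; ring.
  have lip (f : R -> R) k : (forall s t, 0 <= s <= 1 -> 0 <= t <= 1 ->
      `|f s - f t| <= k * `|s - t|) -> `|f u - f s| <= `|k| * (t - s).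
    move=> H; apply: le_trans (H _ _ u01 s01) _.
    have su' : 0 <= u - s by rewrite subr_ge0 ltW.
    rewrite (ger0_norm su').
    apply: (@le_trans _ _ (`|k| * (u - s))).
      by rewrite ler_wpM2r ?ler_norm.
    by rewrite ler_wpM2l// lerD2r.
  apply: le_trans (ler_normB _ _) _; rewrite !normrM.
  by apply: lerD; rewrite ler_wpM2r// lip.
rewrite RintegralD//; [|by apply: cint; exact: absint..].
rewrite !RintegralZl//; [|exact: absint..].
have ts0 : 0 <= t - s by rewrite subr_ge0.
have -> : (`|kx| * Cy + `|ky| * Cx) * (t - s) ^+ 2 =
  `|kx| * (t - s) * (Cy * (t - s)) + `|ky| * (t - s) * (Cx * (t - s)) by ring.
by apply: lerD; rewrite ler_wpM2l ?mulr_ge0//;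
  [exact: (lp_bound py)|exact: (lp_bound px)].
Qed.

(** Both the height and half the area integral expand as half a wedge up to a quadratic error.
    Forwards this is the expansion itself; backwards the difference of the two has quadratic
    increments and is therefore constant. *)
Lemma admissibleP (g : R -> hpt R) : admissible g <-> horizontal g.
Proof.
split=> [[lx [ly [lz gz]]]|[lx ly [C gz]]].
  split=> //; have [C H] := area_integral_expansion lx ly.
  exists (2^-1 * C) => s t s0 st t1; have := H _ _ s0 st t1 => /=.
  have -> : (g t).2 - (g s).2 = ((g t).2 - (g 0).2) - ((g s).2 - (g 0).2) by ring.
  rewrite !gz; [|by rewrite s0 (le_trans st)|by rewrite t1 (le_trans s0)].
  rewrite -[((g s).1.1, (g s).1.2)]surjective_pairing.
  rewrite -[((g t).1.1, (g t).1.2)]surjective_pairing => h.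
  by rewrite -!mulrBr normrM ger0_norm ?invr_ge0// -mulrA ler_wpM2l ?invr_ge0.
have [Mx [Mx0 bx]] := lipschitz01_bounded lx.
have [My [My0 bY]] := lipschitz01_bounded ly.
have lz : lipschitz01 (fun t => (g t).2).
  have [kx hx] := lx; have [ky hy] := ly.
  pose K := `|C| + (Mx * `|ky| + My * `|kx|); exists K.
  have main s t : 0 <= s -> s <= t -> t <= 1 -> `|(g t).2 - (g s).2| <= K * (t - s).
    move=> s0 st t1; have ts0 : 0 <= t - s by rewrite subr_ge0.
    have s01 : 0 <= s <= 1 by rewrite s0 (le_trans st).
    have t01 : 0 <= t <= 1 by rewrite t1 (le_trans s0).
    rewrite -[_ - _](subrK (2^-1 * wedge (g s).1 (g t).1)).
    apply: le_trans (ler_normD _ _) _; rewrite /K mulrDl; apply: lerD.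
      apply: le_trans (gz _ _ s0 st t1) _; rewrite expr2 mulrA ler_wpM2r//.
      apply: (@le_trans _ _ (`|C| * (t - s))); first by rewrite ler_wpM2r// ler_norm.
      by rewrite ler_piMr//; lra.
    have -> : wedge (g s).1 (g t).1 = (g s).1.1 * ((g t).1.2 - (g s).1.2) -
        (g s).1.2 * ((g t).1.1 - (g s).1.1) by rewrite /wedge; ring.
    rewrite normrM ger0_norm ?invr_ge0//.
    apply: (@le_trans _ _ (Mx * (`|ky| * (t - s)) + My * (`|kx| * (t - s)))); last lra.
    apply: (@le_trans _ _ (`|(g s).1.1 * ((g t).1.2 - (g s).1.2) -
        (g s).1.2 * ((g t).1.1 - (g s).1.1)|)).
      by rewrite ler_piMl// invf_le1// ler1n.
    apply: le_trans (ler_normB _ _) _; rewrite !normrM.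
    have l (f : R -> R) k : (forall s t, 0 <= s <= 1 -> 0 <= t <= 1 ->
      `|f s - f t| <= k * `|s - t|) -> `|f t - f s| <= `|k| * (t - s).
      move=> H; apply: le_trans (H _ _ t01 s01) _; rewrite ger0_norm//.
      by rewrite ler_wpM2r// ler_norm.
    by apply: lerD; apply: ler_pM => //; [exact: bx|exact: (l (fun t => (g t).1.2))
      |exact: bY|exact: (l (fun t => (g t).1.1))].
  move=> s t /andP[s0 s1] /andP[t0 t1]; case: (leP s t) => [st|/ltW ts].
    by rewrite distrC (distrC s) (ger0_norm (_ : 0 <= t - s)) ?subr_ge0//; exact: main.
  by rewrite (ger0_norm (_ : 0 <= s - t)) ?subr_ge0//; exact: main.
split=> //; split=> //; split=> //.
have [C' H] := area_integral_expansion lx ly.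
pose I := area_integral (fun t => (g t).1.1) (fun t => (g t).1.2).
pose f t := (g t).2 - 2^-1 * I t.
have fc : forall t, 0 <= t <= 1 -> f t = f 0.
  apply: (@quadratic_increment_const _ (C + 2^-1 * C')) => s t s0 st t1.
  have h1 := gz _ _ s0 st t1; have h2 := H _ _ s0 st t1; move: h2 => /=.
  rewrite -[((g s).1.1, (g s).1.2)]surjective_pairing.
  rewrite -[((g t).1.1, (g t).1.2)]surjective_pairing -/(I t) -/(I s) => h2.
  have -> : f t - f s = ((g t).2 - (g s).2 - 2^-1 * wedge (g s).1 (g t).1) -
     2^-1 * (I t - I s - wedge (g s).1 (g t).1) by rewrite /f; ring.
  apply: le_trans (ler_normB _ _) _; rewrite mulrDl; apply: lerD => //.
  by rewrite normrM ger0_norm ?invr_ge0// -mulrA ler_wpM2l ?invr_ge0.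
have I0 : I 0 = 0.
  rewrite /I /area_integral (_ : [set u | _] = [set 0]); first by rewrite Rintegral_set1.
  by apply/seteqP; split=> u /=; [rewrite -eq_le => /eqP|move=> ->; rewrite lexx].
by move=> t t01; have := fc t t01; rewrite /f I0 -[Rintegral _ _ _]/(I t); lra.
Qed.
End Admissible.

(** * The polygonal gauge *)

Section ConeMinimum.
Variables (R : realType) (n : nat).

Definition nonneg_row (c : 'rV[R]_n) := forall i, 0 <= c ord0 i.
Definition rsum (c : 'rV[R]_n) : R := \sum_i c ord0 i.

Lemma rsum_ge0 c : nonneg_row c -> 0 <= rsum c.
Proof. by move=> c0; apply: sumr_ge0. Qed.

Lemma coord_le_rsum c i : nonneg_row c -> c ord0 i <= rsum c.
Proof.
by move=> c0; rewrite /rsum (bigD1 i)//= lerDl; apply: sumr_ge0.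
Qed.

Lemma continuous_linear_row (a : 'I_n -> R) :
  continuous (fun c : 'rV[R]_n => \sum_i c ord0 i * a i).
Proof.
apply: (continuous_big (@add_continuous R)) => i _ c.
apply: (@cvgM R _ (nbhs c) _); last exact: cvg_cst.
exact: coord_continuous.
Qed.

Lemma continuous_rsum : continuous rsum.
Proof.
apply: (continuous_big (@add_continuous R)) => i _; exact: coord_continuous.
Qed.

(** A nonnegative row whose sum is at most that of a known candidate [c0] lies in the compact box
    with sides [[0, rsum c0]], so the minimum is taken there. *)
Lemma min_rsum_closed (P : set 'rV[R]_n) : closed P ->
  (exists2 c, P c & nonneg_row c) ->
  exists c, [/\ P c, nonneg_row c &
    forall c', P c' -> nonneg_row c' -> rsum c <= rsum c'].
Proof.
move=> cP [c0 Pc0 c00].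
pose box : set 'rV[R]_n := [set c | forall i, `[0, rsum c0]%classic (c ord0 i)].
have [|||c] := @compact_EVT_min _ _ rsum (box `&` P).
- exists c0; split=> // i; rewrite /= in_itv /= c00; exact: coord_le_rsum.
- apply: compact_closedI => //.
  apply: (@rV_compact R n (fun=> `[0, rsum c0]%classic)) => i; exact: segment_compact.
- apply: continuous_subspaceT; exact: continuous_rsum.
rewrite inE => -[bc Pc] min; exists c; split=> //.
  by move=> i; have := bc i; rewrite /= in_itv /= => /andP[].
move=> c' Pc' c'0; case: (leP (rsum c') (rsum c0)) => h.
  apply: min; rewrite inE; split=> // i; rewrite /= in_itv /= c'0.
  exact: le_trans (coord_le_rsum _ c'0) h.
apply: le_trans (ltW h); apply: min; rewrite inE; split=> // i.
by rewrite /= in_itv /= c00; exact: coord_le_rsum.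
Qed.

End ConeMinimum.

(** * The norm as a minimal sum of coefficients over the vertices *)

Section Gauge.
Variables (R : realType) (s : seq (R * R)).
Notation n := (size s).
Notation Q := (conv_hull s).
Hypothesis Qsym : centrally_symmetric Q.
Hypothesis Qint : interior Q !=set0.
Notation N := (normL Q).
Implicit Types (u v w : R * R) (c : 'rV[R]_n).

Definition vert (i : 'I_n) : R * R := nth (0, 0) s i.
Definition lin c : R * R :=
  (\sum_i c ord0 i * (vert i).1, \sum_i c ord0 i * (vert i).2).

Lemma lin_scale t c : lin (t *: c) = vsc t (lin c).
Proof.
by apply: pairE => /=; rewrite mulr_sumr; apply: eq_bigr => i _; rewrite mxE mulrA.
Qed.

Lemma linD c c' : lin (c + c') = lin c + lin c'.
Proof.
by apply: pairE; rewrite /= -big_split; apply: eq_bigr => i _; rewrite mxE mulrDl.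
Qed.

Lemma rsum_scale t c : rsum (t *: c) = t * rsum c.
Proof. by rewrite /rsum mulr_sumr; apply: eq_bigr => i _; rewrite mxE. Qed.

Lemma rsumD c c' : rsum (c + c') = rsum c + rsum c'.
Proof. by rewrite /rsum -big_split; apply: eq_bigr => i _; rewrite mxE. Qed.

Lemma nonneg_scale t c : 0 <= t -> nonneg_row c -> nonneg_row (t *: c).
Proof. by move=> t0 c0 i; rewrite mxE mulr_ge0. Qed.

Lemma nonnegD c c' : nonneg_row c -> nonneg_row c' -> nonneg_row (c + c').
Proof. by move=> c0 c0' i; rewrite mxE addr_ge0. Qed.

Lemma rsum_eq0 c : nonneg_row c -> rsum c = 0 -> lin c = 0.
Proof.
move=> c0 t0; have z i : c ord0 i = 0.
  by apply/eqP; rewrite eq_le c0 andbT -t0 coord_le_rsum.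
by apply: pairE; apply: big1 => i _; rewrite z mul0r.
Qed.

Lemma conv_hullP v : Q v <-> exists c, [/\ nonneg_row c, rsum c = 1 & lin c = v].
Proof.
split=> [[w [w0 [w1 ->]]]|[c [c0 c1 <-]]].
  exists (\row_i w i); split; first by move=> i; rewrite mxE.
    by rewrite -w1; apply: eq_bigr => i _; rewrite mxE.
  by apply: pairE; apply: eq_bigr => i _; rewrite mxE.
by exists (fun i => c ord0 i).
Qed.

Lemma conv_hull_divP v t : 0 < t ->
  Q (v.1 / t, v.2 / t) <-> exists c, [/\ nonneg_row c, rsum c = t & lin c = v].
Proof.
move=> t0; have tn : t != 0 by rewrite gt_eqF.
rewrite conv_hullP; split=> -[c [c0 c1 cv]].
  exists (t *: c); split; first exact/nonneg_scale/c0/ltW.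
    by rewrite rsum_scale c1 mulr1.
  by rewrite lin_scale cv; apply: pairE => /=; field.
exists (t^-1 *: c); split; first by apply: nonneg_scale c0; rewrite invr_ge0 ltW.
  by rewrite rsum_scale c1 mulVf.
by rewrite lin_scale cv; apply: pairE => /=; field.
Qed.

Lemma interior_box (A : set (R * R)) v : interior A v ->
  exists2 e, 0 < e & forall w, `|w.1 - v.1| < e -> `|w.2 - v.2| < e -> A w.
Proof.
move=> /nbhs_ballP[e /= e0 H]; exists e => // w h1 h2; apply: H.
by split; rewrite /ball /= distrC.
Qed.

(** If [Q] contains a box around [q], then [v] is the midpoint of [q + 2 v] and of [- q], which
    belongs to [Q] by symmetry. *)
Lemma conv_hull_nbhs0 : exists2 e, 0 < e & forall v, `|v.1| < e -> `|v.2| < e -> Q v.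
Proof.
have [q /interior_box[e e0 H]] := Qint.
have Qq : Q q by apply: H; rewrite subrr normr0.
have [c [c0 c1 cq]] := (conv_hullP _).1 (Qsym Qq).
exists (e / 2); first by rewrite divr_gt0.
move=> v h1 h2.
have b (x : R) : `|x| < e / 2 -> `|2 * x| < e.
  by rewrite ltr_pdivlMr// normrM mulrC ger0_norm.
have /conv_hullP[c' [c'0 c'1 c'q]] : Q (q + vsc 2 v).
  by apply: H; rewrite /= addrAC subrr add0r; exact: b.
apply/conv_hullP; exists (2^-1 *: (c + c')); split.
- by apply: nonneg_scale; [rewrite invr_ge0|exact: nonnegD].
- by rewrite rsum_scale rsumD c1 c'1; field.
- by rewrite lin_scale linD cq c'q; apply: pairE => /=; field.
Qed.

Lemma conv_hull0 : Q 0.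
Proof. by have [e e0 H] := conv_hull_nbhs0; apply: H; rewrite normr0. Qed.

Lemma conv_hull_absorbing : exists2 C, 0 < C & forall v t, 0 < t ->
  C * (`|v.1| + `|v.2|) <= t -> Q (v.1 / t, v.2 / t).
Proof.
have [e e0 H] := conv_hull_nbhs0; exists (2 / e); first by rewrite divr_gt0.
move=> v t t0; rewrite mulrAC ler_pdivrMr// => h.
have v1 : 0 <= `|v.1| by []. have v2 : 0 <= `|v.2| by [].
have te : 0 < t * e by rewrite mulr_gt0.
by apply: H; rewrite /= normrM normfV (gtr0_norm t0) ltr_pdivrMr// mulrC; lra.
Qed.

Lemma normL_le_rsum c : nonneg_row c -> N (lin c) <= rsum c.
Proof.
(* The infimum in [normL] runs over positive [t], so coefficient sum zero is reached only as a
   limit. *)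
move=> c0; have [t0|t0] := ltP 0 (rsum c); last first.
  have {}t0 : rsum c = 0 by apply/eqP; rewrite eq_le t0 rsum_ge0.
  rewrite t0 (rsum_eq0 c0 t0); apply/ler_addgt0Pr => e e0; rewrite add0r.
  apply: ge_inf; first by exists 0 => t [/ltW].
  by split=> //=; rewrite !mul0r; exact: conv_hull0.
apply: ge_inf; first by exists 0 => t [/ltW].
by split=> //; apply/conv_hull_divP => //; exists c.
Qed.

Lemma closed_lin_eq v : closed [set c | lin c = v].
Proof.
have -> : [set c | lin c = v] =
    (fun c => \sum_i c ord0 i * (vert i).1) @^-1` [set v.1] `&`
    (fun c => \sum_i c ord0 i * (vert i).2) @^-1` [set v.2].
  by apply/seteqP; split=> c /= => [<-|[h1 h2]] //; exact: pairE.
by apply: closedI; apply: preimage_closed; do ?exact: closed_eq;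
  move=> c _; exact: continuous_linear_row.
Qed.

(** The norm as the value of an attained linear program. The norm axioms and the splitting of steps
    along vertices all rest on this description. *)
Lemma normL_decomp v : exists c, [/\ nonneg_row c, lin c = v & rsum c = N v].
Proof.
have [C C0 HC] := conv_hull_absorbing.
have [|c [cv c0 cmin]] := min_rsum_closed (@closed_lin_eq v).
  have t0 : 0 < C * (`|v.1| + `|v.2|) + 1 by rewrite ltr_wpDl// mulr_ge0// ltW.
  have [|c [c0 _ cv]] := (conv_hull_divP v t0).1; last by exists c.
  by apply: HC => //; rewrite lerDl.
exists c; split=> //; apply/eqP; rewrite eq_le -{2}cv normL_le_rsum// andbT.
apply: lb_le_inf.
  have t0 : 0 < C * (`|v.1| + `|v.2|) + 1 by rewrite ltr_wpDl// mulr_ge0// ltW.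
  by exists (C * (`|v.1| + `|v.2|) + 1); split=> //; apply: HC => //; rewrite lerDl.
move=> t [t0 /(conv_hull_divP v t0)[c' [c'0 <- c'v]]].
exact: cmin.
Qed.

Lemma normL_ge0 v : 0 <= N v.
Proof. by have [c [c0 _ <-]] := normL_decomp v; exact: rsum_ge0. Qed.

Lemma normL_gt0 v : v != 0 -> 0 < N v.
Proof.
move=> v0; rewrite lt0r normL_ge0 andbT; apply: contra v0 => /eqP N0.
by have [c [c0 cv tc]] := normL_decomp v; rewrite -cv rsum_eq0// tc.
Qed.

Lemma normL0 : N 0 = 0.
Proof.
apply/eqP; rewrite eq_le normL_ge0 andbT.
have z : nonneg_row (0 : 'rV[R]_n) by move=> i; rewrite mxE.
have t0 : rsum (0 : 'rV[R]_n) = 0 by apply: big1 => i _; rewrite mxE.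
by have := normL_le_rsum z; rewrite rsum_eq0// t0.
Qed.

Lemma normLZ_le t v : 0 <= t -> N (vsc t v) <= t * N v.
Proof.
move=> t0; have [c [c0 cv <-]] := normL_decomp v.
by rewrite -cv -lin_scale -rsum_scale normL_le_rsum//; exact: nonneg_scale.
Qed.

Lemma normLZ t v : 0 <= t -> N (vsc t v) = t * N v.
Proof.
rewrite le_eqVlt => /predU1P[<-|t0]; first by rewrite vsc0l normL0 mul0r.
apply/eqP; rewrite eq_le normLZ_le ?(ltW t0)//=.
have := @normLZ_le t^-1 (vsc t v); rewrite vscA mulVf ?gt_eqF// vsc1 invr_ge0.
by move=> /(_ (ltW t0)); rewrite -(ler_pM2l t0) mulrA divff ?gt_eqF// mul1r.
Qed.

Lemma normL_triangle u v : N (u + v) <= N u + N v.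
Proof.
have [c [c0 <- <-]] := normL_decomp u; have [c' [c'0 <- <-]] := normL_decomp v.
by rewrite -linD -rsumD normL_le_rsum//; exact: nonnegD.
Qed.

Lemma normLN v : N (- v) = N v.
Proof.
have le u : N (- u) <= N u.
  case: (eqVneq u 0) => [->|u0]; first by rewrite oppr0.
  have N0 := normL_gt0 u0.
  have [c [c0 cu tc]] := normL_decomp u.
  have /(conv_hull_divP u N0) Qu : exists c, [/\ nonneg_row c, rsum c = N u & lin c = u].
    by exists c.
  have := Qsym Qu; rewrite /= -!mulNr => /(conv_hull_divP (- u) N0)[c' [c'0 <- <-]].
  exact: normL_le_rsum.
by apply/eqP; rewrite eq_le le -{1}[v]opprK le.
Qed.

Lemma normL_vert i : N (vert i) <= 1.
Proof.
pose c : 'rV[R]_n := delta_mx ord0 i.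
have ci j : c ord0 j = (j == i)%:R by rewrite mxE eqxx.
have -> : vert i = lin c.
  by apply: pairE => /=; rewrite (bigD1 i)//= big1 ?ci ?eqxx ?mul1r ?addr0// => j ji;
    rewrite ci (negPf ji) mul0r.
have <- : rsum c = 1.
  by rewrite /rsum (bigD1 i)//= big1 ?ci ?eqxx ?addr0// => j ji; rewrite ci (negPf ji).
by apply: normL_le_rsum => j; rewrite ci ler0n.
Qed.

Lemma normL_upper : exists2 C, 0 < C & forall v, N v <= C * (`|v.1| + `|v.2|).
Proof.
have [C C0 HC] := conv_hull_absorbing; exists C => // v.
apply/ler_addgt0Pr => e e0; apply: ge_inf; first by exists 0 => t [/ltW].
have t0 : 0 < C * (`|v.1| + `|v.2|) + e by rewrite ltr_wpDl// mulr_ge0// ltW.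
by split=> //; apply: HC => //; rewrite lerDl ltW.
Qed.

Lemma normL_lower : exists2 M, 0 < M & forall v, `|v.1| + `|v.2| <= M * N v.
Proof.
exists (\sum_i (`|(vert i).1| + `|(vert i).2|) + 1).
  by rewrite ltr_wpDl// sumr_ge0// => i _; rewrite addr_ge0.
move=> v; have [c [c0 <- <-]] := normL_decomp v.
have b (f : 'I_n -> R) : `|\sum_i c ord0 i * f i| <= (\sum_i `|f i|) * rsum c.
  apply: le_trans (ler_norm_sum _ _ _) _; rewrite mulr_suml; apply: ler_sum => i _.
  by rewrite normrM (ger0_norm (c0 i)) mulrC ler_wpM2l// coord_le_rsum.
rewrite /= big_split /= mulrDl mulrDl mul1r.
by rewrite -[X in X <= _]addr0 lerD ?rsum_ge0// lerD.
Qed.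

Lemma conv_hull_normL v : Q v <-> N v <= 1.
Proof.
split=> [/conv_hullP[c [c0 <- <-]]|Nv]; first exact: normL_le_rsum.
have [c [c0 cv tc]] := normL_decomp v.
have [c' [c'0 c'1 c'v]] := (conv_hullP 0).1 conv_hull0.
(* The missing weight is filled up with a convex combination representing 0. *)
apply/conv_hullP; exists (c + (1 - N v) *: c'); split.
- by apply: nonnegD => //; apply: nonneg_scale => //; rewrite subr_ge0.
- by rewrite rsumD rsum_scale tc c'1 mulr1 subrKC.
- by rewrite linD lin_scale cv c'v vsc0 addr0.
Qed.

Lemma interior_normL v : interior Q v <-> N v < 1.
Proof.
split=> [/interior_box[e e0 H]|Nv].
  (* Small enough for [(1 + d) v] to stay in the box inside [Q]; the summand 1 covers [v = 0]. *)
  pose d := e / (2 * (`|v.1| + `|v.2| + 1)).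
  have v1 : 0 <= `|v.1| by []. have v2 : 0 <= `|v.2| by [].
  have m0 : 0 < 2 * (`|v.1| + `|v.2| + 1) by lra.
  have d0 : 0 < d by exact: divr_gt0.
  have small (x : R) : `|x| <= `|v.1| + `|v.2| -> `|(1 + d) * x - x| < e.
    move=> hx; have -> : (1 + d) * x - x = d * x by ring.
    rewrite normrM (gtr0_norm d0) /d mulrAC ltr_pdivrMr// ltr_pM2l//; lra.
  have : Q (vsc (1 + d) v) by apply: H => /=; apply: small; lra.
  have d1 : 0 <= 1 + d by lra.
  rewrite conv_hull_normL normLZ// => h.
  case: (ltP (N v) 1) => // h1; have : (1 + d) * 1 <= (1 + d) * N v by rewrite ler_wpM2l.
  by lra.
have [C C0 HC] := normL_upper.
pose e := (1 - N v) / (2 * C).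
have e0 : 0 < e by rewrite divr_gt0 ?mulr_gt0// subr_gt0.
apply/nbhs_ballP; exists e => //= w [/=]; rewrite /ball /= => h1 h2.
apply/conv_hull_normL; rewrite -[w](subrK v) addrC.
apply: le_trans (normL_triangle _ _) _.
have : N (w - v) <= C * (e + e).
  apply: le_trans (HC _) _; rewrite ler_pM2l//= lerD//; rewrite distrC; exact: ltW.
have -> : C * (e + e) = 1 - N v by rewrite /e; field; rewrite gt_eqF.
by lra.
Qed.

End Gauge.

(** * Word distance on the Heisenberg group *)

Section Group.
Variable R : realType.
Implicit Types (p q r : hpt R).

Definition hmul p q : hpt R := (p.1 + q.1, p.2 + q.2 + 2^-1 * wedge p.1 q.1).
Definition hinv p : hpt R := (- p.1, - p.2).
(** An anti-automorphism of the group, realized on words by reading them backwards. It reduces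
    negative heights to positive ones. *)
Definition hrefl p : hpt R := (p.1, - p.2).

Lemma hptE p q : p.1 = q.1 -> p.2 = q.2 -> p = q.
Proof. by case: p q => [a b] [c d] /= -> ->. Qed.

Lemma hmulA p q r : hmul p (hmul q r) = hmul (hmul p q) r.
Proof.
apply: hptE => /=; first exact: addrA.
by rewrite wedgeDl wedgeDr; ring.
Qed.

Lemma hmulVK p q : hmul (hinv p) (hmul p q) = q.
Proof.
apply: hptE => /=; first exact: addKr.
by rewrite wedgeDr !wedgeNl wedgevv; ring.
Qed.

Lemma hmulKV p q : hmul p (hmul (hinv p) q) = q.
Proof.
apply: hptE => /=; first exact: addNKr.
by rewrite wedgeDr wedgeNr wedgeNl wedgevv; ring.
Qed.

Lemma hinvM p q : hinv (hmul p q) = hmul (hinv q) (hinv p).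
Proof.
apply: hptE => /=; first by rewrite opprD addrC.
by rewrite wedgeNl wedgeNr (wedgeC q.1); ring.
Qed.

Lemma hinvK p : hinv (hinv p) = p.
Proof. by apply: hptE => /=; rewrite opprK. Qed.

Lemma hmulVV p q r : hmul (hinv (hmul p q)) (hmul p r) = hmul (hinv q) r.
Proof. by rewrite hinvM -hmulA hmulVK. Qed.

Lemma hmul0p p : hmul (horigin R) p = p.
Proof.
apply: hptE => /=; first by rewrite add0r.
by rewrite wedge0l; ring.
Qed.

Lemma hmulp0 p : hmul p (horigin R) = p.
Proof.
apply: hptE => /=; first by rewrite addr0.
by rewrite wedge0r; ring.
Qed.

Lemma hmulVp p : hmul (hinv p) p = horigin R.
Proof.
apply: hptE => /=; first by rewrite addNr.
by rewrite wedgeNl wedgevv; ring.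
Qed.

Lemma hreflK p : hrefl (hrefl p) = p.
Proof. by apply: hptE => //=; rewrite opprK. Qed.

Lemma hreflM p q : hrefl (hmul p q) = hmul (hrefl q) (hrefl p).
Proof.
apply: hptE => /=; first by rewrite addrC.
by rewrite (wedgeC q.1); ring.
Qed.

Definition wpt (W : seq (R * R)) : hpt R := (vsum W, warea W).

Lemma wpt_cat A B : wpt (A ++ B) = hmul (wpt A) (wpt B).
Proof. by rewrite /wpt vsum_cat warea_cat. Qed.

End Group.

(** * Reduction to words in the vertices and existence of minimizers *)

Section Dist.
Variables (R : realType) (s : seq (R * R)).
Notation n := (size s).
Notation Q := (conv_hull s).
Hypothesis Qsym : centrally_symmetric Q.
Hypothesis Qint : interior Q !=set0.
Notation N := (normL Q).
Notation len := (wlen N).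
Implicit Types (u v w : R * R) (c : 'rV[R]_n) (W : seq (R * R)).
Let Nhom := normLZ Qsym Qint.
Let Npos := normL_gt0 Qsym Qint.
Let Nge0 := normL_ge0 Qsym Qint.

Lemma wlen_ge0 W : 0 <= len W.
Proof. by apply: sumr_ge0 => w _; exact: Nge0. Qed.

Lemma normL_vsum W : N (vsum W) <= len W.
Proof.
elim: W => [|w W IH] /=; first by rewrite wlen_nil (normL0 Qsym Qint).
by rewrite wlen_cons; apply: le_trans (normL_triangle Qsym Qint _ _) _; rewrite lerD2l.
Qed.

Definition vword (ew : seq ('I_n * R)) : seq (R * R) :=
  [seq vsc ia.2 (vert ia.1) | ia <- ew].

Definition coef (ew : seq ('I_n * R)) : R := \sum_(ia <- ew) ia.2.
Definition nonneg_word (ew : seq ('I_n * R)) := all (fun ia => 0 <= ia.2) ew.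

Lemma vword_cat A B : vword (A ++ B) = vword A ++ vword B.
Proof. exact: map_cat. Qed.

Lemma not_uniq_split (T : eqType) (l : seq T) : ~~ uniq l ->
  exists x X Y Z, l = X ++ x :: Y ++ x :: Z.
Proof.
elim: l => [//|x l IH] /=; rewrite negb_and negbK => /orP[|/IH[y [X [Y [Z ->]]]]].
  by move=> /splitPr[Y Z]; exists x, [::], Y, Z.
by exists y, (x :: X), Y, Z.
Qed.

(** Let [S] be the sum of the block between two occurrences of a vertex. Moving the first occurrence
    across the block and moving the second one across it change the area with opposite signs, so one
    of the two moves loses nothing. The occurrences then merge and the word gets shorter. *)
Lemma word_uniq (ew : seq ('I_n * R)) : nonneg_word ew ->
  exists ew', [/\ nonneg_word ew', uniq (map fst ew'), vsum (vword ew') = vsum (vword ew),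
    warea (vword ew) <= warea (vword ew') & coef ew' = coef ew].
Proof.
have [m] := ubnP (size ew); elim: m ew => [//|m IH] ew sz pos.
have [u|/not_uniq_split] := boolP (uniq (map fst ew)); first by exists ew; split.
move=> [i [X [Y [Z e]]]].
have [A [a [B [b [C E]]]]] : exists A a B b C, ew = A ++ (i, a) :: B ++ (i, b) :: C.
  pose x := size X; pose y := size Y.
  have szX : size (take x ew) = x.
    rewrite size_take_min; apply/minn_idPl; rewrite -(size_map fst) e size_cat.
    by rewrite leq_addr.
  have := congr1 (drop x) e; rewrite drop_size_cat// -map_drop.
  case e1 : (drop x ew) => [//|[j a] ew1] /= [ji e2].
  have := congr1 (drop y) e2; rewrite drop_size_cat// -map_drop.
  case e3 : (drop y ew1) => [//|[k b] ew2] /= [ki e4].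
  exists (take x ew), a, (take y ew1), b, ew2.
  by rewrite -[LHS](cat_take_drop x) e1 -[in LHS](cat_take_drop y ew1) e3 ji ki.
move: pos; rewrite E /nonneg_word all_cat /= all_cat /= => /and4P[pA a0 pB /andP[b0 pC]].
have ab0 : 0 <= a + b by exact: addr_ge0.
pose S := vsum (vword B).
have merge X' Y' : vsum (vword (X' ++ (i, a) :: (i, b) :: Y')) = vsum (vword (X' ++ (i, a + b) :: Y')) /\
    warea (vword (X' ++ (i, a) :: (i, b) :: Y')) = warea (vword (X' ++ (i, a + b) :: Y')).
  rewrite !vword_cat /= !vsum_cat !warea_cat /= vscDl !addrA; split=> //.
  by rewrite !(wedgeDr, wedgeDl, wedgeZl, wedgeZr) wedgevv; ring.
have step (ew1 : seq ('I_n * R)) : (size ew1 < size ew)%N -> nonneg_word ew1 ->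
    vsum (vword ew1) = vsum (vword ew) -> warea (vword ew) <= warea (vword ew1) ->
    coef ew1 = coef ew -> exists ew', [/\ nonneg_word ew', uniq (map fst ew'),
    vsum (vword ew') = vsum (vword ew), warea (vword ew) <= warea (vword ew') &
    coef ew' = coef ew].
  move=> s1 p1 v1 a1 c1; have [|ew' [h1 h2 h3 h4 h5]] := IH ew1 _ p1.
    by rewrite -ltnS; exact: leq_trans s1 _.
  by exists ew'; split=> //; rewrite ?h3 ?h5//; exact: le_trans h4.
have szlt X' Y' : (size X' + size Y' = size A + size B + size C)%N ->
    (size (X' ++ (i, (a + b)%R) :: Y') < size ew)%N.
  by move=> h; rewrite E !size_cat /= size_cat /= !addnS !ltnS h addnA.
have coE X' Y' : coef (X' ++ Y') = coef X' + coef Y' by rewrite /coef big_cat.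
have coC ia X' : coef (ia :: X') = ia.2 + coef X' by rewrite /coef big_cons.
have [h|h] := leP 0 (wedge S (vert i)).
- (* move the first occurrence to the right, across [B] *)
  rewrite -E; apply: (step (A ++ B ++ (i, a + b) :: C)).
  + by rewrite catA; apply: szlt; rewrite size_cat.
  + by rewrite /nonneg_word !all_cat /= pA pB ab0.
  + rewrite E !vword_cat /= !vword_cat /= !vsum_cat /= !vsum_cat /= vscDl.
    by apply: pairE => /=; ring.
  + have [_ e1] := merge (A ++ B) C; rewrite -!catA in e1.
    rewrite -e1 E !vword_cat /= vword_cat /=.
    have := warea_swap (vword A) [:: vsc a (vert i)] (vword B)
      (vsc b (vert i) :: vword C).
    rewrite /= => ->; rewrite addr0 wedgeZl (wedgeC (vert i)) -/S lerDl.
    by rewrite mulrN opprK mulr_ge0.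
  + by rewrite E !(coE, coC) /=; ring.
- rewrite -E; apply: (step (A ++ (i, a + b) :: B ++ C)).
  + by apply: szlt; rewrite size_cat addnA.
  + by rewrite /nonneg_word !all_cat /= all_cat pA pB ab0.
  + rewrite E !vword_cat /= !vword_cat /= !vsum_cat /= !vsum_cat /= vscDl.
    by apply: pairE => /=; ring.
  + have [_ <-] := merge A (B ++ C).
    rewrite E !vword_cat /= !vword_cat /=.
    have := warea_swap (vword A ++ [:: vsc a (vert i)]) (vword B) [:: vsc b (vert i)]
      (vword C).
    rewrite -!catA /= => ->; rewrite addr0 wedgeZr -/S lerDl oppr_ge0.
    by rewrite mulr_ge0_le0// ltW.
  + by rewrite E !(coE, coC) /=; ring.
Qed.

Definition oword (l : seq 'I_n) c : seq (R * R) := [seq vsc (c ord0 i) (vert i) | i <- l].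

Lemma vsum_warea0 W : {in W, forall w, w = 0} -> vsum W = 0 /\ warea W = 0.
Proof.
elim: W => [//|w W IH] H /=; have [|-> ->] := IH.
  by move=> x xW; apply: H; rewrite inE xW orbT.
by rewrite (H w (mem_head _ _)) addr0 wedge0l mulr0 addr0.
Qed.

(** Absent vertices are appended with coefficient 0. A word thus becomes one of finitely many orders
    together with a nonnegative row, which is the parameter space for compactness. *)
Lemma order_word ew : nonneg_word ew -> uniq (map fst ew) ->
  exists l c, [/\ perm_eq l (enum 'I_n), nonneg_row c, rsum c = coef ew &
    wpt (oword l c) = wpt (vword ew)].
Proof.
move=> pos u.
pose f (ew : seq ('I_n * R)) i := nth 0 (map snd ew) (index i (map fst ew)).
have key (ew1 : seq ('I_n * R)) : uniq (map fst ew1) ->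
    [seq (i, f ew1 i) | i <- map fst ew1] = ew1.
  elim: ew1 => [//|[i a] ew1 IH] /= /andP[i1 u1]; rewrite {1}/f /= eqxx /=; congr cons.
  rewrite -[RHS]IH//; apply/eq_in_map => j j1; congr pair.
  by rewrite /f /=; case: eqVneq => // ij; move: i1; rewrite ij j1.
pose c : 'rV[R]_n := \row_i f ew i.
have cE i : c ord0 i = f ew i by rewrite mxE.
pose rest := [seq i <- enum 'I_n | i \notin map fst ew].
have c0 i : i \notin map fst ew -> c ord0 i = 0.
  move=> h; rewrite cE /f nth_default// size_map -(size_map fst) leqNgt index_mem//.
have cpos : nonneg_row c.
  move=> i; have [h|/c0 -> //] := boolP (i \in map fst ew).
  have : (i, f ew i) \in ew by rewrite -{2}(key _ u); exact: map_f.
  by rewrite cE => /(allP pos).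
have pe : perm_eq (map fst ew ++ rest) (enum 'I_n).
  apply: uniq_perm; rewrite ?enum_uniq//.
    rewrite cat_uniq u filter_uniq ?enum_uniq// andbT /=.
    by apply/hasPn => i; rewrite mem_filter => /andP[].
  by move=> i; rewrite mem_cat mem_filter mem_enum andbT; case: (i \in map fst ew).
exists (map fst ew ++ rest), c; split=> //.
  rewrite /rsum -big_enum -(perm_big _ pe) big_cat /= [X in _ + X]big_seq.
  rewrite [X in _ + X]big1 ?addr0; last first.
    by move=> i; rewrite mem_filter => /andP[/c0].
  rewrite /coef -[in RHS](key _ u) [RHS]big_map; apply: eq_bigr => i _.
  by rewrite cE.
rewrite /oword map_cat.
have -> : [seq vsc (c ord0 i) (vert i) | i <- map fst ew] = vword ew.
  rewrite /vword -[in RHS](key _ u) -[RHS]map_comp; apply: eq_map => i.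
  by rewrite /= cE.
have [|z1 z2] := @vsum_warea0 [seq vsc (c ord0 i) (vert i) | i <- rest].
  by move=> w /mapP[i]; rewrite mem_filter => /andP[/c0 -> _] ->; rewrite vsc0l.
by rewrite wpt_cat /wpt z1 z2 hmulp0.
Qed.

Lemma vsum_vword_lin c (l : seq 'I_n) :
  vsum (vword [seq (i, c ord0 i) | i <- l]) =
  (\sum_(i <- l) c ord0 i * (vert i).1, \sum_(i <- l) c ord0 i * (vert i).2).
Proof.
elim: l => [|i l IH] /=; first by rewrite !big_nil.
by rewrite IH !big_cons.
Qed.

(** Each step is replaced by an optimal vertex decomposition, written in reverse if it would enclose
    negative area. *)
Lemma vword_of_word W : exists ew, [/\ nonneg_word ew, vsum (vword ew) = vsum W,
  warea W <= warea (vword ew) & coef ew = len W].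
Proof.
elim: W => [|w W [ew [h1 h2 h3 h4]]] /=.
  by exists [::]; split=> //=; rewrite /coef big_nil wlen_nil.
have [c [c0 cv tc]] := normL_decomp Qsym Qint w.
pose e1 := [seq (i, c ord0 i) | i <- enum 'I_n].
have v1 : vsum (vword e1) = w.
  by rewrite vsum_vword_lin -cv /lin !big_enum.
have p1 : nonneg_word e1 by apply/allP => _ /mapP[i _ ->] /=.
have t1 : coef e1 = N w by rewrite -tc /coef big_map big_enum.
have [e2 [p2 v2 t2 a2]] : exists e2, [/\ nonneg_word e2, vsum (vword e2) = w,
    coef e2 = N w & 0 <= warea (vword e2)].
  have [a0|a0] := leP 0 (warea (vword e1)); first by exists e1.
  exists (rev e1); split.
  - by rewrite /nonneg_word all_rev.
  - by rewrite /vword map_rev vsum_rev.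
  - by rewrite -t1 /coef (perm_big e1)// perm_rev.
  - by rewrite /vword map_rev warea_rev oppr_ge0 ltW.
exists (e2 ++ ew); split.
- by rewrite /nonneg_word all_cat; apply/andP; split.
- by rewrite vword_cat vsum_cat v2 h2.
- rewrite vword_cat warea_cat v2 h2 lerD2r; lra.
- by rewrite /coef big_cat wlen_cons /= -t2 -h4.
Qed.

Lemma word_order W : exists l c, [/\ perm_eq l (enum 'I_n), nonneg_row c,
  rsum c = len W, vsum (oword l c) = vsum W & warea W <= warea (oword l c)].
Proof.
have [ew [p1 v1 a1 c1]] := vword_of_word W.
have [ew' [p2 u2 v2 a2 c2]] := word_uniq p1.
have [l [c [pl c0 tc [ev ea]]]] := order_word p2 u2.
exists l, c; split=> //; first by rewrite tc c2.
  by rewrite ev v2.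
by rewrite ea; exact: le_trans a2.
Qed.

Lemma wlen_oword l c : perm_eq l (enum 'I_n) -> nonneg_row c -> len (oword l c) <= rsum c.
Proof.
move=> pl c0; rewrite /wlen big_map (perm_big _ pl) /rsum -big_enum /=.
apply: ler_sum => i _; rewrite Nhom// ler_piMr//.
exact: normL_vert.
Qed.

Lemma continuous_oword l :
  [/\ continuous (fun c => (vsum (oword l c)).1), continuous (fun c => (vsum (oword l c)).2)
  & continuous (fun c => warea (oword l c))].
Proof.
have cadd (f g : 'rV[R]_n -> R) : continuous f -> continuous g ->
    continuous (fun c => f c + g c).
  by move=> cf cg c; apply: (@cvgD _ _ _ (nbhs c) _); [exact: cf|exact: cg].
have cmul (f g : 'rV[R]_n -> R) : continuous f -> continuous g ->
    continuous (fun c => f c * g c).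
  by move=> cf cg c; apply: (@cvgM R _ (nbhs c) _); [exact: cf|exact: cg].
have ccst (k : R) : continuous (fun c : 'rV[R]_n => k) by exact: (@cst_continuous _ _ k).
elim: l => [|i l [c1 c2 c3]] /=; first by split; exact: ccst.
have cc := @coord_continuous R 1 n ord0 i.
split.
- change (continuous (fun c => c ord0 i * (vert i).1 + (vsum (oword l c)).1)).
  exact: (cadd _ _ (cmul _ _ cc (ccst _)) c1).
- change (continuous (fun c => c ord0 i * (vert i).2 + (vsum (oword l c)).2)).
  exact: (cadd _ _ (cmul _ _ cc (ccst _)) c2).
- apply: (cadd _ _ c3); apply: (cmul _ _ (ccst _)).
  have -> : (fun c => wedge (vsc (c ord0 i) (vert i)) (vsum (oword l c))) =
    (fun c => c ord0 i * (vert i).1 * (vsum (oword l c)).2 +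
      (-1) * (c ord0 i * (vert i).2 * (vsum (oword l c)).1)).
    by apply/funext => c; rewrite /wedge /=; ring.
  exact: (cadd _ _ (cmul _ _ (cmul _ _ cc (ccst _)) c2)
    (cmul _ _ (ccst _) (cmul _ _ (cmul _ _ cc (ccst _)) c1))).
Qed.

(** The area is constrained from below only, because the reduction to ordered vertex words may
    increase it. Exact area is restored later by [interpolate]. *)
Lemma optimal_exists v (z : R) : (exists W, vsum W = v /\ z <= warea W) ->
  exists l c, [/\ perm_eq l (enum 'I_n), nonneg_row c, vsum (oword l c) = v,
    z <= warea (oword l c) &
    forall W, vsum W = v -> z <= warea W -> rsum c <= len W].
Proof.
move=> [W0 [v0 z0]].
pose P l : set 'rV[R]_n := [set c | vsum (oword l c) = v /\ z <= warea (oword l c)].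
have cP l : closed (P l).
  have [c1 c2 c3] := continuous_oword l.
  have -> : P l = (fun c => (vsum (oword l c)).1) @^-1` [set v.1] `&`
    (fun c => (vsum (oword l c)).2) @^-1` [set v.2] `&`
    (fun c => warea (oword l c)) @^-1` [set x | z <= x].
    apply/seteqP; split=> c /= [h h']; first by rewrite h.
    by case: h => h1 h2; split=> //; exact: pairE.
  apply: closedI; [apply: closedI|]; apply: preimage_closed.
  - by move=> c _; exact: c1.
  - exact: closed_eq.
  - by move=> c _; exact: c2.
  - exact: closed_eq.
  - by move=> c _; exact: c3.
  - exact: closed_ge.
(* The minimum over a finite list of orders, by induction; some orders may admit no feasible row,
   hence the case distinctions. *)
have fin (ls : seq (seq 'I_n)) :
    (exists l c, [/\ l \in ls, P l c & nonneg_row c]) ->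
    exists l c, [/\ l \in ls, P l c, nonneg_row c &
      forall l' c', l' \in ls -> P l' c' -> nonneg_row c' -> rsum c <= rsum c'].
  elim: ls => [[l [c [//]]]|l ls IH] ex.
  have dec : (exists2 c, P l c & nonneg_row c) \/ (forall c, P l c -> ~ nonneg_row c).
    have [?|h] := pselect (exists2 c, P l c & nonneg_row c); [by left|right].
    by move=> c h1 h2; apply: h; exists c.
  have decs : (exists l c, [/\ l \in ls, P l c & nonneg_row c]) \/
     (forall l c, l \in ls -> P l c -> ~ nonneg_row c).
    have [?|h] := pselect (exists l c, [/\ l \in ls, P l c & nonneg_row c]).
      by left.
    by right=> l1 c h0 h1 h2; apply: h; exists l1, c.
  have use_l : (exists2 c, P l c & nonneg_row c) ->
      exists c, [/\ P l c, nonneg_row c & forall c', P l c' -> nonneg_row c' ->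
        rsum c <= rsum c'] by exact: min_rsum_closed.
  case: decs => [/IH[l2 [c2 [l2s P2 n2 m2]]]|no2].
    case: dec => [/use_l[c1 [P1 n1 m1]]|no1].
      have [h|/ltW h] := leP (rsum c1) (rsum c2).
        exists l, c1; split=> //; first exact: mem_head.
        move=> l' c'; rewrite inE => /orP[/eqP ->|/m2 m]; first exact: m1.
        by move=> h1 h2; apply: le_trans h _; exact: m.
      exists l2, c2; split=> //; first by rewrite inE l2s orbT.
      move=> l' c'; rewrite inE => /orP[/eqP -> h1 h2|/m2 m]; last exact: m.
      by apply: le_trans h _; exact: m1.
    exists l2, c2; split=> //; first by rewrite inE l2s orbT.
    move=> l' c'; rewrite inE => /orP[/eqP -> h1 h2|/m2 m]; last exact: m.
    by have := no1 _ h1 h2.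
  case: dec => [/use_l[c1 [P1 n1 m1]]|no1].
    exists l, c1; split=> //; first exact: mem_head.
    by move=> l' c'; rewrite inE => /orP[/eqP ->|h /(no2 _ _ h)//]; exact: m1.
  move: ex => [l1 [c1 [+ h1 h2]]]; rewrite inE => /orP[/eqP e|l1s]; exfalso.
    by rewrite e in h1; exact: (no1 _ h1 h2).
  exact: (no2 _ _ l1s h1 h2).
have [|l [c [lp [cv cz] c0 cmin]]] := fin (permutations (enum 'I_n)).
  have [l [c [pl c0 _ cv ca]]] := word_order W0.
  exists l, c; split=> //; first by rewrite mem_permutations.
  by split; [rewrite cv|exact: le_trans ca].
exists l, c; split=> //; first by rewrite -mem_permutations.
move=> W vW zW; have [l' [c' [pl c0' <- cv' ca']]] := word_order W.
apply: (cmin l') => //; first by rewrite mem_permutations.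
by split; [rewrite cv'|exact: le_trans ca'].
Qed.

End Dist.

(** * The word distance, points on minimizers, and branching *)

Section WordDistance.
Variables (R : realType) (s : seq (R * R)).
Notation n := (size s).
Notation Q := (conv_hull s).
Hypothesis Qsym : centrally_symmetric Q.
Hypothesis Qint : interior Q !=set0.
Notation N := (normL Q).
Notation len := (wlen N).
Implicit Types (u v w : R * R) (W : seq (R * R)) (x p q : hpt R).
Let Nhom := normLZ Qsym Qint.
Let Npos := normL_gt0 Qsym Qint.
Let Nge0 := normL_ge0 Qsym Qint.
Let lge0 := wlen_ge0 Qsym Qint.
Let Nsum := normL_vsum Qsym Qint.

Definition wdist x : R := inf [set len W | W in [set W | wpt W = x]].

(** One step reaches the projection, then a square loop of side [sqrt |z|] supplies the height; its
    four sides give the factor 4. A negative height reverses the loop. *)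
Lemma wpt_reach : exists2 C, 0 < C & forall x, exists2 W, wpt W = x &
  len W <= C * (`|x.1.1| + `|x.1.2| + Num.sqrt `|x.2|).
Proof.
have [C C0 HC] := normL_upper Qsym Qint; exists (4 * C); first lra.
move=> [[a b] z] /=.
pose r := Num.sqrt `|z|.
have r0 : 0 <= r by rewrite sqrtr_ge0.
have rr : r * r = `|z| by rewrite -expr2 sqr_sqrtr.
pose loop : seq (R * R) := [:: (r, 0); (0, r); (- r, 0); (0, - r)].
have ll : len loop <= 4 * C * r.
  have h (u : R * R) : `|u.1| + `|u.2| = r -> N u <= C * r by move=> <-; exact: HC.
  have h1 := h (r, 0); have h2 := h (0, r); have h3 := h (- r, 0); have h4 := h (0, - r).
  move: h1 h2 h3 h4; rewrite /= normr0 normrN add0r addr0 (ger0_norm r0).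
  move=> /(_ erefl) h1 /(_ erefl) h2 /(_ erefl) h3 /(_ erefl) h4.
  by rewrite /loop !wlen_cons wlen_nil; lra.
have [v1 a1] : vsum loop = 0 /\ warea loop = `|z|.
  by split; [apply: pairE => /=; ring|rewrite -rr /= /wedge /=; field].
have [loop' [l2 v2 a2]] : exists loop', [/\ len loop' <= 4 * C * r, vsum loop' = 0 &
    warea loop' = z].
  have [z0|z0] := leP 0 z.
    by exists loop; rewrite a1 ger0_norm.
  by exists (rev loop); rewrite wlen_rev vsum_rev warea_rev a1 ltr0_norm// opprK.
exists ((a, b) :: loop').
  by rewrite /wpt /= v2 a2 addr0 wedge0r mulr0 addr0.
rewrite wlen_cons mulrDr lerD//; apply: le_trans (HC _) _ => /=.
have : 0 <= `|a| by []. have : 0 <= `|b| by [].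
move=> b0 a0; have : 0 <= C * (`|a| + `|b|) by rewrite mulr_ge0 ?addr_ge0// ltW.
lra.
Qed.

Lemma wdist_le W : wdist (wpt W) <= len W.
Proof. by apply: ge_inf; [exists 0 => _ [V _ <-]|exists W]. Qed.

Lemma le_wdist x (D : R) : (forall W, wpt W = x -> D <= len W) -> D <= wdist x.
Proof.
move=> H; apply: lb_le_inf; last by move=> _ [W /H ? <-].
by have [C _ /(_ x)[W Wx _]] := wpt_reach; exists (len W), W.
Qed.

Lemma wdist_ge0 x : 0 <= wdist x.
Proof. by apply: le_wdist. Qed.

(** Scaling [W] by [t = sqrt (z / warea W)] gives area [z], and the chord [(1 - t) v] restores the
    endpoint without adding area, being parallel to [t v]. *)
Lemma interpolate W (z : R) : 0 <= z -> z <= warea W -> exists V t,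
  [/\ wpt V = (vsum W, z), 0 <= t <= 1, (z < warea W -> t < 1) &
      len V = t * len W + (1 - t) * N (vsum W)].
Proof.
move=> z0 zW; have [W0|W0] := eqVneq (warea W) 0.
  have e : z = 0 by apply/eqP; rewrite eq_le z0 -W0 zW.
  exists W, 1; rewrite /wpt W0 e ltxx; split=> //; first by rewrite ler01 lexx.
  by ring.
have Wp : 0 < warea W by rewrite lt0r W0 (le_trans z0).
pose t := Num.sqrt (z / warea W).
have zW0 : 0 <= z / warea W by rewrite divr_ge0// ltW.
have t0 : 0 <= t by rewrite sqrtr_ge0.
have tt : t ^+ 2 = z / warea W by rewrite sqr_sqrtr.
have t1 : t <= 1 by rewrite -(sqrtr1 R) ler_wsqrtr// ler_pdivrMr// mul1r.
exists (map (vsc t) W ++ [:: vsc (1 - t) (vsum W)]), t; split.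
- rewrite /wpt vsum_cat warea_cat vsum_scale warea_scale /= !addr0.
  rewrite !(wedgeZl, wedgeZr, wedge0r, wedgevv) tt.
  apply: hptE => /=; last by rewrite !mulr0 !addr0 divfK.
  by rewrite -vscDl subrKC vsc1.
- by rewrite t0.
- by move=> zlt; rewrite -(sqrtr1 R) ltr_sqrt// ltr_pdivrMr// mul1r.
- by rewrite wlen_cat (wlen_scale Nhom)// wlen_cons wlen_nil Nhom ?subr_ge0// addr0.
Qed.

Lemma wdist_monotone W (z : R) : 0 <= z -> z <= warea W ->
  wdist (vsum W, z) <= len W.
Proof.
move=> z0 /(interpolate z0)[V [t [<- t01 _ e]]].
apply: le_trans (wdist_le V) _; rewrite e.
have := Nsum W => h; have : (1 - t) * N (vsum W) <= (1 - t) * len W.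
  by apply: ler_wpM2l => //; lra.
by lra.
Qed.

(** Used in contrapositive form: over [v] with [N v < D], a word of length at most
    [D = wdist (v, z)] cannot enclose more than [z]. *)
Lemma wdist_strict W (z D : R) : 0 <= z -> z < warea W -> len W <= D ->
  N (vsum W) < D -> wdist (vsum W, z) < D.
Proof.
move=> z0 zW lW NW; have [V [t [<- /andP[t0 t1] /(_ zW) t2 e]]] := interpolate z0 (ltW zW).
apply: le_lt_trans (wdist_le V) _; rewrite e.
have h1 : (1 - t) * N (vsum W) < (1 - t) * D by rewrite ltr_pM2l// subr_gt0.
have h2 : t * len W <= t * D by exact: ler_wpM2l.
lra.
Qed.

Lemma wdist_hrefl x : wdist (hrefl x) = wdist x.
Proof.
have le y : wdist (hrefl y) <= wdist y.
  apply: le_wdist => W e; rewrite -(wlen_rev N).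
  have <- : wpt (rev W) = hrefl y by rewrite /wpt vsum_rev warea_rev -e.
  exact: wdist_le.
by apply/eqP; rewrite eq_le le -{1}[x]hreflK le.
Qed.

Lemma optimal_order_word v (z : R) : 0 <= z -> exists l c,
  [/\ perm_eq l (enum 'I_n), nonneg_row c, vsum (oword l c) = v,
      z <= warea (oword l c) & rsum c = wdist (v, z)].
Proof.
move=> z0; have [|l [c [pl c0 cv cz cmin]]] := optimal_exists Qsym Qint (v := v) (z := z).
  by have [C _ /(_ (v, z))[W Wx _]] := wpt_reach; exists W; case: Wx => <- ->.
exists l, c; split=> //; apply/eqP; rewrite eq_le; apply/andP; split.
  by apply: le_wdist => W [Wv Wz]; apply: cmin => //; rewrite Wz.
rewrite -cv; apply: le_trans (wdist_monotone z0 cz) _.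
exact: wlen_oword.
Qed.

(** The optimal word with area at least [z] is brought to area exactly [z] by [interpolate], which
    does not lengthen it; negative heights follow by reversal. *)
Lemma wdist_attained x : exists2 W, wpt W = x & len W = wdist x.
Proof.
have main v (z : R) : 0 <= z -> exists2 W, wpt W = (v, z) & len W = wdist (v, z).
  move=> z0; have [l [c [pl c0 cv cz cd]]] := optimal_order_word v z0.
  have [V [t [Vx /andP[t0 t1] _ e]]] := interpolate z0 cz; rewrite cv in Vx.
  exists V => //; apply/eqP; rewrite eq_le -{2}Vx wdist_le andbT -cd.
  apply: le_trans (wlen_oword Qsym Qint pl c0); rewrite e.
  have : (1 - t) * N (vsum (oword l c)) <= (1 - t) * len (oword l c).
    by apply: ler_wpM2l => //; lra.
  by lra.
case: x => v z; have [/main //|z0] := leP 0 z.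
have [|W [Wv Wz] Wl] := main v (- z); first by rewrite oppr_ge0 ltW.
exists (rev W); first by rewrite /wpt vsum_rev warea_rev Wv Wz opprK.
by rewrite wlen_rev Wl -(wdist_hrefl (v, z)).
Qed.

Lemma wdist_triangle p q : wdist (hmul p q) <= wdist p + wdist q.
Proof.
have [A <- <-] := wdist_attained p; have [B <- <-] := wdist_attained q.
by rewrite -wpt_cat -wlen_cat wdist_le.
Qed.

Lemma wdist_hinv p : wdist (hinv p) = wdist p.
Proof.
have le y : wdist (hinv y) <= wdist y.
  have [A Ay <-] := wdist_attained y.
  have <- : wpt (rev (map (vsc (-1)) A)) = hinv y.
    rewrite /wpt vsum_rev warea_rev vsum_scale warea_scale -Ay vscN1.
    by apply: hptE => //=; ring.
  apply: le_trans (wdist_le _) _; rewrite wlen_rev /wlen big_map.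
  by apply: ler_sum => w _; rewrite vscN1 (normLN Qsym Qint).
by apply/eqP; rewrite eq_le le -{1}[p]hinvK le.
Qed.

Lemma wdist0 : wdist (horigin R) = 0.
Proof.
by apply/eqP; rewrite eq_le wdist_ge0 andbT -(wlen_nil N) (wdist_le [::]).
Qed.

Lemma normL_wdist x : N x.1 <= wdist x.
Proof. by have [W <- <-] := wdist_attained x; exact: Nsum. Qed.

Lemma wdist_flat v : wdist (v, 0) <= N v.
Proof.
have := wdist_le [:: v]; rewrite wlen_cons wlen_nil addr0.
by rewrite /wpt /= wedge0r mulr0 !addr0.
Qed.

Lemma wdist_lower : exists2 M, 0 < M & forall x,
  `|x.1.1| + `|x.1.2| <= M * wdist x /\ `|x.2| <= M * wdist x ^+ 2.
Proof.
have [M M0 HM] := normL_lower Qsym Qint.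
pose M' := M + M ^+ 2.
have M1 : M <= M' by rewrite lerDl sqr_ge0.
have M2 : M ^+ 2 <= M' by rewrite lerDr ltW.
exists M'; first exact: lt_le_trans M1.
move=> x; have [W <- <-] := wdist_attained x; split => /=.
  apply: le_trans (HM _) _; by apply: ler_pM => //; do ?[exact: ltW|exact: Nge0|exact: Nsum].
apply: (@le_trans _ _ (M ^+ 2 * len W ^+ 2)); last by rewrite ler_wpM2r// sqr_ge0.
elim: W => [|w W IH] /=; first by rewrite normr0 mulr_ge0 ?sqr_ge0.
rewrite wlen_cons; apply: le_trans (ler_normD _ _) _.
have h : `|wedge w (vsum W)| <= M ^+ 2 * (N w * len W).
  apply: (@le_trans _ _ ((`|w.1| + `|w.2|) * (`|(vsum W).1| + `|(vsum W).2|))).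
    rewrite /wedge; apply: le_trans (ler_normB _ _) _; rewrite !normrM.
    rewrite mulrDl !mulrDr.
    have p1 : 0 <= `|w.1| * `|(vsum W).1| by rewrite mulr_ge0.
    have p2 : 0 <= `|w.2| * `|(vsum W).2| by rewrite mulr_ge0.
    by lra.
  have -> : M ^+ 2 * (N w * len W) = (M * N w) * (M * len W) by ring.
  apply: ler_pM; rewrite ?addr_ge0//.
  by apply: le_trans (HM _) _; rewrite ler_pM2l.
rewrite normrM ger0_norm ?invr_ge0//.
have p : 0 <= M ^+ 2 * (N w * len W) by rewrite mulr_ge0 ?sqr_ge0// mulr_ge0.
have p' : 0 <= M ^+ 2 * N w ^+ 2 by rewrite mulr_ge0 ?sqr_ge0.
have -> : M ^+ 2 * (N w + len W) ^+ 2 =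
  M ^+ 2 * N w ^+ 2 + 2 * (M ^+ 2 * (N w * len W)) + M ^+ 2 * len W ^+ 2 by ring.
lra.
Qed.

Lemma wdist_eq0 x : wdist x = 0 -> x = horigin R.
Proof.
have [M _ /(_ x)] := wdist_lower => -[+ +] d0; rewrite d0 expr0n /= !mulr0 => h1 h2.
have a1 : 0 <= `|x.1.1| by []. have a2 : 0 <= `|x.1.2| by [].
apply: hptE; last by apply/eqP; rewrite -normr_le0.
by apply: pairE; apply/eqP; rewrite -normr_le0; lra.
Qed.

Lemma wdist_dil_le (r : R) x : 0 <= r -> wdist (hdil r x) <= r * wdist x.
Proof.
move=> r0; have [W <- <-] := wdist_attained x.
have -> : hdil r (wpt W) = wpt (map (vsc r) W).
  by rewrite /wpt vsum_scale warea_scale.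
by rewrite -(wlen_scale Nhom)// wdist_le.
Qed.

Lemma wdist_dil (r : R) x : 0 < r -> wdist (hdil r x) = r * wdist x.
Proof.
move=> r0; apply/eqP; rewrite eq_le wdist_dil_le ?(ltW r0)//=.
have := @wdist_dil_le r^-1 (hdil r x); rewrite invr_ge0 => /(_ (ltW r0)).
have -> : hdil r^-1 (hdil r x) = x.
  by apply: hptE; [apply: pairE|] => /=; field; rewrite gt_eqF.
by rewrite -(ler_pM2l r0) mulrA divff ?gt_eqF// mul1r.
Qed.

(* [p] lies at arc length [l] on some minimizer from the origin to [x]. *)
Definition on_geodesic x p (l : R) := wdist p <= l /\ wdist (hmul (hinv p) x) <= wdist x - l.

Lemma on_geodesic_eq x p (l : R) : on_geodesic x p l ->
  wdist p = l /\ wdist (hmul (hinv p) x) = wdist x - l.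
Proof. by move=> [h1 h2]; have := wdist_triangle p (hmul (hinv p) x); rewrite hmulKV; lra. Qed.

(** The negation of uniqueness, expressed by points rather than curves ([unique_geodesicP]). *)
Definition branching x := exists p q l, [/\ p <> q, on_geodesic x p l & on_geodesic x q l].

Definition generic v := forall i : 'I_n, vert i != 0 -> wedge (vert i) v != 0.

(** The two factors of [x] at [p] are replaced separately by vertex words with at least their area.
    The total area cannot exceed [x.2], so neither part gains any and the break point is still
    [p]. *)
Lemma on_geodesic_word x p (l : R) : 0 < x.2 -> N x.1 < wdist x -> generic x.1 ->
  on_geodesic x p l -> exists A B,
    [/\ maximal N x.1 x.2 (wdist x) (A ++ B), wpt A = p, len A = l &
        forall w, w \in A ++ B -> wedge w x.1 != 0].
Proof.
move=> z0 Nlt gen og; have [dp dp'] := on_geodesic_eq og.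
have [A Ap Al] := wdist_attained p.
have [B Bp Bl] := wdist_attained (hmul (hinv p) x).
have [la [a [pla a0 sa va aa]]] := word_order Qsym Qint A.
have [lb [b [plb b0 sb vb ab]]] := word_order Qsym Qint B.
(* Without zero steps, every step is a nonzero multiple of a nonzero vertex, hence not parallel to
   [x.1]. *)
pose f (W : seq (R * R)) := [seq w <- W | w != 0].
have fv W : vsum (f W) = vsum W.
  by elim: W => [//|w W IH] /=; case: eqVneq => [->|_] /=; rewrite IH ?add0r.
have fa W : warea (f W) = warea W.
  elim: W => [//|w W IH] /=; case: eqVneq => [->|_] /=; rewrite IH ?fv//.
  by rewrite wedge0l mulr0 addr0.
have fl W : len (f W) = len W.
  elim: W => [//|w W IH] /=; case: eqVneq => [->|_] /=; rewrite ?wlen_cons IH//.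
  by rewrite (normL0 Qsym Qint) add0r.
pose A' := f (oword la a); pose B' := f (oword lb b).
have lA : len A' <= l by rewrite fl -dp -Al -sa; exact: wlen_oword.
have lB : len B' <= wdist x - l by rewrite fl -dp' -Bl -sb; exact: wlen_oword.
have vA : vsum A' = p.1 by rewrite fv va -Ap.
have vB : vsum B' = (hmul (hinv p) x).1 by rewrite fv vb -Bp.
have vAB : vsum (A' ++ B') = x.1 by rewrite vsum_cat vA vB /= addNKr.
have zAB : x.2 = p.2 + (hmul (hinv p) x).2 + 2^-1 * wedge (vsum A') (vsum B').
  by rewrite vA vB /= wedgeDr !wedgeNl wedgeNr wedgevv; ring.
have aA : p.2 <= warea A' by rewrite fa -Ap.
have aB : (hmul (hinv p) x).2 <= warea B' by rewrite fa -Bp.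
have lAB : len (A' ++ B') <= wdist x by rewrite wlen_cat; lra.
have upper : warea (A' ++ B') <= x.2.
  case: (leP (warea (A' ++ B')) x.2) => // h.
  have := wdist_strict (ltW z0) h lAB; rewrite vAB => /(_ Nlt).
  by rewrite -surjective_pairing ltxx.
rewrite warea_cat in upper.
have eA : warea A' = p.2 by lra.
have eB : warea B' = (hmul (hinv p) x).2 by lra.
have eAB : warea (A' ++ B') = x.2 by rewrite warea_cat zAB eA eB.
have low : wdist x <= len (A' ++ B').
  by rewrite [x in wdist x](_ : x = wpt (A' ++ B')) ?wdist_le//; apply: hptE.
rewrite wlen_cat in low.
exists A', B'; split.
- by split=> //; rewrite wlen_cat; lra.
- exact: hptE.
- by lra.
have gw c (k : seq 'I_n) w : w \in f (oword k c) -> wedge w x.1 != 0.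
  rewrite mem_filter => /andP[w0 /mapP[i _ wE]]; rewrite wE wedgeZl mulf_neq0//.
    by apply: contra w0 => /eqP c0; rewrite wE c0 vsc0l.
  by apply: gen; apply: contra w0 => /eqP c0; rewrite wE c0 vsc0.
by move=> w; rewrite mem_cat => /orP[/gw|/gw].
Qed.

Lemma generic_unique_pos x : 0 < x.2 -> N x.1 < wdist x -> generic x.1 -> ~ branching x.
Proof.
move=> z0 Nlt gen [p [q [l [pq hp hq]]]]; apply: pq.
have [A [B [M1 <- l1 g1]]] := on_geodesic_word z0 Nlt gen hp.
have [A' [B' [M2 <- l2 g2]]] := on_geodesic_word z0 Nlt gen hq.
have max W : vsum W = x.1 -> len W <= wdist x -> warea W <= x.2.
  move=> Wv Wl; case: (leP (warea W) x.2) => // h.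
  have := wdist_strict (ltW z0) h Wl; rewrite Wv => /(_ Nlt).
  by rewrite -surjective_pairing ltxx.
have [|e1 e2 _] := maximal_unique Nhom Npos z0 max M1 M2 g1 g2 erefl erefl.
  by rewrite l1 l2.
by rewrite /wpt e1 e2.
Qed.

(** Reflection reverses products, so a splitting of [x] at [p] becomes one of [hrefl x] at the
    reflected second factor, at arc length [wdist x - l]. The second factor determines [p], which
    keeps the two points apart. *)
Lemma branching_hrefl x : branching x -> branching (hrefl x).
Proof.
move=> [p [q [l [pq hp hq]]]].
have tr p' : on_geodesic x p' l ->
    on_geodesic (hrefl x) (hrefl (hmul (hinv p') x)) (wdist x - l).
  move=> [h1 h2]; split; rewrite !wdist_hrefl//.
  have e : hrefl x = hmul (hrefl (hmul (hinv p') x)) (hrefl p').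
    by rewrite -hreflM hmulKV.
  by rewrite [in X in hmul _ X]e hmulVK wdist_hrefl; lra.
exists (hrefl (hmul (hinv p) x)), (hrefl (hmul (hinv q) x)), (wdist x - l).
split; [|exact: tr|exact: tr].
move=> /(congr1 (@hrefl R)); rewrite !hreflK => e; apply: pq.
have inv y : y = hmul x (hinv (hmul (hinv y) x)).
  by rewrite hinvM hinvK hmulKV.
by rewrite (inv p) e -inv.
Qed.

Lemma generic_unique x : N x.1 < wdist x -> generic x.1 -> ~ branching x.
Proof.
move=> Nlt gen; have [z0|z0|z0] := ltgtP 0 x.2.
- exact: generic_unique_pos.
- move=> /branching_hrefl; apply: generic_unique_pos => //=.
    by rewrite oppr_gt0.
  by rewrite wdist_hrefl.
(* At height zero the straight segment has length [N x.1], against the strict inequality. *)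
- move: Nlt; rewrite [x]surjective_pairing -z0 /= => Nlt.
  by have := wdist_flat x.1; lra.
Qed.

(** Scaling the minimizer to [(v, z')] shows that every height of absolute value at most
    [t ^ 2 * z'] over [t v] is reached with length [t * N v]. The height at an intermediate point of
    a minimizer to [(v, z)] can then be chosen in more than one way. *)
Lemma wall_branching_pos v (z z' : R) : 0 < z -> z < z' -> wdist (v, z') = N v ->
  branching (v, z).
Proof.
move=> z0 zz' dz'; have z'0 : 0 < z' by exact: lt_trans zz'.
have small (t y : R) : 0 <= t -> `|y| <= t ^+ 2 * z' -> wdist (vsc t v, y) <= t * N v.
  move=> t0; have pos y' : 0 <= y' -> y' <= t ^+ 2 * z' -> wdist (vsc t v, y') <= t * N v.
    move=> y0 yz; have [W [Wv Wz] Wl] := wdist_attained (v, z').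
    rewrite -dz' -Wl -(wlen_scale Nhom)// -Wv -vsum_scale.
    by apply: wdist_monotone => //; rewrite warea_scale Wz.
  have [y0|y0] := leP 0 y; first by rewrite ger0_norm//; exact: pos.
  rewrite ltr0_norm// => yz; rewrite -(wdist_hrefl (vsc t v, y)) /hrefl /=.
  by apply: pos; rewrite ?oppr_ge0 ?(ltW y0).
(* Chosen so that [t ^ 2 * z' = z]: the whole height can be gained over the part [t v]. *)
pose t := Num.sqrt (z / z').
have zz0 : 0 < z / z' by rewrite divr_gt0.
have t0 : 0 < t by rewrite sqrtr_gt0.
have tt : t ^+ 2 * z' = z by rewrite sqr_sqrtr ?(ltW zz0)// divfK// gt_eqF.
have t1 : t < 1 by rewrite -(sqrtr1 R) ltr_sqrt// ltr_pdivrMr// mul1r.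
have u0 : 0 < (1 - t) ^+ 2 * z' by rewrite mulr_gt0// exprn_gt0// subr_gt0.
(* A height that can be postponed to the remaining part [(1 - t) v] while the intermediate height
   [z - e] stays nonnegative. *)
pose e := Num.min z ((1 - t) ^+ 2 * z').
have e0 : 0 < e by rewrite lt_min z0.
have e1 : e <= z by rewrite ge_min lexx.
have e2 : e <= (1 - t) ^+ 2 * z' by rewrite ge_min lexx orbT.
have dz : wdist (v, z) = N v.
  apply/eqP; rewrite eq_le.
  have := @small 1 z ler01; rewrite vsc1 mul1r expr1n mul1r ger0_norm ?(ltW z0)//.
  by move=> /(_ (ltW zz')) ->; exact: (normL_wdist (v, z)).
have on y : `|y| <= z -> `|z - y| <= (1 - t) ^+ 2 * z' ->
    on_geodesic (v, z) (vsc t v, y) (t * N v).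
  move=> h1 h2; split; first by apply: small; rewrite ?tt// ltW.
  have -> : hmul (hinv (vsc t v, y)) (v, z) = (vsc (1 - t) v, z - y).
    by apply: hptE => /=; [apply: pairE => /=; ring|rewrite /wedge /=; ring].
  rewrite dz; have := @small (1 - t) (z - y); rewrite subr_ge0 => /(_ (ltW t1) h2).
  by lra.
exists (vsc t v, z), (vsc t v, z - e), (t * N v); split.
- by case=> h; move: e0; lra.
- apply: on; first by rewrite ger0_norm ?(ltW z0).
  by rewrite subrr normr0 ltW.
- apply: on; first by rewrite ger0_norm; lra.
  by rewrite opprB addrC subrK ger0_norm// ltW.
Qed.

End WordDistance.

(** * Geodesics *)

Section Geodesics.
Variables (R : realType) (s : seq (R * R)).
Notation Q := (conv_hull s).
Hypothesis Qsym : centrally_symmetric Q.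
Hypothesis Qint : interior Q !=set0.
Notation N := (normL Q).
Notation len := (wlen N).
Notation wdist := (wdist s).
Implicit Types (u v w : R * R) (W : seq (R * R)) (x p q : hpt R) (g c : R -> hpt R).
Let Nhom := normLZ Qsym Qint.
Let Nge0 := normL_ge0 Qsym Qint.

Definition hdiff g (a b : R) : hpt R := hmul (hinv (g a)) (g b).

Lemma hdiff_chain g a b d : hmul (hdiff g a b) (hdiff g b d) = hdiff g a d.
Proof. by rewrite /hdiff -hmulA hmulKV. Qed.

Lemma hdiff1 g a b : (hdiff g a b).1 = (g b).1 - (g a).1.
Proof. by rewrite /hdiff /= addrC. Qed.

Lemma hdiff2 g a b : (hdiff g a b).2 = (g b).2 - (g a).2 - 2^-1 * wedge (g a).1 (g b).1.
Proof. by rewrite /hdiff /= wedgeNl; ring. Qed.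

Definition wlip (k D : R) g := forall a b, 0 <= a -> a <= b -> b <= D ->
  wdist (hdiff g a b) <= k * (b - a).

(** The arc length parametrization: the first step as a straight segment, followed by the left
    translate of the path of the remaining word. *)
Lemma word_path W : exists c, [/\ c 0 = horigin R, c (len W) = wpt W & wlip 1 (len W) c].
Proof.
elim: W => [|w W [c [c0 cW cl]]].
  exists (fun=> horigin R); split=> // a b a0 ab b0.
  by rewrite /hdiff hmulVp (wdist0 Qsym Qint) mul1r subr_ge0.
pose L := N w.
pose c1 (t : R) : hpt R := (vsc (t / L) w, 0).
have L0 : 0 <= L by exact: Nge0.
have c1L : c1 L = (w, 0).
  rewrite /c1; case: (eqVneq L 0) => [L1|L1]; last by rewrite divff// vsc1.
  case: (eqVneq w 0) => [->|/(normL_gt0 Qsym Qint)]; first by rewrite vsc0.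
  by rewrite -/L L1 ltxx.
have c1l a b : 0 <= a -> a <= b -> wdist (hdiff c1 a b) <= b - a.
  move=> a0 ab; have -> : hdiff c1 a b = (vsc ((b - a) / L) w, 0).
    by apply: hptE; [apply: pairE => /=; ring|rewrite /= /wedge /=; ring].
  apply: le_trans (wdist_flat Qsym Qint _) _; rewrite Nhom ?divr_ge0 ?subr_ge0// -/L.
  case: (eqVneq L 0) => [->|L1]; last by rewrite divfK.
  by rewrite mulr0 subr_ge0.
pose c' t := if t <= L then c1 t else hmul (c1 L) (c (t - L)).
have cL t : L <= t -> c' t = hmul (c1 L) (c (t - L)).
  rewrite /c'; case: ltgtP => // <- _.
  by rewrite subrr c0 hmulp0.
exists c'; rewrite wlen_cons -/L; split.
- rewrite /c' L0 /c1 mul0r vsc0l; exact: hptE.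
- rewrite cL ?lerDl ?(wlen_ge0 Qsym Qint)// addrC addKr cW c1L.
  by apply: hptE => /=; ring.
have below a b : 0 <= a -> a <= b -> b <= L -> wdist (hdiff c' a b) <= b - a.
  by move=> a0 ab bL; rewrite /hdiff /c' bL (le_trans ab bL); exact: c1l.
have above a b : L <= a -> a <= b -> b <= L + len W -> wdist (hdiff c' a b) <= b - a.
  move=> La ab bD; rewrite /hdiff !cL ?(le_trans La ab)// hmulVV.
  by have := cl (a - L) (b - L); rewrite mul1r /hdiff; move=> /(_ _ _ _) h; apply: le_trans (h _ _ _) _; lra.
move=> a b a0 ab bD; rewrite mul1r.
have [bL|/ltW Lb] := leP b L; first exact: below.
have [aL|/ltW La] := leP a L; last exact: above.
rewrite -(hdiff_chain c' a L b); apply: le_trans (wdist_triangle Qsym Qint _ _) _.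
by have := below a L a0 aL (lexx L); have := above L b (lexx L) Lb bD; lra.
Qed.

Lemma geodesic_through x p (l : R) : on_geodesic s x p l -> exists g,
  [/\ g 0 = horigin R, g 1 = x, wlip (wdist x) 1 g, 0 <= l <= wdist x &
      0 < wdist x -> g (l / wdist x) = p].
Proof.
move=> og; have [dp dp'] := on_geodesic_eq Qsym Qint og.
have [A Ap Al] := wdist_attained Qsym Qint p.
have [B Bp Bl] := wdist_attained Qsym Qint (hmul (hinv p) x).
have [cA [cA0 cA1 cAl]] := word_path A; have [cB [cB0 cB1 cBl]] := word_path B.
rewrite Al Ap in cA1; rewrite Bl Bp in cB1; rewrite Al in cAl; rewrite Bl in cBl.
rewrite dp in cA1 cAl; rewrite dp' in cB1 cBl.
have l0 : 0 <= l by rewrite -dp; exact: wdist_ge0.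
have l1 : l <= wdist x by have := wdist_ge0 Qsym Qint (hmul (hinv p) x); rewrite dp'; lra.
pose c t := if t <= l then cA t else hmul p (cB (t - l)).
have cl t : l <= t -> c t = hmul p (cB (t - l)).
  by rewrite /c; case: ltgtP => // <- _; rewrite subrr cB0 hmulp0.
have below a b : 0 <= a -> a <= b -> b <= l -> wdist (hdiff c a b) <= b - a.
  move=> a0 ab bL; rewrite /hdiff /c bL (le_trans ab bL) -[X in _ <= X]mul1r.
  exact: cAl.
have above a b : l <= a -> a <= b -> b <= wdist x -> wdist (hdiff c a b) <= b - a.
  move=> La ab bD; rewrite /hdiff !cl ?(le_trans La ab)// hmulVV.
  apply: le_trans (cBl (a - l) (b - l) _ _ _) _; lra.
have cW a b : 0 <= a -> a <= b -> b <= wdist x -> wdist (hdiff c a b) <= b - a.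
  move=> a0 ab bD.
  have [bL|/ltW Lb] := leP b l; first exact: below.
  have [aL|/ltW La] := leP a l; last exact: above.
  rewrite -(hdiff_chain c a l b); apply: le_trans (wdist_triangle Qsym Qint _ _) _.
  by have := below a l a0 aL (lexx l); have := above l b (lexx l) Lb bD; lra.
exists (fun t => c (t * wdist x)); split.
- by rewrite mul0r /c l0.
- by rewrite mul1r cl// cB1 hmulKV.
- move=> a b a0 ab b1; have d0 := wdist_ge0 Qsym Qint x.
  apply: le_trans (cW (a * wdist x) (b * wdist x) _ _ _) _.
  + exact: mulr_ge0.
  + exact: ler_wpM2r.
  + exact: ler_piMl.
  + by rewrite -mulrBl mulrC.
- by rewrite l0 l1.
- by move=> d0; rewrite divfK ?gt_eqF// /c lexx.
Qed.

(** By [wdist_lower], an increment of distance [d] moves the projection by order [d] and has height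
    of order [d ^ 2], which is [horizontal]. *)
Lemma wlip_admissible k g : wlip k 1 g -> admissible g.
Proof.
move=> gl; have [M M0 HM] := wdist_lower Qsym Qint.
have dk a b : 0 <= a -> a <= b -> b <= 1 -> wdist (hdiff g a b) <= `|k| * (b - a).
  move=> a0 ab b1; apply: le_trans (gl _ _ a0 ab b1) _.
  by rewrite ler_wpM2r ?ler_norm// subr_ge0.
have coord (f : R * R -> R) : (forall u v, f (u - v) = f u - f v) ->
    (forall v, `|f v| <= `|v.1| + `|v.2|) -> lipschitz01 (fun t => f (g t).1).
  move=> fB fle; exists (M * `|k|).
  have main a b : 0 <= a -> a <= b -> b <= 1 ->
      `|f (g b).1 - f (g a).1| <= M * `|k| * (b - a).
    move=> a0 ab b1; rewrite -fB -(hdiff1 g a b); apply: le_trans (fle _) _.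
    apply: le_trans (HM _).1 _; rewrite -mulrA ler_pM2l//; exact: dk.
  move=> a b /andP[a0 a1] /andP[b0 b1]; have [ab|/ltW ba] := leP a b.
    by rewrite distrC (distrC a) (ger0_norm (_ : 0 <= b - a)) ?subr_ge0//; exact: main.
  by rewrite (ger0_norm (_ : 0 <= a - b)) ?subr_ge0//; exact: main.
apply/admissibleP; split.
- by apply: coord => // v; rewrite lerDl.
- by apply: coord => // v; rewrite lerDr.
exists (M * `|k| ^+ 2) => a b a0 ab b1; rewrite -hdiff2.
apply: le_trans (HM _).2 _; rewrite -mulrA -exprMn ler_pM2l//.
by rewrite lerXn2r ?nnegrE ?wdist_ge0 ?mulr_ge0 ?subr_ge0//; exact: dk.
Qed.

Notation chord g := (fun u v : R => normL Q ((hproj (g v)).1 - (hproj (g u)).1,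
                 (hproj (g v)).2 - (hproj (g u)).2)).

Lemma chord_wdist g a b : chord g a b <= wdist (hdiff g a b).
Proof. by have := normL_wdist Qsym Qint (hdiff g a b); rewrite hdiff1. Qed.

Lemma wlip_length k g a b : wlip k 1 g -> 0 <= a -> a <= b -> b <= 1 ->
  (proj_length Q g a b <= (k * (b - a))%:E)%E.
Proof.
move=> gl a0 _ b1; apply: ge_ereal_sup => _ [l /= pl <-]; rewrite lee_fin.
elim: l a a0 pl => [|t l IH] a a0 /=.
  rewrite andbT big_cons big_nil addr0 => ab.
  exact: le_trans (chord_wdist g a b) (gl _ _ a0 ab b1).
move=> /andP[at_ pl]; rewrite big_cons.
have t0 : 0 <= t by exact: le_trans at_.
have tb : t <= b.
  have : path <=%R t (rcons l b) by [].
  rewrite (path_sortedE le_trans) => /andP[/allP h _]; apply: h.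
  by rewrite mem_rcons mem_head.
have h1 := IH t t0 pl.
have h2 := gl _ _ a0 at_ (le_trans tb b1).
have h3 := chord_wdist g a t.
by move: h1 h3 => /=; set S := \sum_(_ <- _) _; lra.
Qed.

Lemma pairmap_iota (T : Type) (f : R -> R -> T) (P : nat -> R) k m :
  pairmap f (P m) [seq P i.+1 | i <- iota m k] = [seq f (P i) (P i.+1) | i <- iota m k].
Proof. by elim: k m => [//|k IH] m /=; rewrite IH. Qed.

(** An inscribed polygon with [m + 1] equal time steps is no longer than the curve and misses its
    endpoint by a vertical error of order [1 / (m + 1)]. By [wpt_reach] this error costs only its
    square root, which tends to zero. *)
Lemma horizontal_length g a b : horizontal g -> 0 <= a -> a <= b -> b <= 1 ->
  ((wdist (hdiff g a b))%:E <= proj_length Q g a b)%E.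
Proof.
move=> [_ _ [C HC]] a0 ab b1.
case E : (proj_length Q g a b) => [l| |]; [|by rewrite leey|]; last first.
  have : ((chord g a b)%:E <= proj_length Q g a b)%E.
    apply: ereal_sup_ubound; exists [::]; first by rewrite /= ab.
    by rewrite /= big_cons big_nil addr0.
  by rewrite E.
rewrite lee_fin; have [K K0 HK] := wpt_reach Qsym Qint.
have C0 : 0 <= `|C| by [].
have step (m : nat) : wdist (hdiff g a b) <= l + K * Num.sqrt (`|C| / m.+1%:R).
  pose d := (b - a) / m.+1%:R; pose P (i : nat) := a + i%:R * d.
  have d0 : 0 <= d by rewrite divr_ge0// subr_ge0.
  have P0 : P 0%N = a by rewrite /P mul0r addr0.
  have Pm : P m.+1 = b by rewrite /P /d mulrC divfK ?pnatr_eq0//; lra.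
  have Ple i j : (i <= j)%N -> P i <= P j.
    by move=> ij; rewrite /P lerD2l ler_wpM2r// ler_nat.
  have Pd i : P i.+1 - P i = d by rewrite /P -natr1; ring.
  pose W k := [seq (g (P i.+1)).1 - (g (P i)).1 | i <- iota 0 k].
  (* Vertical elements are central, so the heights of the chord increments simply add up to [e]. *)
  have area k : (k <= m.+1)%N -> exists2 e : R, hdiff g a (P k) = hmul (wpt (W k)) (0, e) &
      `|e| <= k%:R * (`|C| * d ^+ 2).
    elim: k => [_|k IH km].
      exists 0; last by rewrite normr0 mul0r.
      by rewrite P0 /hdiff hmulVp /wpt /=; apply: hptE => /=; [rewrite addr0|rewrite wedge0r; ring].
    have [e he ee] := IH (ltnW km).
    exists (e + (hdiff g (P k) (P k.+1)).2).
      rewrite -(hdiff_chain g a (P k)) he /W -addn1 iotaD map_cat /= add0n.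
      rewrite -/(W k) wpt_cat /wpt /hdiff /= !addn1.
      apply: hptE; last first.
        by rewrite /= !(wedgeDr, wedgeDl, wedge0r, wedge0l, wedgeNl, wedgeNr); ring.
      by apply: pairE => /=; ring.
    apply: le_trans (ler_normD _ _) _; rewrite -natr1 mulrDl mul1r lerD//.
    rewrite hdiff2; apply: le_trans (HC _ _ _ _ _) _.
    - by apply: le_trans a0 _; rewrite -P0; exact: Ple.
    - exact: Ple.
    - by rewrite (le_trans _ b1)// -Pm; exact: Ple.
    - by rewrite Pd ler_wpM2r ?sqr_ge0// ler_norm.
  have [e he ee] := area m.+1 (leqnn _); rewrite Pm in he.
  have Wl : len (W m.+1) <= l.
    rewrite -lee_fin -E; apply: ereal_sup_ubound.
    have eq : rcons [seq P i.+1 | i <- iota 0 m] b = [seq P i.+1 | i <- iota 0 m.+1].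
      by rewrite -Pm -[in RHS]addn1 iotaD map_cat /= add0n cats1.
    exists [seq P i.+1 | i <- iota 0 m]; rewrite /= eq -P0.
      have : forall k j, path <=%R (P j) [seq P i.+1 | i <- iota j k].
        by elim=> [//|k IH] j /=; rewrite IH Ple.
      exact.
    by rewrite pairmap_iota /wlen /W !big_map.
  rewrite he; apply: le_trans (wdist_triangle Qsym Qint _ _) _; apply: lerD.
    exact: le_trans (wdist_le Qsym Qint _) Wl.
  have [V Vx Vl] := HK (0, e); rewrite -Vx; apply: le_trans (wdist_le Qsym Qint _) _.
  apply: le_trans Vl _; rewrite /= normr0 !add0r ler_pM2l// ler_wsqrtr//.
  apply: le_trans ee _; have n0 : (m.+1%:R : R) != 0 by rewrite pnatr_eq0.
  have -> : m.+1%:R * (`|C| * d ^+ 2) = `|C| / m.+1%:R * (b - a) ^+ 2.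
    by rewrite /d; field.
  by rewrite ler_piMr ?divr_ge0//; apply: exprn_ile1; lra.
apply/ler_addgt0Pr => e e0.
(* With more than [y] pieces, [K * sqrt (|C| / n)] is at most [e]. *)
pose y := `|C| / (e / K) ^+ 2.
have eK : 0 < e / K by rewrite divr_gt0.
apply: le_trans (step (Num.bound y)) _; rewrite lerD2l.
rewrite mulrC -ler_pdivlMr// -(ger0_norm (ltW eK)) -(sqrtr_sqr (e / K)) ler_wsqrtr//.
have yb : y < (Num.bound y).+1%:R.
  apply: (@lt_trans _ _ (Num.bound y)%:R); last by rewrite ltr_nat.
  by apply: archi_boundP; rewrite divr_ge0// sqr_ge0.
rewrite ler_pdivrMr ?ltr0Sn// mulrC -ler_pdivrMr ?exprn_gt0//.
exact: ltW.
Qed.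

Lemma hdiff0 g t : g 0 = horigin R -> hdiff g 0 t = g t.
Proof.
move=> g0; rewrite /hdiff g0; have -> : hinv (horigin R) = horigin R.
  by apply: hptE => /=; rewrite ?oppr0//; apply: pairE; rewrite /= oppr0.
by rewrite hmul0p.
Qed.

Lemma on_geodesic_end x : on_geodesic s x x (wdist x).
Proof. by split; rewrite ?subrr ?hmulVp ?(wdist0 Qsym Qint). Qed.

Lemma dCC_wdist x : dCC Q (horigin R) x = (wdist x)%:E.
Proof.
apply/eqP; rewrite eq_le; apply/andP; split.
  have [g [g0 g1 gl _ _]] := geodesic_through (on_geodesic_end x).
  apply: (@le_trans _ _ (proj_length Q g 0 1)).
    by apply: ereal_inf_lbound; exists g => //; split; [exact: wlip_admissible gl|].
  by have := wlip_length gl (lexx 0) ler01 (lexx 1); rewrite subr0 mulr1.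
apply: le_ereal_inf_tmp => _ [g [/admissibleP ga [g0 <-]] <-].
by rewrite -[X in wdist X](hdiff0 _ g0); exact: horizontal_length.
Qed.

Lemma wlip_geodesic x g : wlip (wdist x) 1 g -> g 0 = horigin R -> g 1 = x ->
  cc_geodesic Q x g.
Proof.
move=> gl g0 g1; have adm := wlip_admissible gl.
have pl t : 0 <= t <= 1 -> proj_length Q g 0 t = (t * wdist x)%:E.
  move=> /andP[t0 t1]; apply/eqP; rewrite eq_le; apply/andP; split.
    by have := wlip_length gl (lexx 0) t0 t1; rewrite subr0 mulrC.
  have /admissibleP hg := adm.
  apply: le_trans (horizontal_length hg (lexx 0) t0 t1); rewrite lee_fin hdiff0//.
  have := wdist_triangle Qsym Qint (g t) (hdiff g t 1).
  by rewrite /hdiff hmulKV g1 => h; have := gl _ _ t0 t1 (lexx 1); rewrite /hdiff g1; lra.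
split=> //; split=> //; split=> //; rewrite dCC_wdist; split.
  by rewrite pl ?mul1r// ler01 lexx.
by move=> t t01; rewrite pl// EFinM.
Qed.

Lemma geodesic_on x g t : cc_geodesic Q x g -> 0 <= t <= 1 ->
  on_geodesic s x (g t) (t * wdist x).
Proof.
move=> [/admissibleP ga [g0 [g1 [gl gt]]]] t01; have /andP[t0 t1] := t01.
have plt := gt t t01; rewrite dCC_wdist -EFinM in plt; rewrite dCC_wdist in gl.
split.
  by rewrite -lee_fin -plt -[X in wdist X](hdiff0 _ g0); exact: horizontal_length.
(* Subdivisions of [[0, t]] and [[t, 1]] concatenate to one of [[0, 1]]. The first part has length
   [t * wdist x], which leaves at most [(1 - t) * wdist x] for the second. *)
rewrite -lee_fin -{1}g1; apply: le_trans (horizontal_length ga t0 t1 (lexx 1)) _.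
apply: ge_ereal_sup => _ [l2 /= p2 <-]; rewrite lee_fin.
set S2 := \sum_(_ <- _) _.
suff : t * wdist x <= wdist x - S2 by lra.
rewrite -lee_fin -plt; apply: ge_ereal_sup => _ [l1 /= p1 <-]; rewrite lee_fin.
set S1 := \sum_(_ <- _) _; suff : S1 + S2 <= wdist x by lra.
rewrite -lee_fin -gl; apply: ereal_sup_ubound; exists (rcons l1 t ++ l2).
  by rewrite /= rcons_cat cat_path p1 last_rcons.
by rewrite /= rcons_cat pairmap_cat big_cat /= last_rcons.
Qed.

(** Two points at equal arc length lie on geodesics that differ at the time [l / wdist x];
    conversely geodesics have constant speed, so they differ at points of equal arc length. *)
Lemma unique_geodesicP x : unique_geodesic Q x <-> ~ branching s x.
Proof.
split=> [[_ uni] [p [q [l [pq hp hq]]]]|nb].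
  have [g1 [a0 a1 al /andP[l0 l1] ap]] := geodesic_through hp.
  have [g2 [b0 b1 bl _ bq]] := geodesic_through hq.
  have [d0|d0] := ltP 0 (wdist x).
    apply: pq; rewrite -(ap d0) -(bq d0).
    apply: uni; [exact: wlip_geodesic|exact: wlip_geodesic|].
    by rewrite divr_ge0 ?(ltW d0)//= ler_pdivrMr// mul1r.
  apply: pq; have [dp _] := on_geodesic_eq Qsym Qint hp.
  have [dq _] := on_geodesic_eq Qsym Qint hq.
  have l00 : l = 0 by lra.
  by rewrite (wdist_eq0 Qsym Qint (etrans dp l00)) (wdist_eq0 Qsym Qint (etrans dq l00)).
split.
  have [g [g0 g1 gl _ _]] := geodesic_through (on_geodesic_end x).
  by exists g; exact: wlip_geodesic.
move=> g1 g2 h1 h2 t t01; apply: contrapT => ne; apply: nb.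
exists (g1 t), (g2 t), (t * wdist x); split=> //; exact: geodesic_on.
Qed.

End Geodesics.

(** * Topology and measurability *)

Section RealContinuity.
Variables (T : topologicalType) (R : realType).
Implicit Types f g : T -> R.

Lemma continuous_add f g : continuous f -> continuous g -> continuous (fun x => f x + g x).
Proof. by move=> cf cg x; apply: (@cvgD _ _ _ (nbhs x) _); [exact: cf|exact: cg]. Qed.
Lemma continuous_opp f : continuous f -> continuous (fun x => - f x).
Proof. by move=> cf x; apply: (@cvgN _ _ _ (nbhs x) _); exact: cf. Qed.
Lemma continuous_mul f g : continuous f -> continuous g -> continuous (fun x => f x * g x).
Proof. by move=> cf cg x; apply: (@cvgM R _ (nbhs x) _); [exact: cf|exact: cg]. Qed.
Lemma continuous_abs f : continuous f -> continuous (fun x => `|f x|).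
Proof. by move=> cf x; apply: (@cvg_norm _ _ _ (nbhs x) _); exact: cf. Qed.
Lemma continuous_sqrt f : continuous f -> continuous (fun x => Num.sqrt (f x)).
Proof. by move=> cf x; apply: continuous_comp; [exact: cf|exact: sqrt_continuous]. Qed.
Lemma continuous_const (k : R) : continuous (fun _ : T => k).
Proof. exact: (@cst_continuous _ _ k). Qed.
End RealContinuity.

Section HeisenbergContinuity.
Variables (T : topologicalType) (R : realType).
Implicit Types f g : T -> hpt R.

Record hcont f : Prop := HCont {
  hcont1 : continuous (fun x => (f x).1.1);
  hcont2 : continuous (fun x => (f x).1.2);
  hcont3 : continuous (fun x => (f x).2) }.

Lemma continuous_hcont f : continuous f -> hcont f.
Proof.
have cfst (A B : topologicalType) (h : T -> A * B) : continuous h ->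
    continuous (fun x => (h x).1).
  by move=> ch x; apply: continuous_comp; [exact: ch|exact: cvg_fst].
have csnd (A B : topologicalType) (h : T -> A * B) : continuous h ->
    continuous (fun x => (h x).2).
  by move=> ch x; apply: continuous_comp; [exact: ch|exact: cvg_snd].
move=> cf; split; [exact/cfst/cfst|exact/csnd/cfst|exact: csnd].
Qed.

Lemma hcont_hmul f g : hcont f -> hcont g -> hcont (fun x => hmul (f x) (g x)).
Proof.
move=> [f1 f2 f3] [g1 g2 g3]; split => /=.
- exact: continuous_add.
- exact: continuous_add.
- apply: continuous_add; first exact: continuous_add.
  apply: continuous_mul; first exact: continuous_const.
  apply: continuous_add; first exact: continuous_mul.
  by apply: continuous_opp; exact: continuous_mul.
Qed.

Lemma hcont_hinv f : hcont f -> hcont (fun x => hinv (f x)).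
Proof. by move=> [f1 f2 f3]; split => /=; exact: continuous_opp. Qed.

Lemma hcont_const (p : hpt R) : hcont (fun _ : T => p).
Proof. by split; exact: continuous_const. Qed.

End HeisenbergContinuity.

(** * Continuity of the distance and the structure of the branching set *)

Section DistanceTopology.
Variables (R : realType) (s : seq (R * R)).
Notation n := (size s).
Notation Q := (conv_hull s).
Hypothesis Qsym : centrally_symmetric Q.
Hypothesis Qint : interior Q !=set0.
Notation N := (normL Q).
Notation wdist := (wdist s).
Implicit Types (x p q : hpt R).

(** The distances of two points differ by at most the distance of their quotient, which [wpt_reach]
    bounds by a continuous function vanishing at the base point. *)
Lemma wdist_hcont (T : topologicalType) (f : T -> hpt R) : hcont f ->
  continuous (fun t => wdist (f t)).
Proof.
move=> hf t0; have [C C0 HC] := wpt_reach Qsym Qint.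
pose h t := hmul (hinv (f t0)) (f t).
have ch : hcont h by apply: hcont_hmul => //; exact: hcont_const.
pose F t := C * (`|(h t).1.1| + `|(h t).1.2| + Num.sqrt `|(h t).2|).
have cF : continuous F.
  have [h1 h2 h3] := ch; apply: continuous_mul; first exact: continuous_const.
  apply: continuous_add; last by apply: continuous_sqrt; exact: continuous_abs.
  by apply: continuous_add; exact: continuous_abs.
have F0 : F t0 = 0.
  by rewrite /F /h hmulVp /= !normr0 sqrtr0 !addr0 mulr0.
have close t : `|wdist (f t0) - wdist (f t)| <= F t.
  have hF : wdist (h t) <= F t.
    have [W hW lW] := HC (h t).
    by have := wdist_le Qsym Qint W; rewrite hW => le1; exact: le_trans le1 lW.
  have h1 := wdist_triangle Qsym Qint (f t0) (h t); rewrite /h hmulKV -/(h t) in h1.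
  have h2 := wdist_triangle Qsym Qint (f t) (hinv (h t)).
  rewrite (wdist_hinv Qsym Qint) /h hinvM hinvK hmulKV -/(h t) in h2.
  by rewrite ler_norml; lra.
apply/(@cvgrPdist_le _ R^o) => e e0; near=> t.
apply: le_trans (close t) _; apply: le_trans (ler_norm _) _.
rewrite -[F t]subr0 -F0 distrC.
by near: t; apply: (@cvgr_dist_le _ R^o); [exact: cF|].
Unshelve. all: by end_near. Qed.

Lemma wdist_continuous : continuous wdist.
Proof. by apply: (@wdist_hcont _ id); apply: continuous_hcont => x; exact: cvg_id. Qed.

Lemma normL_fst_continuous : continuous (fun x : hpt R => N x.1).
Proof.
move=> x0; have [C C0 HC] := normL_upper Qsym Qint.
pose F x := C * (`|(x.1 - x0.1).1| + `|(x.1 - x0.1).2|).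
have [c1 c2 _] : hcont (@id (hpt R)) by apply: continuous_hcont => x; exact: cvg_id.
have cF : continuous F.
  apply: continuous_mul; first exact: continuous_const.
  by apply: continuous_add; apply: continuous_abs; apply: continuous_add => //;
    exact: continuous_const.
have F0 : F x0 = 0 by rewrite /F subrr /= normr0 addr0 mulr0.
have close x : `|N x0.1 - N x.1| <= F x.
  have h1 := normL_triangle Qsym Qint (x.1 - x0.1) x0.1.
  have h2 := normL_triangle Qsym Qint (- (x.1 - x0.1)) x.1.
  rewrite subrK in h1; rewrite opprB subrK -opprB (normLN Qsym Qint) in h2.
  by have h3 := HC (x.1 - x0.1); rewrite -/(F x) in h3; rewrite ler_norml; lra.
apply/(@cvgrPdist_le _ R^o) => e e0; near=> t.
apply: le_trans (close t) _; apply: le_trans (ler_norm _) _.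
rewrite -[F t]subr0 -F0 distrC.
by near: t; apply: (@cvgr_dist_le _ R^o); [exact: cF|].
Unshelve. all: by end_near. Qed.

Lemma closed_le_fun (T : topologicalType) (f g : T -> R) : continuous f -> continuous g ->
  closed [set t | f t <= g t].
Proof.
move=> cf cg; have -> : [set t | f t <= g t] = (fun t => g t + - f t) @^-1` [set y | 0 <= y].
  by apply/seteqP; split=> t /=; rewrite subr_ge0.
apply: preimage_closed; last exact: closed_ge.
by move=> t _; apply: continuous_add => //; exact: continuous_opp.
Qed.

Lemma wdist_ball_compact (r : R) : compact [set x | wdist x <= r].
Proof.
have [M M0 HM] := wdist_lower Qsym Qint.
pose m := M * `|r| + M * `|r| ^+ 2.
pose box : set (hpt R) := (`[- m, m] `*` `[- m, m]) `*` `[- m, m].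
have cbox : compact box.
  by apply: compact_setX; [apply: compact_setX|]; exact: segment_compact.
apply: (subclosed_compact _ cbox).
  exact: closed_le_fun wdist_continuous (@continuous_const _ _ r).
move=> x /= xr; have [h1 h2] := HM x.
have d0 := wdist_ge0 Qsym Qint x.
have dr : wdist x <= `|r| by exact: le_trans (ler_norm r).
have b1 : M * wdist x <= M * `|r| by rewrite ler_pM2l.
have b2 : M * wdist x ^+ 2 <= M * `|r| ^+ 2.
  by rewrite ler_pM2l// lerXn2r// nnegrE.
have p1 : 0 <= M * `|r| by rewrite mulr_ge0// ltW.
have p2 : 0 <= M * `|r| ^+ 2 by rewrite mulr_ge0// ltW.
have a1 : 0 <= `|x.1.1| by []. have a2 : 0 <= `|x.1.2| by [].
by split; [split|]; rewrite /= in_itv /= -ler_norml /m; lra.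
Qed.

Lemma wdist_eq x p : wdist (hmul (hinv p) x) = 0 -> p = x.
Proof. by move=> /(wdist_eq0 Qsym Qint) e; rewrite -(hmulKV p x) e hmulp0. Qed.

Definition split_at x p := wdist p + wdist (hmul (hinv p) x) <= wdist x.

(** Only non-strict inequalities between continuous functions remain: [l] is eliminated as the
    common distance of [p] and [q], and [p <> q] becomes a lower bound [1 / (k + 1)] for some
    [k]. *)
Lemma branchingP x : branching s x <->
  exists p q, [/\ split_at x p, split_at x q, wdist p <= wdist q, wdist q <= wdist p &
    exists k : nat, k.+1%:R^-1 <= wdist (hmul (hinv p) q)].
Proof.
split=> [[p [q [l [pq hp hq]]]]|[p [q [hp hq h1 h2 [k hk]]]]].
  have [p1 p2] := on_geodesic_eq Qsym Qint hp.
  have [q1 q2] := on_geodesic_eq Qsym Qint hq.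
  exists p, q; split; rewrite /split_at ?p1 ?q1 ?p2 ?q2 ?subrKC//.
  have d0 : 0 < wdist (hmul (hinv p) q).
    rewrite lt0r (wdist_ge0 Qsym Qint) andbT; apply/eqP => e.
    by apply: pq; exact: wdist_eq.
  exists (Num.bound (wdist (hmul (hinv p) q))^-1).
  rewrite -[X in _ <= X]invrK lef_pV2 ?posrE ?invr_gt0 ?ltr0Sn//.
  apply/ltW/(@lt_trans _ _ (Num.bound (wdist (hmul (hinv p) q))^-1)%:R).
    by apply: archi_boundP; rewrite invr_ge0 ltW.
  by rewrite ltr_nat.
exists p, q, (wdist p); split.
- move=> e; move: hk; rewrite e hmulVp (wdist0 Qsym Qint) leNgt invr_gt0 ltr0Sn//.
- by split=> //; move: hp; rewrite /split_at; lra.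
- by split=> //; move: hq; rewrite /split_at; lra.
Qed.

(** For fixed [k] the triples [(x, p, q)] form a compact set, since [p] and [q] stay in the ball;
    its projection to [x] is compact, hence closed. *)
Lemma branching_closed_pieces (r : R) : exists G : nat -> set (hpt R),
  (forall k, closed (G k)) /\
  [set x | wdist x <= r] `&` branching s = \bigcup_k G k.
Proof.
pose B : set (hpt R) := [set x | wdist x <= r].
pose P k : set ((hpt R * hpt R) * hpt R) := ((B `*` B) `*` B) `&`
  ([set t | split_at t.1.1 t.1.2] `&` [set t | split_at t.1.1 t.2] `&`
   [set t | wdist t.1.2 <= wdist t.2] `&` [set t | wdist t.2 <= wdist t.1.2] `&`
   [set t | k.+1%:R^-1 <= wdist (hmul (hinv t.1.2) t.2)]).
pose T := ((hpt R * hpt R) * hpt R)%type.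
have c1 : hcont (fun t : T => t.1.1).
  apply: continuous_hcont => t; apply: continuous_comp; exact: cvg_fst.
have c2 : hcont (fun t : T => t.1.2).
  by apply: continuous_hcont => t; apply: continuous_comp; [exact: cvg_fst|exact: cvg_snd].
have c3 : hcont (fun t : T => t.2).
  by apply: continuous_hcont => t; exact: cvg_snd.
have csplit (f g : T -> hpt R) : hcont f -> hcont g -> closed [set t | split_at (f t) (g t)].
  move=> cf cg; apply: closed_le_fun; last exact: wdist_hcont.
  apply: continuous_add; first exact: wdist_hcont.
  by apply: wdist_hcont; apply: hcont_hmul => //; exact: hcont_hinv.
have cP k : compact (P k).
  apply: compact_closedI.
    by apply: compact_setX; [apply: compact_setX|]; exact: wdist_ball_compact.
  apply: closedI; [apply: closedI; [apply: closedI; [apply: closedI|]|]|].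
  - exact: csplit.
  - exact: csplit.
  - by apply: closed_le_fun; exact: wdist_hcont.
  - by apply: closed_le_fun; exact: wdist_hcont.
  - apply: closed_le_fun; first exact: continuous_const.
    by apply: wdist_hcont; apply: hcont_hmul => //; exact: hcont_hinv.
exists (fun k => (fun t : T => t.1.1) @` P k); split=> [k|].
  apply: compact_closed; first exact: norm_hausdorff.
  apply: continuous_compact (cP k); apply: continuous_subspaceT => t.
  apply: continuous_comp; exact: cvg_fst.
apply/seteqP; split=> [x [xr /branchingP[p [q [hp hq h1 h2 [k hk]]]]]|x [k _ [[[x' p] q] /= H <-]]].
  exists k => //; exists ((x, p), q) => //; split; last by do 4 ?split.
  have := wdist_ge0 Qsym Qint (hmul (hinv p) x).
  have := wdist_ge0 Qsym Qint (hmul (hinv q) x).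
  move: hp hq xr; rewrite /split_at /B /= => hp hq xr i1 i2.
  by split; [split|]; rewrite /=; lra.
move: H => [[[/= xr _] _] [[[[h1 h2] h3] h4] h5]]; split=> //.
by apply/branchingP; exists p, q; split=> //; exists k.
Qed.

End DistanceTopology.

Section BorelProduct.
Variable R : realType.

(** Measurability is in the product sigma-algebra, so [U] is written as the countable union of the
    cubes inside it with rational centre and radius [1 / (k + 1)]. *)
Lemma open_measurable_hpt (U : set (hpt R)) : open U -> measurable U.
Proof.
move=> oU.
pose box (i : rat * rat * rat * nat) : set (hpt R) :=
  (ball (ratr i.1.1.1 : R) (i.2.+1%:R^-1) `*` ball (ratr i.1.1.2 : R) (i.2.+1%:R^-1)) `*`
   ball (ratr i.1.2 : R) (i.2.+1%:R^-1).
have mbox i : measurable (box i).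
  by apply: measurableX; [apply: measurableX|]; exact: measurable_ball.
pose F i := if `[< box i `<=` U >] then box i else set0.
have -> : U = \bigcup_i F i.
  apply/seteqP; split=> [x Ux|x [i _]]; last first.
    by rewrite /F; case: asboolP => // iU /iU.
  have /nbhs_ballP[e /= e0 He] : nbhs x U by exact: open_nbhs_nbhs.
  pose m := Num.bound (2 / e).
  have m0 : 0 < m.+1%:R^-1 :> R by rewrite invr_gt0.
  have me : 2 * m.+1%:R^-1 < e.
    rewrite ltr_pdivrMr ?ltr0Sn// mulrC -ltr_pdivrMr//.
    apply: (@lt_trans _ _ m%:R); last by rewrite ltr_nat.
    by apply: archi_boundP; rewrite divr_ge0// ltW.
  have rat_near (y : R) : exists q : rat, `|y - ratr q| < m.+1%:R^-1.
    move: (m.+1%:R^-1) m0 => d d0.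
    have /rat_in_itvoo[q] : y - d < y + d by lra.
    by rewrite in_itv /= => /andP[h1 h2]; exists q; rewrite ltr_norml; lra.
  have [q1 h1] := rat_near x.1.1; have [q2 h2] := rat_near x.1.2.
  have [q3 h3] := rat_near x.2.
  exists (q1, q2, q3, m) => //; rewrite /F asboolT.
    by split; [split|]; rewrite /ball /= distrC.
  move=> y [[y1 y2] y3]; apply: He.
  have tri (a b c : R) : `|a - b| < m.+1%:R^-1 -> ball b (m.+1%:R^-1) c -> ball a e c.
    rewrite /ball /= => i1 i2; apply: le_lt_trans (ler_distD b _ _) _.
    by apply: lt_trans me; rewrite mulr_natl mulr2n; exact: ltrD.
  by split; [split; [exact: tri y1|exact: tri y2]|exact: tri y3].
apply: countable_bigcupT_measurable; first exact: countableP.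
by move=> i; rewrite /F; case: asboolP.
Qed.

Lemma closed_measurable_hpt (C : set (hpt R)) : closed C -> measurable C.
Proof.
by move=> cC; rewrite -[C]setCK; apply: measurableC; apply: open_measurable_hpt;
  exact: closed_openC.
Qed.

End BorelProduct.

(** * Volumes *)

(** Packages the right-hand side of a dilation formula as a measure, to which uniqueness theorems
    for Lebesgue and product measures apply. *)
Lemma scaled_pushforward d d' (T1 : measurableType d) (T2 : measurableType d')
    (R : realType) (m : {measure set T1 -> \bar R}) (f : T1 -> T2) (k : R) :
  0 <= k -> measurable_fun setT f ->
  exists nu : {measure set T2 -> \bar R}, forall A, nu A = (k%:E * m (f @^-1` A))%E.
Proof.
move=> k0 mf.
pose nu := measure_function_pushforward__canonical__measure_function_Measure m mf.
by exists (mscale (NngNum k0) nu).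
Qed.

Section Dilation.
Variable R : realType.
Notation lam := (@lebesgue_measure R).
Notation TR := (measurableTypeR R).

Lemma lebesgue_dil (t : R) : 0 < t -> forall A : set TR, measurable A ->
  lam A = (t%:E * lam ((fun x : TR => (t * x : R)%R) @^-1` A))%E.
Proof.
move=> t0; have mf : measurable_fun setT (fun x : TR => (t * x : R) : TR).
  exact: (@mulrl_measurable R setT t).
have [nu nuE] := scaled_pushforward lam (ltW t0) mf.
move=> A mA; rewrite -nuE; apply: lebesgue_measure_unique => // X.
move=> /ocitvP[->|[[a b] /= ab ->]]; first by rewrite !measure0.
rewrite nuE.
have -> : (fun x : R => t * x) @^-1` `]a, b]%classic = `](a / t), (b / t)]%classic.
  apply/seteqP; split=> x /=; rewrite !in_itv /=.
    by rewrite ltr_pdivrMr// ler_pdivlMr// mulrC.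
  by rewrite ltr_pdivrMr// ler_pdivlMr// mulrC.
have lamE (x y : R) : x < y -> lam `]x, y]%classic = (y - x)%:E.
  by move=> xy; rewrite lebesgue_measure_itv /= lte_fin xy.
have ab' : a / t < b / t by rewrite ltr_pM2r ?invr_gt0.
apply: etrans (lamE _ _ ab) (esym _).
apply: etrans (congr1 (fun z => (t%:E * z)%E) (lamE _ _ ab')) _.
by rewrite -EFinM; congr EFin; field; rewrite gt_eqF.
Qed.

Notation lam2 := (lam \x lam)%E.
Notation T2 := (TR * TR)%type.

Lemma lebesgue2_dil (t : R) : 0 < t -> forall A : set T2, measurable A ->
  lam2 A = ((t ^+ 2)%:E * lam2 ((fun v : T2 => ((t * v.1)%R : R, (t * v.2)%R : R) : T2) @^-1` A))%E.
Proof.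
move=> t0; have mf : measurable_fun setT (fun v : T2 => (t * v.1 : R, t * v.2 : R) : T2).
  have m1 : measurable_fun setT (fun x : TR => (t * x : R) : TR).
    exact: (@mulrl_measurable R setT t).
  apply: measurable_fun_pair.
    by apply: (measurableT_comp m1); exact: measurable_fst.
  by apply: (measurableT_comp m1); exact: measurable_snd.
have [nu nuE] := scaled_pushforward lam2 (sqr_ge0 t) mf.
move=> A mA; rewrite -nuE; apply: product_measure_unique => // X Y mX mY.
have m1 Z : measurable Z -> measurable ((fun x : TR => (t * x : R)) @^-1` Z).
  by move=> mZ; rewrite -[X in measurable X]setTI; exact: (@mulrl_measurable R setT t).
apply: etrans (nuE _) _.
apply: etrans (congr1 (fun z => ((t ^+ 2)%:E * z)%E)
  (product_measure1E lam lam (m1 _ mX) (m1 _ mY))) _.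
apply: etrans _ (esym (congr2 (fun u v : \bar R => (u * v)%E)
  (lebesgue_dil t0 mX) (lebesgue_dil t0 mY))).
by rewrite expr2 EFinM muleACA.
Qed.

Lemma lebesgue2_sigma_finite : sigma_finite (setT : set T2) lam2.
Proof.
pose I (n : nat) : set TR := `]- (n%:R : R), n%:R]%classic.
have mI n : measurable (I n) by exact: measurable_itv.
exists (fun n => I n `*` I n).
  apply/seteqP; split=> // -[a b] _; exists (Num.bound (`|a| + `|b|)).+1 => //.
  have h : `|a| + `|b| < (Num.bound (`|a| + `|b|))%:R by apply: archi_boundP; rewrite addr_ge0.
  have ha : 0 <= `|a| by []. have hb : 0 <= `|b| by [].
  have bd (x : R) : `|x| <= `|a| + `|b| -> I (Num.bound (`|a| + `|b|)).+1 x.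
    move=> hx; rewrite /I /= in_itv /= -natr1.
    by have /andP[] : - (Num.bound (`|a| + `|b|))%:R < x < (Num.bound (`|a| + `|b|))%:R;
      [rewrite -ltr_norml; exact: le_lt_trans h|lra].
  by split; apply: bd; lra.
move=> n; split; first exact: measurableX.
have fin : (lam (I n) < +oo)%E.
  by rewrite lebesgue_measure_itv; case: ifP => _; rewrite ?ltry// -EFinD ltry.
rewrite product_measure1E//; apply: lte_mul_pinfty => //.
by rewrite ge0_fin_numE.
Qed.

(** The exponent 4 is the homogeneous dimension: 1 for each plane coordinate and 2 for the
    height. *)
Lemma vol_dil (t : R) : 0 < t -> forall A : set (hpt R), measurable A ->
  vol A = ((t ^+ 4)%:E * vol (hdil t @^-1` A))%E.
Proof.
move=> t0.
pose T3 := ((TR * TR) * TR)%type.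
have mf : measurable_fun setT (hdil t : T3 -> T3).
  have m1 k : measurable_fun setT (fun x : TR => (k * x : R) : TR).
    exact: (@mulrl_measurable R setT k).
  apply: measurable_fun_pair; [apply: measurable_fun_pair|].
  - apply: (measurableT_comp (m1 t)).
    by apply: (measurableT_comp measurable_fst); exact: measurable_fst.
  - apply: (measurableT_comp (m1 t)).
    by apply: (measurableT_comp measurable_snd); exact: measurable_fst.
  - by apply: (measurableT_comp (m1 (t ^+ 2))); exact: measurable_snd.
have t4 : 0 <= t ^+ 4 by rewrite exprn_ge0// ltW.
have [nu nuE] := scaled_pushforward (lam2 \x lam)%E t4 mf.
suff H (A : set T3) : measurable A -> (lam2 \x lam)%E A = nu A.
  by move=> A mA; exact: etrans (H A mA) (nuE A).
move=> mA; pose m12 : {sigma_finite_measure set T2 -> \bar R} :=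
  HB.pack lam2 (Measure_isSigmaFinite.Build _ _ _ lam2 lebesgue2_sigma_finite).
apply: (@product_measure_unique _ _ _ _ R m12 lam nu _ A mA) => X Y mX mY.
pose f2 (v : T2) : T2 := (t * v.1 : R, t * v.2 : R).
pose f1 (x : TR) : TR := (t ^+ 2 * x : R).
have mf2 : measurable (f2 @^-1` X).
  rewrite -[X in measurable X]setTI; apply: (_ : measurable_fun setT f2) => //.
  have m1 : measurable_fun setT (fun x : TR => (t * x : R) : TR).
    exact: (@mulrl_measurable R setT t).
  apply: measurable_fun_pair.
    by apply: (measurableT_comp m1); exact: measurable_fst.
  by apply: (measurableT_comp m1); exact: measurable_snd.
have mf1 : measurable (f1 @^-1` Y).
  by rewrite -[X in measurable X]setTI; exact: (@mulrl_measurable R setT (t ^+ 2)).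
apply: etrans (nuE _) _.
apply: etrans (congr1 (fun z => ((t ^+ 4)%:E * z)%E)
  (product_measure1E lam2 lam mf2 mf1)) _.
apply: etrans _ (esym (congr2 (fun u v : \bar R => (u * v)%E)
  (lebesgue2_dil t0 mX) (lebesgue_dil (exprn_gt0 2 t0) mY))).
by rewrite (exprD t 2 2) EFinM muleACA.
Qed.

End Dilation.

(** * Null sets obtained from sections *)

Section NullSets.
Variable R : realType.
Notation lam := (@lebesgue_measure R).
Notation TR := (measurableTypeR R).
Notation lam2 := (lam \x lam)%E.

Lemma product_null_of_sections d (T : measurableType d) (m : {measure set T -> \bar R})
    (bad : set T) (X : set (T * TR)) :
  measurable bad -> m bad = 0%E -> (forall v, ~ bad v -> lam (xsection X v) = 0%E) ->
  (m \x lam)%E X = 0%E.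
Proof.
move=> mbad bad0 H; rewrite /product_measure1; apply/eqP; rewrite eq_le.
apply/andP; split; last by apply: integral_ge0 => v _; exact: measure_ge0.
rewrite -[X in (_ <= X)%E](@integral0 _ _ _ m setT).
apply: (ge0_integralT_le_off_null mbad bad0) => [v|v|v /H] /=.
- exact: measure_ge0.
- by [].
- by move=> ->.
Qed.

Lemma null_line (e : R * R) : e != 0 ->
  lam2 [set v : TR * TR | wedge e (v : R * R) = 0] = 0%E.
Proof.
move=> /pair_neq0 e0; apply: (@product_null_of_sections _ TR lam [set (0 : R)]).
- exact: measurable_set1.
- exact: lebesgue_measure_set1.
move=> a /= /eqP a0; have [e1|e1] := eqVneq e.1 0.
  have e2 : e.2 != 0 by case: e0 => //; rewrite e1 eqxx.
  rewrite [X in lam X](_ : _ = set0) ?measure0//.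
  apply/seteqP; split=> // b; rewrite /xsection /= inE /wedge /= e1 mul0r sub0r.
  by move=> /eqP; rewrite oppr_eq0 mulf_eq0 (negPf e2) (negPf a0).
rewrite [X in lam X](_ : _ = [set (e.2 * a / e.1 : R)]); first exact: lebesgue_measure_set1.
apply/seteqP; split=> b; rewrite /xsection /= inE /wedge /=.
  by move=> /eqP; rewrite subr_eq0 => /eqP <-; rewrite mulrAC divff// mul1r.
by move=> ->; field.
Qed.

(** [C] is a section of the closed cylinder over it, which reduces the plane to the
    three-dimensional case. *)
Lemma closed_measurable_plane (C : set (R * R)) : closed C -> measurable C.
Proof.
move=> cC; have : measurable (C `*` [set: R]).
  apply: closed_measurable_hpt; have -> : C `*` [set: R] = fst @^-1` C.
    by apply/seteqP; split=> -[u z] //= [].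
  by apply: preimage_closed => // x _; exact: cvg_fst.
move=> /(measurable_ysection (0 : R)).
rewrite (_ : ysection _ _ = C)//; apply/seteqP; split=> v; rewrite /ysection /= inE /=.
  by case.
by [].
Qed.

Lemma nongeneric_null (s : seq (R * R)) :
  let bad := [set v : R * R | has (fun e => (e != 0) && (wedge e v == 0)) s] in
  measurable bad /\ lam2 (bad : set (TR * TR)) = 0%E.
Proof.
elim: s => [|e s [mb b0]] bad.
  rewrite (_ : bad = set0); last by apply/seteqP; split.
  by split; [exact: measurable0|rewrite measure0].
pose b1 : set (R * R) := [set v | (e != 0) && (wedge e v == 0)].
have [m1 n1] : measurable b1 /\ lam2 (b1 : set (TR * TR)) = 0%E.
  rewrite /b1; have [->|e0] := eqVneq e 0.
    rewrite (_ : [set v | _] = set0); last by apply/seteqP; split.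
    by split; [exact: measurable0|rewrite measure0].
  have eqb : [set v : R * R | true && (wedge e v == 0)] = [set v | wedge e v = 0].
    by apply/seteqP; split=> v /= /eqP.
  rewrite eqb; split; last exact: null_line.
  apply: closed_measurable_plane.
  rewrite (_ : [set v | _] = (fun v => e.1 * v.2 + - (e.2 * v.1)) @^-1` [set 0])//.
  apply: preimage_closed; last exact: closed_eq.
  move=> v _; apply: continuous_add; last apply: continuous_opp;
    by apply: continuous_mul; [exact: continuous_const|move=> x; do ?exact: cvg_fst; do ?exact: cvg_snd].
pose b2 : set (R * R) := [set v : R * R | has (fun e => (e != 0) && (wedge e v == 0)) s].
have -> : bad = b1 `|` b2.
  by apply/seteqP; split=> v /=; [move=> /orP|move=> h; apply/orP].
split; first exact: measurableU.
have le2 : (lam2 ((b1 : set (TR * TR)) `|` b2) <= lam2 b1 + lam2 b2)%E by exact: measureU2.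
by apply/eqP; rewrite eq_le measure_ge0 andbT; apply: le_trans le2 _; rewrite n1 b0 adde0.
Qed.

Lemma null_subsingleton (A : set R) : (forall a b, A a -> A b -> a = b) -> finite_set A.
Proof.
move=> H; have [[a Aa]|h] := pselect (exists a, A a).
  by rewrite (_ : A = [set a])//; apply/seteqP; split=> [b Ab|b ->] //=; exact: H.
by rewrite (_ : A = set0)//; apply/seteqP; split=> // b Ab; apply: h; exists b.
Qed.

End NullSets.

(** * Comparison of the unique points with the regular cone *)

Section Volumes.
Variables (R : realType) (s : seq (R * R)).
Notation Q := (conv_hull s).
Hypothesis Qsym : centrally_symmetric Q.
Hypothesis Qint : interior Q !=set0.
Notation N := (normL Q).
Notation wdist := (wdist s).
Notation U := [set x | unique_geodesic Q x].
Implicit Types (x p q : hpt R).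

Lemma CCballE r : CCball Q r = [set x | wdist x <= r].
Proof.
by apply/seteqP; split=> x; rewrite /CCball /= (dCC_wdist Qsym Qint) lee_fin.
Qed.

Lemma ball_measurable (r : R) : measurable [set x | wdist x <= r].
Proof.
apply: closed_measurable_hpt.
exact: closed_le_fun (wdist_continuous Qsym Qint) (@continuous_const _ _ r).
Qed.

Lemma unique_measurable r : measurable (CCball Q r `&` U).
Proof.
have [G [cG eG]] := branching_closed_pieces Qsym Qint r.
rewrite (_ : _ `&` _ = CCball Q r `\` \bigcup_k G k).
  apply: measurableD; first by rewrite CCballE; exact: ball_measurable.
  by apply: bigcupT_measurable => k; exact: closed_measurable_hpt.
rewrite -eG CCballE; apply/seteqP; split=> x /= [xr].
  by move=> /(unique_geodesicP Qsym Qint) nb; split=> // -[_ /nb].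
by move=> nb; split=> //; apply/(unique_geodesicP Qsym Qint) => b; apply: nb.
Qed.

Lemma hdilV (t : R) x : t != 0 -> hdil t^-1 (hdil t x) = x.
Proof. by move=> t0; apply: hptE; [apply: pairE|] => /=; field. Qed.

Lemma branching_hdil (t : R) x : 0 < t -> branching s (hdil t x) <-> branching s x.
Proof.
have imp (u : R) y : 0 < u -> branching s y -> branching s (hdil u y).
  move=> u0 [p [q [l [pq hp hq]]]].
  have tr p' : on_geodesic s y p' l -> on_geodesic s (hdil u y) (hdil u p') (u * l).
    move=> [h1 h2]; split; first by rewrite wdist_dil// ler_pM2l.
    have -> : hmul (hinv (hdil u p')) (hdil u y) = hdil u (hmul (hinv p') y).
      apply: hptE; first by apply: pairE => /=; ring.
      by rewrite /=; unfold wedge; rewrite /=; ring.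
    by rewrite !wdist_dil// -mulrBr ler_pM2l.
  exists (hdil u p), (hdil u q), (u * l); split; [|exact: tr|exact: tr].
  move=> /(congr1 (hdil u^-1)); rewrite !hdilV ?gt_eqF//.
move=> t0; split; last exact: imp.
have ti : 0 < t^-1 by rewrite invr_gt0.
by move=> /(imp _ _ ti); rewrite hdilV// gt_eqF.
Qed.

Lemma hdil_ball (r : R) : 0 < r -> hdil r @^-1` (CCball Q r) = CCball Q 1.
Proof.
move=> r0; have e x : (wdist (hdil r x) <= r) = (wdist x <= 1).
  by rewrite wdist_dil// -[X in _ <= X]mulr1 ler_pM2l.
by rewrite !CCballE; apply/seteqP; split=> x /=; rewrite e.
Qed.

Lemma hdil_unique (r : R) : 0 < r -> hdil r @^-1` U = U.
Proof.
move=> r0; apply/seteqP; split=> x /=; rewrite !(unique_geodesicP Qsym Qint);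
  by apply: contra_not => /(branching_hdil _ r0).
Qed.

Definition regular_ball := [set x : hpt R | N x.1 < wdist x /\ wdist x <= 1].

Lemma regular_ball_measurable : measurable regular_ball.
Proof.
rewrite (_ : regular_ball = [set x | wdist x <= 1] `\` [set x | wdist x <= N x.1]).
  apply: measurableD; first exact: ball_measurable.
  apply: closed_measurable_hpt; apply: closed_le_fun.
    exact: wdist_continuous.
  exact: normL_fst_continuous.
apply/seteqP; split=> x /= [h1 h2]; split=> //.
  by apply/negP; rewrite -ltNge.
by rewrite ltNge; apply/negP.
Qed.

(** A point off the wall is rescaled to the unit sphere by the inverse of its distance. The origin
    appears because the parameter [t = 0] in [reg_cone] collapses the sphere to it. *)
Lemma reg_cone_sub : regular_ball `<=` reg_cone Q /\
  reg_cone Q `<=` regular_ball `|` [set horigin R].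
Proof.
split=> [x [Nx x1]|_ [p [t [dp [/(interior_normL Qsym Qint) Np [/andP[t0 t1] ->]]]]]].
  have d0 : 0 < wdist x by exact: le_lt_trans (normL_ge0 Qsym Qint _) Nx.
  have di : 0 < (wdist x)^-1 by rewrite invr_gt0.
  exists (hdil (wdist x)^-1 x), (wdist x); split.
    by rewrite /CCsphere /= (dCC_wdist Qsym Qint) wdist_dil// mulVf ?gt_eqF.
  split.
    apply/(interior_normL Qsym Qint).
    rewrite [X in N X](_ : _ = vsc (wdist x)^-1 x.1)// normLZ ?(ltW di)//.
    by rewrite mulrC ltr_pdivrMr// mul1r.
  split; first by rewrite (ltW d0).
  by rewrite -[in LHS](hdilV x (lt0r_neq0 di)) invrK.
move: dp; rewrite /CCsphere /= (dCC_wdist Qsym Qint) => -[dp].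
move: t0; rewrite le_eqVlt => /predU1P[<-|t0].
  by right; apply: hptE; [apply: pairE|] => /=; ring.
left; rewrite /regular_ball /= wdist_dil// dp mulr1; split=> //.
rewrite [X in N X](_ : _ = vsc t p.1)// normLZ ?(ltW t0)//.
by rewrite -[X in _ < X]mulr1 ltr_pM2l.
Qed.

Lemma origin_not_branching : ~ branching s (horigin R).
Proof.
move=> [p [q [l [pq hp hq]]]]; apply: pq.
have [p1 p2] := on_geodesic_eq Qsym Qint hp; have [q1 q2] := on_geodesic_eq Qsym Qint hq.
rewrite (wdist0 Qsym Qint) in p2.
have h1 := wdist_ge0 Qsym Qint (hmul (hinv p) (horigin R)).
have h2 := wdist_ge0 Qsym Qint p.
have l0 : l = 0 by lra.
by rewrite (wdist_eq0 Qsym Qint (etrans p1 l0)) (wdist_eq0 Qsym Qint (etrans q1 l0)).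
Qed.

Lemma reg_cone_measurable : measurable (reg_cone Q).
Proof.
have [sub1 sub2] := reg_cone_sub.
have m0 : measurable [set horigin R].
  rewrite (_ : [set _] = [set x | wdist x <= 0]); first exact: ball_measurable.
  apply/seteqP; split=> x /=; first by move=> ->; rewrite (wdist0 Qsym Qint).
  move=> h; apply: (wdist_eq0 Qsym Qint); apply/eqP.
  by rewrite eq_le h (wdist_ge0 Qsym Qint).
have [h0|h0] := pselect (reg_cone Q (horigin R)).
  rewrite (_ : reg_cone Q = regular_ball `|` [set horigin R]).
    by apply: measurableU => //; exact: regular_ball_measurable.
  by apply/seteqP; split=> // x [/sub1|->].
rewrite (_ : reg_cone Q = regular_ball); first exact: regular_ball_measurable.
by apply/seteqP; split=> // x xr; have [//|e] := sub2 _ xr; rewrite e in xr.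
Qed.

(* Over a fixed [v], at most one point of each sign of the height lies on the
   wall [wdist = N] without being branching. *)
Lemma wall_section_finite (v : R * R) :
  finite_set [set z : R | wdist (v, z) <= N v /\ ~ branching s (v, z)].
Proof.
set S := [set z | _].
have wall z : wdist (v, z) <= N v -> wdist (v, z) = N v.
  by move=> h; apply/eqP; rewrite eq_le h (normL_wdist Qsym Qint (v, z)).
have pos z z' : 0 < z -> z < z' -> S z -> S z' -> False.
  by move=> z0 zz' [_ nb] [/wall h _]; apply: nb; exact: (wall_branching_pos Qsym Qint z0 zz' h).
have Sneg z : S z -> S (- z).
  move=> [h nb]; split; first by rewrite -(wdist_hrefl Qsym Qint (v, - z)) /hrefl /= opprK.
  by move=> /(branching_hrefl Qsym Qint); rewrite /hrefl /= opprK.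
have sub z z' : 0 < z -> 0 < z' -> S z -> S z' -> z = z'.
  move=> z0 z'0 h h'; case: (ltgtP z z') => // l; exfalso.
    exact: (pos _ _ z0 l h h').
  exact: (pos _ _ z'0 l h' h).
apply: (@sub_finite_set _ _ ([set 0] `|` ([set z | 0 < z] `&` S) `|` ([set z | z < 0] `&` S))).
  move=> z Sz; have [z0|z0|z0] := ltgtP z 0; [by right|by left; right|by left; left].
rewrite !finite_setU; split; first split.
- exact: finite_set1.
- by apply: null_subsingleton => a b [a0 Sa] [b0 Sb]; exact: sub.
- apply: null_subsingleton => a b [/= a0 Sa] [/= b0 Sb]; apply: oppr_inj.
  by apply: sub; rewrite ?oppr_gt0//; exact: Sneg.
Qed.

(** The two differences are null for different reasons. Uniquely reached points outside the cone lie
    on the wall, with finitely many over each [v]; branching points of the cone lie over the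
    finitely many lines through nonzero vertices. *)
Lemma vol_regular : vol (CCball Q 1 `&` U) = vol (reg_cone Q).
Proof.
have mX := unique_measurable 1; have mY := reg_cone_measurable.
set X := CCball Q 1 `&` U in mX *; set Y := reg_cone Q in mY *.
have [sub1 sub2] := reg_cone_sub.
have XY : vol (X `\` Y) = 0%E.
  apply: (@product_null_of_sections R _ _ (lebesgue_measure \x lebesgue_measure)%E set0).
  - exact: measurable0.
  - by rewrite measure0.
  move=> v _; apply: countable_lebesgue_measure0; apply: finite_set_countable.
  apply: sub_finite_set (wall_section_finite v) => z; rewrite /xsection /= inE => -[[]].
  rewrite CCballE /= => h /(unique_geodesicP Qsym Qint) nb nY; split=> //.
  rewrite leNgt; apply/negP => lt; apply: nY; exact: sub1.
have YX : vol (Y `\` X) = 0%E.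
  have [mb b0] := nongeneric_null s.
  apply: (@product_null_of_sections R _ _ (lebesgue_measure \x lebesgue_measure)%E _ _ mb b0).
  move=> v /negP/hasPn gen; rewrite [X in lebesgue_measure X](_ : _ = set0) ?measure0//.
  apply/seteqP; split=> // z; rewrite /xsection /= inE => -[/sub2 Yz nX]; apply: nX.
  case: Yz => [[h1 h2]|->]; rewrite /X CCballE /=; last first.
    split; first by rewrite /= (wdist0 Qsym Qint).
    apply/(unique_geodesicP Qsym Qint); exact: origin_not_branching.
  split=> //; apply/(unique_geodesicP Qsym Qint); apply: (generic_unique Qsym Qint h1).
  move=> i i0; have := gen (vert i); rewrite mem_nth// i0 => /(_ erefl).
  exact.
pose V : {measure set _ -> \bar R} :=
  ((@lebesgue_measure R \x @lebesgue_measure R) \x @lebesgue_measure R)%E.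
have eX : vol X = (vol (X `\` Y) + vol (X `&` Y))%E := measureDI V mX mY.
have eY : vol Y = (vol (Y `\` X) + vol (Y `&` X))%E := measureDI V mY mX.
by rewrite eX eY XY YX setIC.
Qed.

(** For infinite [V] both sides are 0 by the default value of [fine]. *)
Lemma fine_scale (c : R) (V : \bar R) : 0 < c -> fine (c%:E * V) = c * fine V.
Proof.
move=> c0; case: V => [v| |] //=.
  by rewrite gt0_muley ?lte_fin//= mulr0.
by rewrite gt0_muleNy ?lte_fin//= mulr0.
Qed.

Lemma unique_ratioE (r : R) : 0 < r ->
  unique_ratio Q r = fine (vol (reg_cone Q)) / fine (vol (CCball Q 1)).
Proof.
move=> r0; have r4 : 0 < r ^+ 4 by rewrite exprn_gt0.
have mB : measurable (CCball Q r) by rewrite CCballE; exact: ball_measurable.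
have pU : hdil r @^-1` (CCball Q r `&` U) = CCball Q 1 `&` U.
  by rewrite preimage_setI (hdil_ball r0) (hdil_unique r0).
have e1 := vol_dil r0 (unique_measurable r); have e2 := vol_dil r0 mB.
rewrite pU in e1; rewrite (hdil_ball r0) in e2.
rewrite /unique_ratio e1 e2 vol_regular.
rewrite !(fine_scale _ r4) invfM mulrACA divff ?mul1r//.
exact: lt0r_neq0.
Qed.

End Volumes.

Unset Implicit Arguments.

Theorem mainTheorem8 (R : realType) (Q : set (R * R))
  (Qpoly : is_convex_polygon Q) (Qsym : centrally_symmetric Q)
  (Qint : interior Q !=set0) :
  (forall r : R, 0 < r ->
     measurable (CCball Q r `&` [set x | unique_geodesic Q x]) /\
     unique_ratio Q r = fine (vol (reg_cone Q)) / fine (vol (CCball Q 1))) /\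
  (unique_ratio Q r @[r --> +oo] --> fine (vol (reg_cone Q)) / fine (vol (CCball Q 1))).
Proof.
have [s Qs] := Qpoly; subst Q; split=> [r r0|].
  by split; [exact: unique_measurable|exact: unique_ratioE].
(* The ratio is constant for positive [r], so the asymptotic density is that constant. *)
apply: cvg_near_cst; near=> r; exact: unique_ratioE.
Unshelve. all: by end_near. Qed.
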